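(* Let $d\in\mathbb{N}$, let $M\in\mathcal{S}^d$ and $\Psi,\Sigma\in\mathcal{S}_{++}^d$ be such that $\Psi\Sigma=\Sigma\Psi$. Let $(\mathfrak{Y}_t)_{t\ge0}$ be the $\mathcal{S}^d$-valued process solving $$\mathrm{d}\mathfrak{Y}_t=-(\mathfrak{Y}_t-M)\,\mathrm{d}t+\tfrac1{\sqrt2}\Psi^{1/2}\mathrm{d}\mathfrak{B}_t\Sigma^{1/2}+\tfrac1{\sqrt2}\Sigma^{1/2}\mathrm{d}\mathfrak{B}_t^\top\Psi^{1/2},\qquad \mathfrak{Y}_0=Y\in\mathcal{S}^d,$$ where $(\mathfrak{B}_t)_{t\ge0}$ is a $d\times d$ matrix of independent standard Brownian motions; let $\mathcal{P}_tf(Y)=\mathsf{E}[f(\mathfrak{Y}_t)\mid\mathfrak{Y}_0=Y]$ be its transition semigroup, and let $\mathfrak{Y}_\infty\sim\gamma_{M,\Psi,\Sigma}:=\mathcal{SN}_{d\times d}(M,\Psi,\Sigma)$, its stationary limiting distribution. For every test function $h$ belonging either to $C^{0,\beta}(\mathcal{S}^d)$ for some $\beta\in(0,1]$ or to $\mathrm{Lip}^{\mathrm{s}}_p(\mathcal{S}^d)$ for some $p\in\mathbb{N}_0$, the function $$f_h(Y):=-\int_0^\infty\Big\{\mathcal{P}_th(Y)-\mathsf{E}[h(\mathfrak{Y}_\infty)]\Big\}\,\mathrm{d}t,\qquad Y\in\mathcal{S}^d,$$ is well defined pointwise and solves the Stein equation in the pointwise sense: for every $Y\in\mathcal{S}^d$,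 $$\lim_{s\downarrow0}\frac{\mathcal{P}_sf_h(Y)-f_h(Y)}{s}=h(Y)-\mathsf{E}[h(\mathfrak{Y}_\infty)].$$ Moreover, if $h\in C^{0,\beta}(\mathcal{S}^d)$ for some $\beta\in(0,1]$, then for every $Y\in\mathcal{S}^d$, $$|f_h(Y)|\le\frac1\beta[h]_{\beta,\mathcal{S}}\,d^{\mathcal{S}}_{\mathrm{HK},\beta}(\delta_Y,\gamma_{M,\Psi,\Sigma})\le\frac1\beta[h]_{\beta,\mathcal{S}}\Big\{\mathsf{E}\big[\|\mathfrak{Y}_\infty-M\|_F^\beta\big]+\|Y-M\|_F^\beta\Big\},$$ where $\delta_Y$ is the unit point mass at $Y$.
   Context: $\mathcal{S}^d$ and $\mathcal{S}_{++}^d$ are the sets of real symmetric and of real symmetric positive definite $d\times d$ matrices; $\mathcal{S}^d$ carries the Frobenius inner product $\langle A,B\rangle_F=\mathrm{tr}(A^\top B)$ and norm $\|\cdot\|_F$. $\Psi^{1/2},\Sigma^{1/2}$ are symmetric square roots. $\mathbb{N}_0=\{0,1,2,\ldots\}$. Symmetric matrix normal distribution: let $q_d=d(d+1)/2$, $[q_d]=\{1,\dots,q_d\}$, fix an ordering $\{(i_a,j_a):a\in[q_d]\}$ of $\{(i,j):1\le i\le j\le d\}$, and let $\mathrm{vecs}(S)=(r_aS_{i_aj_a})_{a}\in\mathbb{R}^{q_d}$ with $r_a=1$ if $i_a=j_a$ and $r_a=\sqrt2$ if $i_a<j_a$ (an isometry from $\mathcal{S}^d$ onto $\mathbb{R}^{q_d}$).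 Let $E_a\in\mathcal{S}^d$ be the matrix with $\mathrm{vecs}(E_a)$ equal to the $a$-th standard basis vector of $\mathbb{R}^{q_d}$. For commuting $\Psi,\Sigma\in\mathcal{S}_{++}^d$, let $\Omega_{\Psi,\Sigma}$ be the $q_d\times q_d$ matrix with entries $(\Omega_{\Psi,\Sigma})_{ab}=\langle K_{\Psi,\Sigma}E_a,E_b\rangle_F$, where $K_{\Psi,\Sigma}U=(\Psi U\Sigma+\Sigma U\Psi)/2$. A random matrix $\mathfrak{Z}\in\mathcal{S}^d$ has law $\mathcal{SN}_{d\times d}(M,\Psi,\Sigma)$ if $\mathrm{vecs}(\mathfrak{Z})\sim\mathcal{N}_{q_d}(\mathrm{vecs}(M),\Omega_{\Psi,\Sigma})$. The semigroup $\mathcal{P}_tf$ is defined for every measurable $f$ for which the expectation is finite. Function classes: for $\beta\in(0,1]$ and $h:\mathcal{S}^d\to\mathbb{R}$, $[h]_{\beta,\mathcal{S}}:=\sup_{S\ne T}|h(S)-h(T)|/\|S-T\|_F^\beta$ and $C^{0,\beta}(\mathcal{S}^d):=\{h:[h]_{\beta,\mathcal{S}}<\infty\}$. For $\mathbf{a}=(a_1,\dots,a_k)\in[q_d]^k$, the coordinate directional derivative is $D^{\mathrm{s}}_{\mathbf{a}}f(S)=D^kf(S)[E_{a_1},\dots,E_{a_k}]$ ($D^k$ the $k$-th Fréchet derivative), equivalently the corresponding coordinate partial derivative of $f\circ\mathrm{vecs}^{-1}$ at $\mathrm{vecs}(S)$; for $k=0$ it is $f$ itself. $\mathrm{Lip}^{\mathrm{s}}_p(\mathcal{S}^d)$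 is the class of functions on $\mathcal{S}^d$ whose coordinate directional derivatives up to order $p$ exist and whose coordinate directional derivatives of order $p$ all belong to $C^{0,1}(\mathcal{S}^d)$. For probability measures $\mu,\nu$ on $\mathcal{S}^d$ with finite $\beta$-th moments, $d^{\mathcal{S}}_{\mathrm{HK},\beta}(\mu,\nu):=\sup\{|\int h\,\mathrm{d}\mu-\int h\,\mathrm{d}\nu|:h\in C^{0,\beta}(\mathcal{S}^d),\ [h]_{\beta,\mathcal{S}}\le1\}$. *)

(* Defs.v *)
From HB Require Import structures.
From mathcomp Require Import all_boot all_order all_algebra.
From mathcomp Require Import all_classical all_reals all_analysis.

Set Implicit Arguments.
Unset Strict Implicit.
Unset Printing Implicit Defensive.

Import Order.TTheory GRing.Theory Num.Theory.
Import numFieldNormedType.Exports.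

Local Open Scope classical_set_scope.
Local Open Scope ring_scope.

Definition frob (R : realType) (m n : nat) (A B : 'M[R]_(m, n)) : R :=
  \tr (A^T *m B).

Section Frobenius.
Context {R : realType} {m n : nat}.
Implicit Types A B : 'M[R]_(m, n).

Lemma frobE A B : frob A B = \sum_i \sum_j A i j * B i j.
Proof.
rewrite /frob exchange_big; apply: eq_bigr => j _; rewrite !mxE.
by apply: eq_bigr => i _; rewrite !mxE.
Qed.

Lemma frobC A B : frob A B = frob B A.
Proof.
by rewrite !frobE; apply: eq_bigr => i _; apply: eq_bigr => j _; rewrite mulrC.
Qed.

Lemma frobDl A B C : frob (A + B) C = frob A C + frob B C.
Proof. by rewrite /frob linearD /= mulmxDl linearD. Qed.

Lemma frobZl a A B : frob (a *: A) B = a * frob A B.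
Proof. by rewrite /frob linearZ /= -scalemxAl linearZ. Qed.

Lemma frob_ge0 A : 0 <= frob A A.
Proof.
by rewrite frobE; do 2![apply: sumr_ge0 => ? _]; rewrite -expr2 sqr_ge0.
Qed.

Lemma frob_eq0 A : frob A A = 0 -> A = 0.
Proof.
rewrite frobE => /eqP.
rewrite psumr_eq0; last first.
  by move=> i _; apply: sumr_ge0 => j _; rewrite -expr2 sqr_ge0.
move=> /allP A0; apply/matrixP => i j; rewrite mxE.
have := A0 i (mem_index_enum i); rewrite psumr_eq0; last first.
  by move=> k _; rewrite -expr2 sqr_ge0.
by move=> /allP /(_ j (mem_index_enum j)); rewrite mulf_eq0 orbb => /eqP.
Qed.

Lemma frob_cauchy_schwarz A B : frob A B ^+ 2 <= frob A A * frob B B.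
Proof.
have [B0|B0] := eqVneq (frob B B) 0.
  by rewrite (frob_eq0 B0) -(scale0r 0) frobC !frobZl !mul0r expr0n mulr0.
have Bgt0 : 0 < frob B B by rewrite lt_def B0 frob_ge0.
have := frob_ge0 (frob B B *: A + (- frob A B) *: B).
rewrite frobDl !frobZl ![frob _ (_ + _)]frobC !frobDl !frobZl (frobC B A).
have -> : frob B B * (frob B B * frob A A + - frob A B * frob A B) +
    - frob A B * (frob B B * frob A B + - frob A B * frob B B) =
    frob B B * (frob A A * frob B B - frob A B ^+ 2).
  by rewrite [X in _ + X](_ : _ = 0) ?addr0; [congr (_ * _);
     rewrite mulNr expr2 [_ * frob A A]mulrC
   | rewrite mulNr [X in _ * (X + _)]mulrC mulNr subrr mulr0 oppr0].
by rewrite pmulr_rge0// subr_ge0.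
Qed.

Lemma sqrt_frobD A B :
  Num.sqrt (frob (A + B) (A + B)) <=
  Num.sqrt (frob A A) + Num.sqrt (frob B B).
Proof.
rewrite -[leRHS]ger0_norm ?addr_ge0 ?sqrtr_ge0// -sqrtr_sqr ler_wsqrtr//.
rewrite sqrrD !sqr_sqrtr ?frob_ge0//.
rewrite frobDl ![frob _ (_ + _)]frobC !frobDl (frobC B A) addrA.
rewrite lerD2r -addrA lerD2l -mulr2n lerMn2r orFb.
rewrite -sqrtrM ?frob_ge0// (le_trans (ler_norm _))// -sqrtr_sqr ler_wsqrtr//.
exact: frob_cauchy_schwarz.
Qed.

End Frobenius.

Definition symmx (R : realType) (d : nat) : {pred 'M[R]_d} :=
  fun A => A^T == A.
Arguments symmx {R d}.

Fact symmx_submod_closed (R : realType) (d : nat) :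
  submod_closed (@symmx R d).
Proof.
split => [|a A B]; first by rewrite unfold_in trmx0.
by rewrite !unfold_in => /eqP AE /eqP BE; rewrite linearP /= AE BE.
Qed.

HB.instance Definition _ (R : realType) (d : nat) :=
  GRing.isSubmodClosed.Build R 'M[R]_d (@symmx R d)
    (@symmx_submod_closed R d).

Record symM (R : realType) (d : nat) : Type :=
  SymM { symval :> 'M[R]_d ; _ : symval \in symmx }.

HB.instance Definition _ (R : realType) (d : nat) := [isSub for @symval R d].
HB.instance Definition _ (R : realType) (d : nat) :=
  [Choice of symM R d by <:].
HB.instance Definition _ (R : realType) (d : nat) :=
  [SubChoice_isSubLmodule of symM R d by <:].

Section SymNorm.
Variables (R : realType) (d : nat).

Definition sym_norm (S : symM R d) : R := Num.sqrt (frob S S).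

Fact sym_normD (S T : symM R d) :
  sym_norm (S + T) <= sym_norm S + sym_norm T.
Proof. exact: sqrt_frobD. Qed.

Fact sym_normZ (a : R) (S : symM R d) : sym_norm (a *: S) = `|a| * sym_norm S.
Proof.
have aS : a *: S = a *: symval S :> 'M[R]_d by [].
rewrite /sym_norm aS frobZl frobC frobZl mulrA -expr2.
by rewrite sqrtrM ?sqr_ge0// sqrtr_sqr.
Qed.

Fact sym_norm_eq0 (S : symM R d) : sym_norm S = 0 -> S = 0.
Proof.
move=> /eqP; rewrite sqrtr_eq0 => S0; apply/val_inj; apply: frob_eq0.
by apply/eqP; rewrite eq_le S0 frob_ge0.
Qed.

HB.instance Definition _ :=
  @Lmodule_isNormed.Build R (symM R d) sym_norm sym_normD sym_normZ
    sym_norm_eq0.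

HB.instance Definition _ :=
  Measurable.copy (symM R d) (g_sigma_algebraType (@open (symM R d))).

Lemma symM_normE (S : symM R d) : `|S| = Num.sqrt (frob S S).
Proof. by []. Qed.

End SymNorm.

Definition posdef (R : realType) (d : nat) (A : symM R d) : Prop :=
  forall v : 'rV[R]_d, v != 0 -> 0 < (v *m A *m v^T) ord0 ord0.

Definition qd (d : nat) : nat := (d * d.+1)./2.

(* An enumeration of the pairs (i, j) with i <= j. *)
Definition vecs_ordering (d : nat) (o : 'I_(qd d) -> 'I_d * 'I_d) : Prop :=
  injective o /\ forall i j : 'I_d, ((i, j) \in codom o) = (i <= j)%N.

Section Coordinates.
Context {R : realType} {d : nat} (o : 'I_(qd d) -> 'I_d * 'I_d).

Definition vecs_weight (a : 'I_(qd d)) : R :=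
  if (o a).1 == (o a).2 then 1 else Num.sqrt 2.

Definition vecs (S : symM R d) : 'rV[R]_(qd d) :=
  \row_a (vecs_weight a * S (o a).1 (o a).2).

Definition basis_mx (a : 'I_(qd d)) : 'M[R]_d :=
  \matrix_(i, j) ((((i, j) == o a) || ((j, i) == o a))%:R / vecs_weight a).

Fact basis_mx_sym (a : 'I_(qd d)) : basis_mx a \in symmx.
Proof. by apply/eqP/matrixP => i j; rewrite !mxE orbC. Qed.

Definition basis (a : 'I_(qd d)) : symM R d := SymM (basis_mx_sym a).

(* This characterizes [basis a], [vecs] being injective. *)
Lemma vecs_basis (a : 'I_(qd d)) :
  vecs_ordering o -> vecs (basis a) = delta_mx ord0 a.
Proof.
move=> [inj_o codom_o]; have o_le b : ((o b).1 <= (o b).2)%N.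
  by rewrite -codom_o -surjective_pairing codom_f.
have w_neq0 b : vecs_weight b != 0.
  by rewrite /vecs_weight; case: ifP => _; rewrite ?oner_eq0// sqrtr_eq0 -ltNge.
apply/rowP => b; rewrite !mxE eqxx /= -surjective_pairing (inj_eq inj_o).
have [->|ba] /= := eqVneq b a; first by rewrite mul1r divff.
case: eqP => [ab|_]; last by rewrite mul0r mulr0.
case/eqP: ba; apply: inj_o; rewrite [LHS]surjective_pairing -ab.
move: (o_le a) (o_le b); rewrite -ab /= => le1 le2.
by congr pair; apply/val_inj/eqP; rewrite eqn_leq le1 le2.
Qed.

Lemma vecs_inj : vecs_ordering o -> injective vecs.
Proof.
move=> [_ codom_o] S T /rowP ST; apply/val_inj/matrixP => i j.
have w_neq0 b : vecs_weight b != 0.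
  by rewrite /vecs_weight; case: ifP => _; rewrite ?oner_eq0// sqrtr_eq0 -ltNge.
have le_eq (k l : 'I_d) : (k <= l)%N -> S k l = T k l.
  rewrite -codom_o => /codomP[a ao]; have := ST a.
  by rewrite !mxE -ao => /(mulfI (w_neq0 a)).
have sym_entry (U : symM R d) : U i j = U j i.
  by case: U => U /= /eqP UT; rewrite -[in LHS]UT mxE.
have [/le_eq//|/ltnW/le_eq ji] := leqP i j.
by rewrite [LHS]sym_entry [RHS]sym_entry.
Qed.

(* [coord_derive [:: a1; ...; ak] f S] stands for D^k f(S)[E_a1, ..., E_ak].  In
   [lip_sym], all the derivatives of order p are continuous, so that existence of
   the iterated directional derivatives amounts to f being C^p. *)
Fixpoint coord_derive (a : seq 'I_(qd d)) (f : symM R d -> R) : symM R d -> R :=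
  if a is b :: a' then 'D_(basis b) (coord_derive a' f) else f.

End Coordinates.

Section FunctionClasses.
Context {R : realType} {d : nat}.
Implicit Types (b : R) (h : symM R d -> R).

Definition holder_seminorm b h : \bar R :=
  ereal_sup [set x : \bar R | exists S T : symM R d,
    S != T /\ x = (`|h S - h T| / `|S - T| `^ b)%:E].

Definition holder b h : Prop := (holder_seminorm b h < +oo)%E.

Definition lip_sym (o : 'I_(qd d) -> 'I_d * 'I_d) (p : nat) h : Prop :=
  (forall a : seq 'I_(qd d), (size a < p)%N ->
    forall (S : symM R d) (i : 'I_(qd d)),
      derivable (coord_derive o a h) S (basis o i)) /\
  (forall a : seq 'I_(qd d), size a = p -> holder 1 (coord_derive o a h)).

Definition finite_moment b (mu : {measure set (symM R d) -> \bar R}) : Prop :=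
  mu.-integrable setT (fun S => (`|S| `^ b)%:E).

(* Meaningful for probability measures with finite [b]-th moment. *)
Definition dHK b (mu nu : {measure set (symM R d) -> \bar R}) : \bar R :=
  ereal_sup [set x : \bar R | exists h : symM R d -> R,
    [/\ holder b h, (holder_seminorm b h <= 1)%E &
        x = `|\int[mu]_S h S - \int[nu]_S h S|%:E]].

End FunctionClasses.

(* The variance [v = 0] is treated apart because [normal_prob m 0] is not a
   point mass. *)
Definition gauss1 (R : realType) (m v : R) : set R -> \bar R :=
  if v == 0 then \d_m else normal_prob m (Num.sqrt v).

Section Gaussian.
Context {disp : measure_display} {T : measurableType disp} {R : realType}.
Variable P : probability T R.

Definition gaussian_rv (X : T -> R) (m v : R) : Prop :=
  measurable_fun setT X /\
  forall A : set R, measurable A -> P (X @^-1` A) = gauss1 m v A.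

(* Multivariate normal law, possibly degenerate: every linear functional is
   normal with the prescribed mean and variance. *)
Definition gaussian_vector (q : nat) (Z : T -> 'rV[R]_q) (m : 'rV[R]_q)
    (Om : 'M[R]_q) : Prop :=
  forall u : 'rV[R]_q,
    gaussian_rv (fun w => (u *m (Z w)^T) ord0 ord0)
      ((u *m m^T) ord0 ord0) ((u *m Om *m u^T) ord0 ord0).

Definition sn_operator (d : nat) (Psi Sigma : symM R d) (U : 'M[R]_d) :
    'M[R]_d :=
  2^-1 *: (Psi *m U *m Sigma + Sigma *m U *m Psi).

Definition sn_covariance (d : nat) (o : 'I_(qd d) -> 'I_d * 'I_d)
    (Psi Sigma : symM R d) : 'M[R]_(qd d) :=
  \matrix_(a, b) frob (sn_operator Psi Sigma (basis o a)) (basis o b).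

Definition symmetric_normal (d : nat) (o : 'I_(qd d) -> 'I_d * 'I_d)
    (Z : T -> symM R d) (M Psi Sigma : symM R d) : Prop :=
  gaussian_vector (fun w => vecs o (Z w)) (vecs o M)
    (sn_covariance o Psi Sigma).

Definition independent_classes (I : finType) (F : I -> set_system T) : Prop :=
  forall (J : {set I}) (A : I -> set T), (forall i, i \in J -> F i (A i)) ->
    P (\bigcap_(i in [set` J]) A i) = (\prod_(i in J) P (A i))%E.

Definition independent_rvs (I : finType) (X : I -> T -> R) : Prop :=
  independent_classes (fun i => preimage_set_system setT (X i) measurable).

Definition process_sigma (W : R -> T -> R) : set_system T :=
  <<s [set A | exists2 t : R, 0 <= t &
               preimage_set_system setT (W t) measurable A] >>.

(* Processes are indexed by all reals but constrained at times t >= 0 only. *)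
Record brownian_motion (W : R -> T -> R) : Prop := BrownianMotion {
  bm_measurable : forall t, 0 <= t -> measurable_fun setT (W t) ;
  bm_start : {ae P, forall w, W 0 w = 0} ;
  bm_independent : forall (n : nat) (t : nat -> R), 0 <= t 0%N ->
    (forall i, t i <= t i.+1) ->
    independent_rvs (fun (i : 'I_n) w => W (t i.+1) w - W (t i) w) ;
  bm_gaussian : forall s t, 0 <= s -> s <= t ->
    gaussian_rv (fun w => W t w - W s w) 0 (t - s) ;
  bm_continuous :
    {ae P, forall w, {within `[0, +oo[, continuous (fun t => W t w)}} }.

Definition brownian_matrix (d : nat) (B : R -> T -> 'M[R]_d) : Prop :=
  (forall i j, brownian_motion (fun t w => B t w i j)) /\
  independent_classes
    (fun ij : 'I_d * 'I_d => process_sigma (fun t w => B t w ij.1 ij.2)).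

(* The equation
     dX_t = - (X_t - M) dt + 2^(-1/2) Ph dB_t Sh + 2^(-1/2) Sh dB_t^T Ph
   in integral form.  The integrands of the stochastic integrals being constant
   and B_0 being 0, these integrals are Ph B_t Sh and Sh B_t^T Ph. *)
Definition ou_solution (d : nat) (B : R -> T -> 'M[R]_d) (M Ph Sh Y : symM R d)
    (X : R -> T -> symM R d) : Prop :=
  (forall t, 0 <= t -> measurable_fun setT (X t)) /\
  {ae P, forall w,
    {within `[0, +oo[, continuous (fun t => X t w)} /\
    forall t, 0 <= t -> forall i j : 'I_d,
      X t w i j = Y i j
        - \int[lebesgue_measure]_(s in `[0, t]) (X s w i j - M i j)
        + ((Num.sqrt 2)^-1 *: (Ph *m B t w *m Sh)
           + (Num.sqrt 2)^-1 *: (Sh *m (B t w)^T *m Ph)) i j}.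

(* [X Y] is the process started at [Y]. *)
Definition semigroup_defined (d : nat) (X : symM R d -> R -> T -> symM R d)
    (t : R) (f : symM R d -> R) (Y : symM R d) : Prop :=
  measurable_fun setT f /\ P.-integrable setT (fun w => (f (X Y t w))%:E).

Definition semigroup (d : nat) (X : symM R d -> R -> T -> symM R d)
    (t : R) (f : symM R d -> R) (Y : symM R d) : R :=
  \int[P]_w f (X Y t w).

Definition stein_solution (d : nat) (X : symM R d -> R -> T -> symM R d)
    (h : symM R d -> R) (Eh : R) (Y : symM R d) : R :=
  - \int[lebesgue_measure]_(t in `[0, +oo[) (semigroup X t h Y - Eh).

End Gaussian.

(* Main.v *)
(* The equation for Y is linear with additive noise, so an implicit Euler scheme
   writes <U, Y_t> as a limit of sums of independent Gaussian increments, which gives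
   its characteristic function.  Characteristic functions determine laws on S^d, hence
   Mehler's formula: started at S, Y_t has the law of
     M + e^(-t) (S - M) + (1 - e^(-2t))^(1/2) (Y_oo - M).
   Both classes of test functions satisfy
     |h S - h T| <= C (1 + |S| + |T|)^N |S - T|^b,
   so that P_t h - E h(Y_oo) decays like e^(-bt).  The semigroup property and Fubini's
   theorem give P_s f_h - f_h = int_0^s (P_t h - E h(Y_oo)) dt, whose average over
   [0, s] tends to h - E h(Y_oo).  When h is Hoelder, P_t h - E h(Y_oo) has mean 0 under
   the stationary law and seminorm at most e^(-bt) [h], so it is bounded by
   e^(-bt) [h] d_HK; integrating in t yields the factor 1/b. *)
Require Import Defs.
From HB Require Import structures.
From mathcomp Require Import all_boot all_order all_algebra.
From mathcomp Require Import all_classical all_reals all_analysis.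
From mathcomp Require Import measurable_realfun.
From mathcomp Require Import ring lra.

Set Implicit Arguments.
Unset Strict Implicit.
Unset Printing Implicit Defensive.

Import Order.TTheory GRing.Theory Num.Theory.
Import numFieldNormedType.Exports.
Import HBNNSimple.
(* Restores [basis], shadowed by the topological notion of the same name. *)
Import Defs.

Local Open Scope classical_set_scope.
Local Open Scope ring_scope.

(** * Bounded measurable functions *)

(** The hypotheses give one solution for each start, with no measurability in the start and no
    Markov property. This is why everything is moved to Mehler's representation, which is jointly
    measurable in time, start and noise, and in which the semigroup property is an identity between
    characteristic functions. As the equation holds path by path, a deterministic scheme replaces
    stochastic integration; the implicit scheme multiplies errors by 1 / (1 + t/n) <= 1, so they
    never amplify. Characteristic functions are kept real: E cos(<U, Y> + th) for all phases th
    carries the same information as E exp(i <U, Y>). Mehler's formula is used as a coupling: one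
    noise Y_oo serves all times and all starts, so bounds on P_t h come from bounds for each
    outcome. The class given by the growth inequality is stable under h |-> f_h with the same b and
    N, so P_s f_h makes sense; for N = 0 no constant is lost, as the sharp factor 1/b requires. *)

Lemma cvg_Rintegral_dominated {disp : measure_display}
    {T : measurableType disp} {R : realType} (mu : {measure set T -> \bar R})
    (f_ : nat -> T -> R) (f g : T -> R) :
  (forall n, measurable_fun setT (f_ n)) -> measurable_fun setT f ->
  mu.-integrable setT (EFin \o g) ->
  {ae mu, forall x n, `|f_ n x| <= g x} ->
  {ae mu, forall x, f_ n x @[n --> \oo] --> f x} ->
  \int[mu]_x f_ n x @[n --> \oo] --> \int[mu]_x f x.
Proof.
move=> mf_ mf ig fg f_f.
have [] := @dominated_convergence _ _ _ mu setT measurableT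
  (fun n => EFin \o f_ n) (EFin \o f) (EFin \o g) => //.
- by move=> n; exact/measurable_EFinP.
- exact/measurable_EFinP.
- apply: filterS f_f => x fx _; apply/fine_cvgP; split; last exact: fx.
  exact: nearW.
- by apply: filterS fg => x fx n _; rewrite /= lee_fin.
move=> fi _ cf; apply: fine_cvg.
rewrite fineK; last exact: integrable_fin_num.
exact: cf.
Qed.

Section bounded_integrals.
Context {disp : measure_display} {T : measurableType disp} {R : realType}.
Variable P : probability T R.
Implicit Types f g : T -> R.

Lemma bounded_integrable f (C : R) : measurable_fun setT f ->
  (forall x, `|f x| <= C) -> P.-integrable setT (EFin \o f).
Proof.
move=> mf fC; apply: (@le_integrable _ _ _ P setT _ _ (EFin \o cst C)) => //.
- exact/measurable_EFinP.
- by move=> x _ /=; rewrite lee_fin (le_trans (fC x))// ler_norm.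
- exact: finite_measure_integrable_cst.
Qed.

Lemma cvg_Rintegral_bounded (f_ : nat -> T -> R) f (C : R) :
  (forall n, measurable_fun setT (f_ n)) -> measurable_fun setT f ->
  (forall n x, `|f_ n x| <= C) ->
  {ae P, forall x, f_ n x @[n --> \oo] --> f x} ->
  \int[P]_x f_ n x @[n --> \oo] --> \int[P]_x f x.
Proof.
move=> mf_ mf fC; apply: (@cvg_Rintegral_dominated _ _ _ P _ _ (cst C)) => //.
  exact: finite_measure_integrable_cst.
exact: aeW.
Qed.

Lemma Rintegral_prob_cst (c : R) : \int[P]_x c = c.
Proof.
rewrite Rintegral_cst// [X in fine X](_ : _ = 1%E) ?mulr1//.
exact: probability_setT.
Qed.

End bounded_integrals.

Definition bounded_mfun {disp : measure_display} {T : measurableType disp}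
    {R : realType} (f : T -> R) : Prop :=
  measurable_fun setT f /\ exists C : R, forall x, `|f x| <= C.

Section bounded_mfun_theory.
Context {disp : measure_display} {T : measurableType disp} {R : realType}.
Implicit Types f g : T -> R.

Lemma bounded_mfun_cst (c : R) : bounded_mfun (fun _ : T => c).
Proof. by split => //; exists `|c|. Qed.

Lemma bounded_mfunM f g : bounded_mfun f -> bounded_mfun g ->
  bounded_mfun (fun x => f x * g x).
Proof.
move=> [mf [C fC]] [mg [D gD]]; split; first exact: measurable_funM.
by exists (C * D) => x; rewrite normrM ler_pM.
Qed.

Lemma bounded_mfunD f g : bounded_mfun f -> bounded_mfun g ->
  bounded_mfun (fun x => f x + g x).
Proof.
move=> [mf [C fC]] [mg [D gD]]; split; first exact: measurable_funD.
by exists (C + D) => x; rewrite (le_trans (ler_normD _ _))// lerD.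
Qed.

Lemma bounded_mfun_prod (I : Type) (s : seq I) (Q : pred I) (f : I -> T -> R) :
  (forall i, bounded_mfun (f i)) ->
  bounded_mfun (fun x => \prod_(i <- s | Q i) f i x).
Proof.
move=> bf; elim: s => [|i s IH].
  under [X in bounded_mfun X]eq_fun do rewrite big_nil.
  exact: bounded_mfun_cst.
under [X in bounded_mfun X]eq_fun do rewrite big_cons.
case: (Q i); last exact: IH.
exact: (bounded_mfunM (bf i) IH).
Qed.

Lemma bounded_mfun_indic (A : set T) : measurable A ->
  bounded_mfun (\1_A : T -> R).
Proof.
move=> mA; split; first exact: measurable_indic.
by exists 1 => x; rewrite indicE; case: (_ \in _); rewrite ?normr0 ?normr1.
Qed.

Lemma bounded_mfun_integrable (P : probability T R) f :
  bounded_mfun f -> P.-integrable setT (EFin \o f).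
Proof. by move=> [mf [C fC]]; exact: bounded_integrable fC. Qed.

(** The functional monotone class argument: simple functions increase to a nonnegative function and
    stay below its bound, so closure under bounded limits applies. *)
Lemma bounded_mfun_ind (Q : (T -> R) -> Prop) :
  (forall A, measurable A -> Q (\1_A : T -> R)) ->
  (forall f g, bounded_mfun f -> bounded_mfun g -> Q f -> Q g ->
     Q (fun x => f x + g x)) ->
  (forall c f, bounded_mfun f -> Q f -> Q (fun x => c * f x)) ->
  (forall (f_ : nat -> T -> R) f (C : R), (forall n, bounded_mfun (f_ n)) ->
     (forall n, Q (f_ n)) -> (forall n x, `|f_ n x| <= C) ->
     (forall x, f_ n x @[n --> \oo] --> f x) -> bounded_mfun f -> Q f) ->
  forall f, bounded_mfun f -> Q f.
Proof.
move=> Qi QD QZ Ql f [mf [C fC]].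
have Q1 : Q (fun=> 1).
  have := Qi setT measurableT.
  by congr Q; apply/funext => x; rewrite indicE in_setT.
have Qc c : Q (fun=> c).
  have := QZ c _ (bounded_mfun_cst 1) Q1.
  by congr Q; apply/funext => x; rewrite mulr1.
have Qpos g : bounded_mfun g -> (forall x, 0 <= g x) -> Q g.
  move=> [mg [D gD]] g0.
  have mg' : measurable_fun setT (EFin \o g) by exact/measurable_EFinP.
  pose g_ := nnsfun_approx measurableT mg'.
  have g_le n x : `|g_ n x| <= D.
    rewrite ger0_norm//; apply: le_trans (gD x); apply: le_trans (ler_norm _).
    by rewrite -lee_fin nnsfun_approxE le_approx// => y _; rewrite lee_fin.
  have bg n : bounded_mfun (g_ n) by split => //; exists D.
  apply: (Ql (fun n => g_ n) g D) => //.
  (* A simple function is a finite sum over its values. The induction runs over the list of values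
     and carries boundedness along, since [QD] and [QZ] ask for it. *)
  - move=> n.
    have -> : (g_ n : T -> R) = fun x => \sum_(y <- finmap.enum_fset (fset_set (range (g_ n))))
        (y * \1_(g_ n @^-1` [set y]) x).
      by apply/funext => x; rewrite fimfunE fsbig_finite.
    have H : forall s : seq R,
        let F := fun x => \sum_(y <- s) (y * \1_(g_ n @^-1` [set y]) x) in
        bounded_mfun F /\ Q F; last first.
      exact: (H (finmap.enum_fset (fset_set (range (g_ n))))).2.
    elim=> [|y s [bs Qs]] /=.
      under eq_fun do rewrite big_nil.
      by split; [exact: bounded_mfun_cst|exact: Qc].
    under eq_fun do rewrite big_cons.
    have my : measurable (g_ n @^-1` [set y]) by exact: measurable_sfunP.
    have by1 := bounded_mfun_indic my.
    have byc := bounded_mfunM (bounded_mfun_cst y) by1.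
    by split; [exact: bounded_mfunD|apply: QD => //; exact: QZ (Qi _ my)].
  - move=> x.
    have := @cvg_nnsfun_approx _ _ _ setT measurableT _ mg' (fun x _ => g0 x) x I.
    by move/fine_cvg.
  - by split => //; exists D.
(* Adding the bound [C] makes [f] nonnegative; the constant is removed again by [QD]. *)
have bC : bounded_mfun (fun x => f x + C).
  by apply: bounded_mfunD => //; [split => //; exists C|exact: bounded_mfun_cst].
have := QD _ _ bC (bounded_mfun_cst (- C)) _ (Qc (- C)).
rewrite (_ : (fun x => f x + C - C) = f); last by apply/funext => x; rewrite addrK.
by apply; apply: Qpos => // x; have := fC x; rewrite ler_norml; lra.
Qed.

End bounded_mfun_theory.

(** * One-dimensional normal laws *)

Section real_line.
Context {R : realType}.
Notation mu := (@lebesgue_measure R).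

Lemma normr_cos_le1 (x : R) : `|cos x| <= 1.
Proof. by rewrite ler_norml cos_geN1 cos_le1. Qed.

Lemma normr_sin_le1 (x : R) : `|sin x| <= 1.
Proof. by rewrite ler_norml sin_geN1 sin_le1. Qed.

Lemma measurable_cos : measurable_fun setT (@cos R).
Proof. by apply: continuous_measurable_fun; exact: continuous_cos. Qed.

Lemma measurable_sin : measurable_fun setT (@sin R).
Proof. by apply: continuous_measurable_fun; exact: continuous_sin. Qed.

(** u / k is below exp(u / k); take the [k]-th power. *)
Lemma exprn_le_expR (k : nat) (u : R) : 0 <= u -> u ^+ k <= k%:R ^+ k * expR u.
Proof.
move=> u0; case: k => [|k]; first by rewrite !expr0 mul1r -expR0 ler_expR.
have -> : expR u = expR (u / k.+1%:R) ^+ k.+1.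
  by rewrite -expRM_natl -mulr_natl mulrC divfK// pnatr_eq0.
rewrite -exprMn lerXn2r ?nnegrE// ?mulr_ge0 ?expR_ge0//.
rewrite mulrC -ler_pdivrMr ?ltr0Sn// (le_trans _ (expR_ge1Dx _))//.
by rewrite lerDr.
Qed.

(** Fundamental theorem of calculus on growing intervals, with dominated convergence for the
    integral and vanishing boundary terms. It serves as integration by parts on the line. *)
Lemma Rintegral_derive0 (q q' : R -> R) :
  (forall x : R, is_derive x 1 q (q' x)) -> continuous q' ->
  mu.-integrable setT (EFin \o q') ->
  q n%:R @[n --> \oo] --> (0 : R) -> q (- n%:R) @[n --> \oo] --> (0 : R) ->
  \int[mu]_x q' x = 0.
Proof.
move=> dq cq' iq' qy qNy.
have cq : continuous q.
  by move=> x; apply/differentiable_continuous/derivable1_diffP; have [] := dq x.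
(* [n.+1] keeps the interval nondegenerate for every [n], as [continuous_FTC2] wants. *)
pose I n := `[- n.+1%:R, n.+1%:R]%classic : set R.
have : \int[mu]_x (q' \_ (I n)) x @[n --> \oo] --> \int[mu]_x q' x.
  apply: (@cvg_Rintegral_dominated _ _ _ mu _ _ (fun x => `|q' x|)) => //.
  - move=> n; have mq' := continuous_measurable_fun cq'.
    have mI : measurable (I n) by exact: measurable_itv.
    refine ((measurable_restrictT _ mI).1 _).
    exact: measurable_funTS.
  - exact: continuous_measurable_fun.
  - by have := integrable_abse iq'.
  - by apply: aeW => x n; rewrite patchE; case: ifP => _ //; rewrite normr0.
  - apply: aeW => x; apply/cvgrPdist_lt => e e0; near=> n.
    rewrite patchE mem_set ?subrr ?normr0//= /I/= in_itv/= -ler_norml.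
    near: n; exists (Num.bound `|x|) => // n /= bn.
    rewrite (le_trans (ltW (archi_boundP _)))// ler_nat.
    exact: leq_trans bn _.
have -> : (fun n => \int[mu]_x (q' \_ (I n)) x) =
          (fun n => q n.+1%:R - q (- n.+1%:R)).
  apply/funext => n; rewrite -Rintegral_mkcond /Rintegral.
  rewrite (@continuous_FTC2 _ _ q)//.
  - by rewrite -subr_gt0 opprK addr_gt0.
  - exact: continuous_subspaceT.
  - split; first by move=> x _; have [] := dq x.
      by apply: cvg_at_right_filter; exact: cq.
    by apply: cvg_at_left_filter; exact: cq.
  - by move=> x _; rewrite derive1E; have [] := dq x.
move=> c1; have c2 : q n.+1%:R - q (- n.+1%:R) @[n --> \oo] --> (0 : R).
  rewrite -[X in _ --> X](subr0 (0 : R)); apply: cvgB.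
    by rewrite (cvg_shiftS (fun n => q n%:R)).
  by rewrite (cvg_shiftS (fun n => q (- n%:R))).
exact: cvg_unique c1 c2.
Unshelve. all: end_near. Qed.

End real_line.

Section normal_density.
Context {R : realType}.
Variables (m s : R).
Hypothesis s0 : s != 0.
Notation mu := (@lebesgue_measure R).
Notation p := (normal_pdf m s).

Let pE x : p x = normal_peak s * expR (- (x - m) ^+ 2 / (s ^+ 2 *+ 2)).
Proof. by rewrite normal_pdfE. Qed.

Lemma is_derive_normal_pdf (x : R) :
  is_derive x 1 p (- ((x - m) / s ^+ 2) * p x).
Proof.
have -> : p = fun x => normal_peak s * expR (- (x - m) ^+ 2 / (s ^+ 2 *+ 2)).
  by apply/funext => y; rewrite pE.
apply: is_derive_eq.
rewrite /GRing.scale/=.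
by field.
Qed.

(** Half of the Gaussian exponent absorbs the power of [x - m]; the remaining half is the density
    with variance [2 * s ^+ 2]. *)
Lemma normal_pdf_moment_le (k : nat) : exists2 C : R, 0 <= C &
  forall x, `|x - m| ^+ k * p x <= C * normal_pdf m (Num.sqrt 2 * s) x.
Proof.
pose s2 := Num.sqrt 2 * s.
have s20 : s2 != 0 by rewrite mulf_neq0// gt_eqF// sqrtr_gt0.
have p20 : normal_peak s2 != 0 by rewrite gt_eqF// normal_peak_gt0.
pose C := 1 + (4 * s ^+ 2) ^+ k * k%:R ^+ k.
have C0 : 0 <= C by rewrite addr_ge0// mulr_ge0// exprn_ge0// mulr_ge0// sqr_ge0.
exists (C * normal_peak s / normal_peak s2) => [|x].
  by rewrite mulr_ge0 ?invr_ge0 ?mulr_ge0 ?normal_peak_ge0.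
rewrite pE -/s2 (normal_pdfE _ s20) mulrA [leRHS]mulrA divfK//.
rewrite mulrAC [leRHS]mulrAC ler_wpM2r ?normal_peak_ge0//.
pose u := (x - m) ^+ 2 / (4 * s ^+ 2).
have s2p : 0 < s ^+ 2 by rewrite exprn_even_gt0.
have u0 : 0 <= u by rewrite mulr_ge0 ?sqr_ge0// invr_ge0 mulr_ge0// ltW.
have -> : - (x - m) ^+ 2 / (s ^+ 2 *+ 2) = - u - u by rewrite /u; field.
have -> : normal_fun m s2 x = expR (- u).
  by rewrite /normal_fun; congr expR; rewrite /u /s2 exprMn sqr_sqrtr//; field.
rewrite expRD mulrA ler_wpM2r ?expR_ge0// expRN ler_pdivrMr ?expR_gt0//.
(* The even power is a power of [u], to which [exprn_le_expR] applies; the 1 covers the case |x - m|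
   <= 1. *)
have le1 : `|x - m| ^+ k <= 1 + (`|x - m| ^+ 2) ^+ k.
  have [h|h] := leP `|x - m| 1.
    by rewrite (le_trans (exprn_ile1 _ _ _))// lerDl exprn_ge0// sqr_ge0.
  rewrite -exprM (le_trans (ler_weXn2l (ltW h) (leq_pmull k (ltn0Sn 1))))//.
  by rewrite lerDr.
apply: (le_trans le1); rewrite /C mulrDl mul1r lerD//.
  by rewrite -expR0 ler_expR.
have -> : `|x - m| ^+ 2 = 4 * s ^+ 2 * u.
  by rewrite real_normK ?num_real// /u; field.
rewrite exprMn -mulrA ler_wpM2l ?(exprn_ge0 k) ?(mulr_ge0 _ (ltW s2p))//.
exact: exprn_le_expR.
Qed.

Lemma integrable_normal_pdfM (k : nat) :
  mu.-integrable setT (fun x => (`|x - m| ^+ k * p x)%:E).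
Proof.
have [C C0 leC] := normal_pdf_moment_le k.
apply: (@le_integrable _ _ _ mu setT _ _
  (fun x => C%:E * (normal_pdf m (Num.sqrt 2 * s) x)%:E)%E) => //.
- apply/measurable_EFinP/measurable_funM; last exact: measurable_normal_pdf.
  by apply: measurable_funX; apply: measurableT_comp => //; exact: measurable_funB.
- move=> x _; rewrite -EFinM !abse_EFin lee_fin ger0_norm.
    by rewrite (le_trans (leC x))// ler_norm.
  by rewrite mulr_ge0 ?exprn_ge0// normal_pdf_ge0.
- by apply: integrableZl => //; exact: integrable_normal_pdf.
Qed.

(** The moment bound with [k = 1] makes |x - m| p(x) bounded, so the density is at most a constant
    over the distance to the mean. The two signs of [e] serve the two boundary terms. *)
Lemma cvg_normal_pdf (e : R) : `|e| = 1 -> p (e * n%:R) @[n --> \oo] --> (0 : R).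
Proof.
move=> e1; have [C C0 leC] := normal_pdf_moment_le 1.
pose K := C * normal_peak (Num.sqrt 2 * s).
have s20 : Num.sqrt 2 * s != 0 by rewrite mulf_neq0// gt_eqF// sqrtr_gt0.
apply/cvgrPdist_lt => d d0; near=> n.
rewrite sub0r normrN ger0_norm ?normal_pdf_ge0//.
have nm : K / d + `|m| < n%:R.
  near: n; exists (Num.bound (K / d + `|m|)) => // n /= bn.
  apply: (lt_le_trans (archi_boundP _)); last by rewrite ler_nat.
  by rewrite addr_ge0// divr_ge0 ?(ltW d0)// mulr_ge0// normal_peak_ge0.
have h : K / d < `|e * n%:R - m|.
  rewrite (lt_le_trans _ (lerB_dist _ _))// normrM e1 mul1r ltrBrDr.
  by rewrite (lt_le_trans nm)// ler_norm.
have K0 : 0 <= K by rewrite mulr_ge0// normal_peak_ge0.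
have h0 : 0 < `|e * n%:R - m| by rewrite (le_lt_trans _ h)// divr_ge0// ltW.
rewrite -(ltr_pM2l h0) (@le_lt_trans _ _ K)//.
  rewrite -[X in X * p _]expr1 (le_trans (leC _))// ler_wpM2l//.
  exact: normal_pdf_ub.
by rewrite -ltr_pdivrMr.
Unshelve. all: end_near. Qed.

Lemma integrable_sinM_normal_pdf (l th : R) : mu.-integrable setT
  (EFin \o (fun x => (x - m) * sin (l * (x - m) + th) * p x)).
Proof.
have mt (f : R -> R) : measurable_fun [set: R] f ->
    measurable_fun [set: R] (fun x : R => f (l * (x - m) + th)).
  move=> mf; apply: measurableT_comp => //; apply: measurable_funD => //.
  by apply: measurable_funM => //; exact: measurable_funB.
  apply: (@le_integrable _ _ _ mu setT _ _ (fun x => (`|x - m| ^+ 1 * p x)%:E)) => //.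
  - apply/measurable_EFinP; apply: measurable_funM; last exact: measurable_normal_pdf.
    apply: measurable_funM; first exact: measurable_funB.
    by apply: mt; exact: measurable_sin.
  - move=> x _ /=; rewrite lee_fin normrM [leRHS]normrM.
    by rewrite ler_wpM2r// normrM normrX normr_id expr1 ler_piMr// normr_sin_le1.
  - exact: integrable_normal_pdfM.
Qed.

(** Gaussian integration by parts: the derivative of [q] is the difference of the two integrands,
    and [q] vanishes at infinity with the density. *)
Lemma Rintegral_sinM_normal_pdf (l th : R) :
  \int[mu]_x ((x - m) * sin (l * (x - m) + th) * p x) =
  l * s ^+ 2 * \int[mu]_x (cos (l * (x - m) + th) * p x).
Proof.
have mt (f : R -> R) : measurable_fun [set: R] f ->
    measurable_fun [set: R] (fun x : R => f (l * (x - m) + th)).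
  move=> mf; apply: measurableT_comp => //; apply: measurable_funD => //.
  by apply: measurable_funM => //; exact: measurable_funB.
have i1 := integrable_sinM_normal_pdf l th.
have i2 : mu.-integrable setT (EFin \o (fun x => cos (l * (x - m) + th) * p x)).
  apply: (@le_integrable _ _ _ mu setT _ _ (fun x => (normal_pdf m s x)%:E)) => //.
  - apply/measurable_EFinP; apply: measurable_funM; last exact: measurable_normal_pdf.
    by apply: mt; exact: measurable_cos.
  - by move=> x _ /=; rewrite lee_fin normrM ler_piMl// normr_cos_le1.
  - exact: integrable_normal_pdf.
pose q (x : R) := s ^+ 2 * (sin (l * (x - m) + th) * p x).
pose q' (x : R) := l * s ^+ 2 * (cos (l * (x - m) + th) * p x)
                   - (x - m) * sin (l * (x - m) + th) * p x.
have dq (x : R) : is_derive x 1 q (q' x).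
  have dp := is_derive_normal_pdf x; apply: is_derive_eq.
  by rewrite /GRing.scale/= /q'; field.
have cp : continuous p by exact: continuous_normal_pdf.
have cq' : continuous q'.
  have cf x : l * (y - m) + th @[y --> x] --> l * (x - m) + th.
    apply: cvgD; last exact: cvg_cst.
    apply: cvgM; first exact: cvg_cst.
    by apply: cvgB; [exact: cvg_id|exact: cvg_cst].
  move=> x; apply: cvgB.
    apply: cvgM; first exact: cvg_cst.
    apply: cvgM; last exact: cp.
    by apply: (cvg_comp _ _ (cf x)); exact: continuous_cos.
  apply: cvgM; last exact: cp.
  apply: cvgM; first by apply: cvgB; [exact: cvg_id|exact: cvg_cst].
  by apply: (cvg_comp _ _ (cf x)); exact: continuous_sin.
have i2' : mu.-integrable setT
    (EFin \o (fun x => l * s ^+ 2 * (cos (l * (x - m) + th) * p x))).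
  by have := integrableZl (mu := mu) measurableT (l * s ^+ 2) i2.
have iq' : mu.-integrable setT (EFin \o q').
  by have := integrableB (mu := mu) measurableT i2' i1.
have cvgq (e : R) : `|e| = 1 -> q (e * n%:R) @[n --> \oo] --> (0 : R).
  move=> e1; apply/cvgr0Pnorm_lt => d d0.
  have s2 : 0 < s ^+ 2 by rewrite exprn_even_gt0.
  have /cvgr0Pnorm_lt/(_ (d / s ^+ 2)) := cvg_normal_pdf e1.
  rewrite divr_gt0// => /(_ isT); apply: filterS => n.
  rewrite ltr_pdivlMr// => h; apply: le_lt_trans h.
  rewrite /q normrM (ger0_norm (ltW s2)) mulrC ler_wpM2r ?(ltW s2)//.
  by rewrite normrM ler_piMl// normr_sin_le1.
have := Rintegral_derive0 dq cq' iq'.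
have -> : (fun n : nat => q n%:R) = (fun n : nat => q (1 * n%:R)).
  by apply/funext => n; rewrite mul1r.
have -> : (fun n : nat => q (- n%:R)) = (fun n : nat => q (-1 * n%:R)).
  by apply/funext => n; rewrite mulN1r.
move=> /(_ (cvgq _ (normr1 _)) (cvgq _ (normrN1 _))).
rewrite /q' RintegralB// => /eqP; rewrite subr_eq0 => /eqP <-.
by rewrite RintegralZl.
Qed.

(** Differentiating in [l] under the integral and integrating by parts gives F' = - l s^2 F, so that
    F(l) exp(l^2 s^2 / 2) is constant. *)
Lemma Rintegral_cos_normal_pdf (l th : R) :
  \int[mu]_x (cos (l * (x - m) + th) * p x) =
  expR (- (l ^+ 2 * s ^+ 2 / 2)) * cos th.
Proof.
pose f (l x : R) := cos (l * (x - m) + th) * p x.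
pose F (l : R) := \int[mu]_x f l x.
have df (x a : R) : is_derive a 1 (f ^~ x) (- ((x - m) * sin (a * (x - m) + th) * p x)).
  by apply: is_derive_eq; rewrite /GRing.scale/=; ring.
have mt (a : R) : measurable_fun [set: R] (fun x : R => cos (a * (x - m) + th)).
  apply: measurableT_comp; first exact: measurable_cos.
  apply: measurable_funD => //.
  by apply: measurable_funM => //; exact: measurable_funB.
have i2 a : mu.-integrable setT (EFin \o f a).
  apply: (@le_integrable _ _ _ mu setT _ _ (fun x => (normal_pdf m s x)%:E)) => //.
  - apply/measurable_EFinP; apply: measurable_funM; last exact: measurable_normal_pdf.
    exact: mt.
  - by move=> x _ /=; rewrite lee_fin normrM ler_piMl// normr_cos_le1.
  - exact: integrable_normal_pdf.
have dF (a : R) : is_derive a 1 F (- (a * s ^+ 2) * F a).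
  have aI : `]a - 1, a + 1[%classic a by rewrite /= in_itv/=; lra.
  have iG : mu.-integrable setT (EFin \o (fun x => `|x - m| ^+ 1 * p x)).
    exact: integrable_normal_pdfM.
  have derf (x y : R) : `]a - 1, a + 1[%classic x -> [set: R] y ->
      derivable (f ^~ y) x 1 by move=> _ _; have [] := df y x.
  have parf (x y : R) : partial1of2 f x y = - ((y - m) * sin (x * (y - m) + th) * p y).
    by rewrite /partial1of2 derive1E; have [] := df y x.
  have G0 (y : R) : 0 <= `|y - m| ^+ 1 * p y.
    by rewrite mulr_ge0 ?exprn_ge0// normal_pdf_ge0.
  have Gub (x y : R) : `]a - 1, a + 1[%classic x -> [set: R] y ->
      `|partial1of2 f x y| <= `|y - m| ^+ 1 * p y.
    move=> _ _; rewrite parf normrN normrM (ger0_norm (normal_pdf_ge0 _ _ _)).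
    rewrite ler_wpM2r ?normal_pdf_ge0// normrM expr1 ler_piMr//.
    exact: normr_sin_le1.
  have dF := derivable_under_integral measurableT aI (fun x _ => i2 x) derf G0 iG Gub.
  have F' := differentiation_under_integral measurableT aI (fun x _ => i2 x) derf G0 iG Gub.
  apply: DeriveDef; first exact: dF.
  rewrite -derive1E F' mulNr -Rintegral_sinM_normal_pdf -mulN1r.
  rewrite -RintegralZl//; last exact: integrable_sinM_normal_pdf.
  by apply: eq_Rintegral => x _; rewrite parf mulN1r.
have F0 : F 0 = cos th.
  rewrite /F /f; under eq_Rintegral do rewrite mul0r add0r.
  rewrite RintegralZl//; last exact: integrable_normal_pdf.
  by rewrite /Rintegral integral_normal_pdf mulr1.
suff : F l * expR (l ^+ 2 * s ^+ 2 / 2) = F 0 * expR (0 ^+ 2 * s ^+ 2 / 2).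
  rewrite expr0n/= !mul0r expR0 mulr1 F0 => <-.
  by rewrite mulrCA -expRD addNr expR0 mulr1.
apply: (@is_derive_0_is_cst R (fun l => F l * expR (l ^+ 2 * s ^+ 2 / 2))) => x.
by have dFx := dF x; apply: is_derive_eq; rewrite /GRing.scale/=; field.
Qed.

End normal_density.

(** Monotone convergence of the truncations. Gaussian laws are known on bounded functions only, so
    integrability of moments is reached this way. *)
Lemma integrable_truncated {disp : measure_display} {T : measurableType disp}
    {R : realType} (P : probability T R) (f : T -> R) (K : R) :
  measurable_fun setT f -> (forall x, 0 <= f x) ->
  (forall n : nat, \int[P]_x Num.min (f x) n%:R <= K) ->
  P.-integrable setT (EFin \o f).
Proof.
move=> mf f0 fK; apply/integrableP; split; first exact/measurable_EFinP.
have mmin n : measurable_fun setT (fun x => Num.min (f x) n%:R).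
  by apply: measurable_minr.
have bmin n : bounded_mfun (fun x => Num.min (f x) n%:R).
  split; first exact: mmin.
  exists n%:R => x; rewrite ger0_norm; first by rewrite ge_min lexx orbT.
  by rewrite le_min f0 ler0n.
under eq_integral do rewrite /= ger0_norm//.
apply: (@le_lt_trans _ _ K%:E); last exact: ltry.
have -> : (\int[P]_x (f x)%:E =
    limn (fun n => \int[P]_x (Num.min (f x) n%:R)%:E))%E.
  rewrite -monotone_convergence//.
  - apply: eq_integral => x _; apply/esym/cvg_lim => //.
    apply: cvg_near_cst; exists (Num.bound (f x)) => // n /= bn.
    congr EFin; apply: min_l; rewrite (le_trans (ltW (archi_boundP _)))//.
    by rewrite ler_nat.
  - by move=> n; exact/measurable_EFinP.
  - by move=> n x _; rewrite lee_fin le_min f0 ler0n.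
  - by move=> x _ i j ij; rewrite lee_fin le_min2// ler_nat.
apply: lime_le.
  apply: ereal_nondecreasing_is_cvgn => i j ij; apply: ge0_le_integral => //.
  - by move=> x _; rewrite lee_fin le_min f0 ler0n.
  - exact/measurable_EFinP.
  - exact/measurable_EFinP.
  - by move=> x _; rewrite lee_fin le_min2// ler_nat.
apply: nearW => n; have := fK n; rewrite -lee_fin /Rintegral fineK//.
by apply: integrable_fin_num => //; exact: bounded_mfun_integrable.
Qed.

Section gaussian_rv_theory.
Context {disp : measure_display} {T : measurableType disp} {R : realType}.
Variables (P : probability T R) (X : T -> R) (m v : R).
Hypothesis XG : gaussian_rv P X m v.
Notation mu := (@lebesgue_measure R).

Let bounded_comp (f : R -> R) : bounded_mfun f -> bounded_mfun (f \o X).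
Proof.
move=> [mf [C fC]]; split; first exact: measurableT_comp mf XG.1.
by exists C => x; exact: fC.
Qed.

Let integrable_comp (f : R -> R) : bounded_mfun f ->
  P.-integrable setT (EFin \o (f \o X)).
Proof. by move=> bf; apply: bounded_mfun_integrable; exact: bounded_comp. Qed.

(** Here and in [Rintegral_gaussian_rv], [bounded_mfun_ind] lifts the hypothesis on sets to bounded
    functions, both sides being linear and continuous along bounded limits. *)
Lemma Rintegral_gaussian_rv0 (f : R -> R) : v = 0 -> bounded_mfun f ->
  \int[P]_w f (X w) = f m.
Proof.
move=> v0; move: f; apply: bounded_mfun_ind.
- move=> A mA; have -> : (fun w => \1_A (X w) : R) = \1_(X @^-1` A).
    by apply/funext => w; rewrite !indicE.
  rewrite /Rintegral integral_indic//; last first.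
    by rewrite -[X @^-1` A]setTI; apply: XG.1.
  rewrite setIT [X in fine X](_ : _ = gauss1 m v A); last exact: XG.2.
  by rewrite /gauss1 v0 eqxx diracE indicE.
- move=> f g bf bg Ef Eg; rewrite RintegralD//; try exact: integrable_comp.
  by rewrite Ef Eg.
- move=> c f bf Ef; rewrite RintegralZl//; last exact: integrable_comp.
  by rewrite Ef.
- move=> f_ f C bf_ Ef fC ff bf.
  have c1 : \int[P]_w f_ n (X w) @[n --> \oo] --> \int[P]_w f (X w).
    apply: (@cvg_Rintegral_bounded _ _ _ P (fun n => f_ n \o X) (f \o X) C) => //.
    + by move=> n; have [] := bounded_comp (bf_ n).
    + by have [] := bounded_comp bf.
    + by move=> n x; exact: fC.
    + by apply: aeW => x; exact: ff.
  have c2 : \int[P]_w f_ n (X w) @[n --> \oo] --> f m.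
    by rewrite (_ : (fun n => _) = f_ ^~ m)//; exact/funext.
  exact: cvg_unique c1 c2.
Qed.

Lemma Rintegral_gaussian_rv (f : R -> R) : 0 < v -> bounded_mfun f ->
  \int[P]_w f (X w) = \int[mu]_x (f x * normal_pdf m (Num.sqrt v) x).
Proof.
move: f => h v0; have s0 : Num.sqrt v != 0 by rewrite gt_eqF// sqrtr_gt0.
have ip := integrable_normal_pdf m (Num.sqrt v).
have mp := measurable_normal_pdf m (Num.sqrt v).
set p := normal_pdf m (Num.sqrt v).
have p0 x : 0 <= p x by exact: normal_pdf_ge0.
have ifp (f : R -> R) : bounded_mfun f ->
    mu.-integrable setT (EFin \o (fun x => f x * p x)).
  move=> [mf [C fC]].
  apply: (@le_integrable _ _ _ mu setT _ _ (fun x => C%:E * (p x)%:E)%E) => //.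
  - by apply/measurable_EFinP; exact: measurable_funM.
  - move=> x _ /=; rewrite lee_fin normrM [leRHS]normrM ler_wpM2r//.
    by rewrite (le_trans (fC x))// ler_norm.
  - exact: integrableZl.
move: h; apply: bounded_mfun_ind.
- move=> A mA; have -> : (fun w => \1_A (X w) : R) = \1_(X @^-1` A).
    by apply/funext => w; rewrite !indicE.
  rewrite /Rintegral integral_indic//; last first.
    by rewrite -[X @^-1` A]setTI; apply: XG.1.
  rewrite setIT [X in fine X](_ : _ = gauss1 m v A); last exact: XG.2.
  rewrite /gauss1 gt_eqF// /normal_prob [in LHS]integral_mkcond.
  congr fine; apply: eq_integral => x _; rewrite patchE indicE.
  by case: ifP => _; rewrite ?mul1r ?mul0r.
- move=> f g bf bg Ef Eg; rewrite RintegralD//; try exact: integrable_comp.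
  rewrite Ef Eg -RintegralD//; try exact: ifp.
  by apply: eq_Rintegral => x _; rewrite mulrDl.
- move=> c f bf Ef; rewrite RintegralZl//; last exact: integrable_comp.
  rewrite Ef -RintegralZl//; last exact: ifp.
  by apply: eq_Rintegral => x _; rewrite mulrA.
- move=> f_ f C bf_ Ef fC ff bf.
  have c1 : \int[P]_w f_ n (X w) @[n --> \oo] --> \int[P]_w f (X w).
    apply: (@cvg_Rintegral_bounded _ _ _ P (fun n => f_ n \o X) (f \o X) C) => //.
    + by move=> n; have [] := bounded_comp (bf_ n).
    + by have [] := bounded_comp bf.
    + by move=> n x; exact: fC.
    + by apply: aeW => x; exact: ff.
  suff c2 : \int[P]_w f_ n (X w) @[n --> \oo] --> \int[mu]_x (f x * p x).
    exact: cvg_unique c1 c2.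
  rewrite (_ : (fun n => _) = fun n => \int[mu]_x (f_ n x * p x)); last first.
    exact/funext.
  apply: (@cvg_Rintegral_dominated _ _ _ mu _ _ (fun x => C * p x)).
  + by move=> n; apply: measurable_funM => //; exact: (bf_ n).1.
  + by apply: measurable_funM => //; exact: bf.1.
  + have := integrableZl (mu := mu) measurableT C ip.
    by congr (mu.-integrable _ _); apply/funext.
  + by apply: aeW => x n; rewrite normrM (ger0_norm (p0 x)) ler_wpM2r.
  + by apply: aeW => x; apply: cvgM; [exact: ff|exact: cvg_cst].
Qed.

Hypothesis v0 : 0 <= v.

Lemma gaussian_rv_cos (l th : R) :
  \int[P]_w cos (l * X w + th) = expR (- (l ^+ 2 * v / 2)) * cos (l * m + th).
Proof.
have bf : bounded_mfun (fun x : R => cos (l * x + th)).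
  split; last by exists 1 => x; exact: normr_cos_le1.
  apply: measurableT_comp; first exact: measurable_cos.
  by apply: measurable_funD => //; exact: measurable_funM.
have [v0'|] := eqVneq v 0.
  rewrite (Rintegral_gaussian_rv0 v0' bf) v0' mulr0 mul0r oppr0.
  by rewrite expR0 mul1r.
move=> vn0; have vp : 0 < v by rewrite lt_def vn0.
rewrite (Rintegral_gaussian_rv vp bf).
have s0 : Num.sqrt v != 0 by rewrite gt_eqF// sqrtr_gt0.
rewrite -[in RHS](sqr_sqrtr v0) -(Rintegral_cos_normal_pdf m s0).
by apply: eq_Rintegral => x _; congr (cos _ * _); ring.
Qed.

(** The truncations [f n] are bounded, hence computed from the density; their integrals stay below
    the moment of the density. *)
Lemma gaussian_rv_integrable (k : nat) :
  P.-integrable setT (fun w => (`|X w - m| ^+ k)%:E).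
Proof.
pose f n (x : R) := Num.min (`|x - m| ^+ k) n%:R : R.
have mk : measurable_fun [set: R] (fun x : R => `|x - m| ^+ k).
  by apply: measurable_funX; apply: measurableT_comp => //; exact: measurable_funB.
have bf n : bounded_mfun (f n).
  split; first by apply: measurable_minr.
  exists n%:R => x; rewrite ger0_norm ?le_min ?exprn_ge0 ?ler0n//.
  by rewrite ge_min lexx orbT.
suff [K HK] : exists K, forall n, \int[P]_w f n (X w) <= K.
  apply: (integrable_truncated _ _ HK) => [|x]; last exact: exprn_ge0.
  exact: measurableT_comp mk XG.1.
have [v0'|] := eqVneq v 0.
  exists (`|m - m| ^+ k) => n; rewrite (Rintegral_gaussian_rv0 v0')//.
  by rewrite ge_min lexx.
move=> vn0; have vp : 0 < v by rewrite lt_def vn0.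
have s0 : Num.sqrt v != 0 by rewrite gt_eqF// sqrtr_gt0.
have ip := integrable_normal_pdfM m s0 k.
exists (\int[mu]_x (`|x - m| ^+ k * normal_pdf m (Num.sqrt v) x)) => n.
rewrite (Rintegral_gaussian_rv vp (bf n)).
have le x : f n x * normal_pdf m (Num.sqrt v) x <=
    `|x - m| ^+ k * normal_pdf m (Num.sqrt v) x.
  by rewrite ler_wpM2r ?normal_pdf_ge0// ge_min lexx.
apply: le_Rintegral => //.
apply: le_integrable ip => //.
  apply/measurable_EFinP; apply: measurable_funM; first exact: (bf n).1.
  exact: measurable_normal_pdf.
move=> x _; rewrite /= lee_fin ger0_norm.
  by rewrite (le_trans (le x))// ler_norm.
by rewrite mulr_ge0 ?normal_pdf_ge0// /f le_min exprn_ge0 ?ler0n.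
Qed.

End gaussian_rv_theory.

(** * Independence *)

Lemma bounded_mfun_comp {disp disp' : measure_display}
    {T : measurableType disp} {T' : measurableType disp'} {R : realType}
    (f : T' -> R) (X : T -> T') :
  bounded_mfun f -> measurable_fun setT X -> bounded_mfun (fun w => f (X w)).
Proof.
move=> [mf [C fC]] mX; split; first exact: measurableT_comp mf mX.
by exists C => x; exact: fC.
Qed.

Lemma cos_sub_pihalf {R : realType} (y : R) : cos (y - pi / 2) = sin y.
Proof. by rewrite cosB cos_pihalf sin_pihalf mulr0 add0r mulr1. Qed.

Lemma bounded_mfun_cos {R : realType} (a b : R) :
  bounded_mfun (fun x : R => cos (a * x + b)).
Proof.
split; last by exists 1 => x; exact: normr_cos_le1.
apply: measurableT_comp; first exact: measurable_cos.
by apply: measurable_funD => //; exact: measurable_funM.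
Qed.

Section independence.
Context {disp : measure_display} {T : measurableType disp} {R : realType}.
Variable P : probability T R.
Context {I : finType}.
Variable X : I -> T -> R.
Hypothesis mX : forall i, measurable_fun setT (X i).
Hypothesis iX : independent_rvs P X.

Let bcomp (f : R -> R) i : bounded_mfun f -> bounded_mfun (fun w => f (X i w)).
Proof. by move=> bf; exact: bounded_mfun_comp. Qed.

Lemma expectation_prod_indic (J : {set I}) (A : I -> set R) :
  (forall i, measurable (A i)) ->
  \int[P]_w (\prod_(i in J) \1_(A i) (X i w)) =
  \prod_(i in J) \int[P]_w \1_(A i) (X i w).
Proof.
move=> mA; pose B i := X i @^-1` A i.
have mB i : measurable (B i) by rewrite -[B i]setTI; apply: mX.
have EB i : \int[P]_w \1_(A i) (X i w) = fine (P (B i)).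
  have -> : (fun w => \1_(A i) (X i w) : R) = \1_(B i).
    by apply/funext => w; rewrite !indicE.
  by rewrite /Rintegral integral_indic// setIT.
under [RHS]eq_bigr do rewrite EB.
have -> : (fun w => \prod_(i in J) \1_(A i) (X i w) : R) =
    \1_(\bigcap_(i in [set` J]) B i).
  apply/funext => w; rewrite indicE.
  have [/set_mem h|/negP h] := boolP (_ \in _).
    apply: big1 => i iJ; rewrite indicE mem_set//; exact: h.
  have [i iJ Bi] : exists2 i, i \in J & ~ B i w.
    apply: contrapT => h'; apply: h; apply/mem_set => i /= iJ.
    by apply: contrapT => Bi; apply: h'; exists i.
  by rewrite (bigD1 i)//= indicE memNset// mul0r.
have mBJ : measurable (\bigcap_(i in [set` J]) B i).
  by apply: fin_bigcap_measurable => //; exact: finite_finset.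
rewrite /Rintegral integral_indic// setIT.
rewrite [X in fine X](_ : _ = (\prod_(i in J) P (B i))%E); last first.
  apply: iX => i iJ; exists (A i) => //.
  by rewrite setTI.
have -> : (\prod_(i in J) P (B i) = (\prod_(i in J) fine (P (B i)))%:E)%E.
  elim/big_rec2 : _ => // i y1 y2 _ ->.
  by rewrite EFinM fineK//; exact: fin_num_measure.
by [].
Qed.

(** Induction on the list [s] of indices whose factor is an arbitrary bounded function, the others
    being indicators. Each step frees one factor with [bounded_mfun_ind], the remaining product
    being a fixed bounded weight [G]. *)
Lemma expectation_prod (J : {set I}) (f : I -> R -> R) :
  (forall i, bounded_mfun (f i)) ->
  \int[P]_w (\prod_(i in J) f i (X i w)) =
  \prod_(i in J) \int[P]_w f i (X i w).
Proof.
suff H (s : seq I) : forall f : I -> R -> R, (forall i, bounded_mfun (f i)) ->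
    (forall i, i \notin s -> exists2 A, measurable A & f i = \1_A) ->
    \int[P]_w (\prod_(i in J) f i (X i w)) =
    \prod_(i in J) \int[P]_w f i (X i w).
  by move=> bf; apply: (H (enum I)) => // i; rewrite mem_enum.
elim: s => [|i s IH] {}f bf fA.
  have /choice[A HA] : forall i, exists A, measurable A /\ f i = \1_A.
    by move=> i; have [A mA ->] := fA i isT; exists A.
  have := expectation_prod_indic J (fun i => (HA i).1).
  rewrite (_ : (fun w => \prod_(i in J) \1_(A i) (X i w)) =
    (fun w => \prod_(i in J) f i (X i w))); last first.
    by apply/funext => w; apply: eq_bigr => i _; rewrite (HA i).2.
  move=> ->; apply: eq_bigr => i _; congr Rintegral; apply/funext => w.
  by rewrite (HA i).2.
pose G w := \prod_(j in J | j != i) f j (X j w).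
pose c := \prod_(j in J | j != i) \int[P]_w f j (X j w).
have bG : bounded_mfun G by apply: bounded_mfun_prod => j; exact: bcomp.
(* An index outside [J] does not enter the products; its factor is exchanged for an indicator so
   that the induction hypothesis applies. *)
have [iJ|iJ] := boolP (i \in J); last first.
  pose f' j := if j == i then \1_setT else f j.
  have E j : j \in J -> f j = f' j.
    by rewrite /f'; case: eqP => // ->; rewrite (negbTE iJ).
  have := IH f'.
  under eq_Rintegral do under eq_bigr => j jJ do rewrite -E//.
  under [X in _ -> _ -> _ = X]eq_bigr => j jJ do rewrite -E//.
  apply=> j; rewrite /f'; case: eqP => [_|/eqP ji].
  - by apply: bounded_mfun_indic; exact: measurableT.
  - exact: bf.
  - by move=> _; exists setT.
  - by move=> js; apply: fA; rewrite inE negb_or ji.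
have red g : bounded_mfun g ->
   (\int[P]_w (g (X i w) * G w) = (\int[P]_w g (X i w)) * c).
  move: g; apply: bounded_mfun_ind.
  - move=> A mA; pose f' j := if j == i then \1_A else f j.
    have f'i : f' i = \1_A by rewrite /f' eqxx.
    have f'j j : j != i -> f' j = f j by rewrite /f' => /negbTE ->.
    have := IH f'; rewrite (bigD1 i)//= f'i.
    rewrite (eq_bigr (fun j => \int[P]_w f j (X j w))); last first.
      by move=> j /andP[_ ji]; rewrite f'j.
    rewrite -/c => <-; last 2 first.
    + move=> j; rewrite /f'; case: eqP => // _.
      exact: bounded_mfun_indic.
    + move=> j js; rewrite /f'; case: eqP => [_|/eqP ji]; first by exists A.
      by apply: fA; rewrite inE negb_or ji.
    apply: eq_Rintegral => w _; rewrite (bigD1 i)//= f'i; congr (_ * _).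
    by apply: eq_bigr => j /andP[_ ji]; rewrite f'j.
  - move=> g h bg bh Eg Eh.
    rewrite RintegralD//; try by apply: bounded_mfun_integrable; exact: bcomp.
    rewrite mulrDl -Eg -Eh -RintegralD//; last 2 first.
    + by apply: bounded_mfun_integrable; apply: bounded_mfunM => //; exact: bcomp.
    + by apply: bounded_mfun_integrable; apply: bounded_mfunM => //; exact: bcomp.
    by apply: eq_Rintegral => w _; rewrite mulrDl.
  - move=> a g bg Eg.
    rewrite RintegralZl//; last by apply: bounded_mfun_integrable; exact: bcomp.
    rewrite -mulrA -Eg -RintegralZl//; last first.
      by apply: bounded_mfun_integrable; apply: bounded_mfunM => //; exact: bcomp.
    by apply: eq_Rintegral => w _; rewrite mulrA.
  - move=> g_ g C bg_ Eg gC gg bg.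
    have [mG [D GD]] := bG.
    have c1 : \int[P]_w (g_ n (X i w) * G w) @[n --> \oo] -->
              \int[P]_w (g (X i w) * G w).
      apply: (@cvg_Rintegral_bounded _ _ _ P _ _ (C * D)).
      + by move=> n; apply: (bounded_mfunM (bcomp i (bg_ n)) bG).1.
      + by apply: (bounded_mfunM (bcomp i bg) bG).1.
      + by move=> n w; rewrite normrM ler_pM.
      + by apply: aeW => w; apply: cvgM; [exact: gg|exact: cvg_cst].
    have c2 : \int[P]_w (g_ n (X i w) * G w) @[n --> \oo] -->
              (\int[P]_w g (X i w)) * c.
      rewrite (_ : (fun n => _) = (fun n => (\int[P]_w g_ n (X i w)) * c)); last first.
        exact/funext.
      apply: cvgM; last exact: cvg_cst.
      apply: (@cvg_Rintegral_bounded _ _ _ P _ _ C) => //.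
      + by move=> n; apply: (bcomp i (bg_ n)).1.
      + by apply: (bcomp i bg).1.
      + by apply: aeW => w; exact: gg.
    exact: cvg_unique c1 c2.
rewrite (bigD1 i)//= -/c -red//.
by apply: eq_Rintegral => w _; rewrite (bigD1 i).
Qed.

Variable v : I -> R.
Hypothesis cosX : forall i th,
  \int[P]_w cos (X i w + th) = expR (- (v i / 2)) * cos th.

(** Factorization of characteristic functions in real form. The claim is strengthened by a product
    of bounded functions of the variables not yet summed: by the addition formula, the cosine of a
    new variable passes into that product. *)
Lemma expectation_cos_sum (th : R) :
  \int[P]_w cos (\sum_i X i w + th) = expR (- ((\sum_i v i) / 2)) * cos th.
Proof.
suff H (s : seq I) : uniq s -> forall th (f : I -> R -> R),
    (forall i, bounded_mfun (f i)) ->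
    \int[P]_w (cos (\sum_(i <- s) X i w + th) *
               \prod_(i in [set j | j \notin s]%SET) f i (X i w)) =
    expR (- ((\sum_(i <- s) v i) / 2)) * cos th *
      \prod_(i in [set j | j \notin s]%SET) \int[P]_w f i (X i w).
  have := H (enum I) (enum_uniq I) th (fun _ _ => 0) (fun _ => bounded_mfun_cst 0).
  have -> : [set j | j \notin enum I]%SET = finset.set0.
    by apply/setP => j; rewrite !inE mem_enum.
  rewrite [X in _ = _ * X]big_pred0 => [|j]; last by rewrite inE.
  rewrite mulr1 !big_enum/= => <-; apply: eq_Rintegral => w _.
  by rewrite big_enum/= [X in _ = _ * X]big_pred0 ?mulr1// => j; rewrite inE.
clear th; elim: s => [_ th f bf|i s IH /= /andP[is_ us] th f bf].
  under eq_Rintegral do rewrite big_nil add0r.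
  rewrite RintegralZl//; last first.
    by apply: bounded_mfun_integrable; apply: bounded_mfun_prod => j; exact: bcomp.
  by rewrite expectation_prod// big_nil mul0r oppr0 expR0 mul1r.
pose f' a j := if j == i then (fun x : R => cos (1 * x + a)) else f j.
have bf' a j : bounded_mfun (f' a j).
  by rewrite /f'; case: ifP => // _; exact: bounded_mfun_cos.
have spl (F : I -> R) : \prod_(j in [set j | j \notin s]%SET) F j =
    F i * \prod_(j in [set j | j \notin i :: s]%SET) F j.
  rewrite (bigD1 i)/=; last by rewrite inE.
  congr (_ * _); apply: eq_bigl => j; rewrite !inE negb_or andbC//.
have f'E a w : \prod_(j in [set j | j \notin s]%SET) f' a j (X j w) =
    cos (X i w + a) * \prod_(j in [set j | j \notin i :: s]%SET) f j (X j w).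
  rewrite spl /f' eqxx mul1r; congr (_ * _); apply: eq_bigr => j.
  by rewrite !inE negb_or => /andP[/negbTE -> _].
have f'E2 a : \prod_(j in [set j | j \notin s]%SET) \int[P]_w f' a j (X j w) =
    expR (- (v i / 2)) * cos a *
    \prod_(j in [set j | j \notin i :: s]%SET) \int[P]_w f j (X j w).
  rewrite spl /f' eqxx; congr (_ * _).
    by rewrite -cosX; apply: eq_Rintegral => w _; rewrite mul1r.
  by apply: eq_bigr => j; rewrite !inE negb_or => /andP[/negbTE -> _].
pose W th a w := cos (\sum_(j <- s) X j w + th) *
   \prod_(j in [set j | j \notin s]%SET) f' a j (X j w).
have bW th' a : bounded_mfun (W th' a).
  apply: bounded_mfunM; last by apply: bounded_mfun_prod => j; exact: bcomp.
  split; last by exists 1 => w; exact: normr_cos_le1.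
  apply: measurableT_comp; first exact: measurable_cos.
  by apply: measurable_funD => //; exact: measurable_sum.
(* cos(a + b) = cos a cos b - sin a sin b, each sine being written as a cosine with phase - pi/2.
   The second term will have mean 0 because [cos (- (pi / 2))] is 0. *)
transitivity (\int[P]_w (W th 0 w - W (th - pi / 2) (- (pi / 2)) w)).
  apply: eq_Rintegral => w _; rewrite /W !f'E addr0 big_cons.
  by rewrite -addrA (addrA _ th) !cos_sub_pihalf [cos (X i w + _)]cosD; ring.
rewrite RintegralB//; try by apply: bounded_mfun_integrable; exact: bW.
rewrite !IH// !f'E2 cosN cos_pihalf cos0 big_cons.
rewrite [in RHS]mulrDl [in RHS]opprD expRD; ring.
Qed.

End independence.

(** * Uniqueness of characteristic functions *)

Section threshold.
Context {R : realType}.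

(* These polynomials converge on [0, 1] to the indicator of [0, 1/2[. *)
Definition threshold (n : nat) (y : R) : R := (1 - y ^+ n) ^+ (n * 2 ^ n).

Lemma threshold_bound n y : 0 <= y <= 1 -> `|threshold n y| <= 1.
Proof.
move=> /andP[y0 y1]; have yn0 : 0 <= y ^+ n by exact: exprn_ge0.
have yn1 : y ^+ n <= 1 by exact: exprn_ile1.
by rewrite /threshold ger0_norm ?exprn_ge0 ?exprn_ile1//; lra.
Qed.

Lemma bernoulli_ineq (x : R) (k : nat) : 0 <= x <= 1 -> 1 - k%:R * x <= (1 - x) ^+ k.
Proof.
move=> /andP[x0 x1]; elim: k => [|k IH]; first by rewrite mul0r subr0 expr0.
rewrite exprS; apply: (@le_trans _ _ ((1 - x) * (1 - k%:R * x))).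
  rewrite -subr_ge0 -natr1.
  have -> : (1 - x) * (1 - k%:R * x) - (1 - (k%:R + 1) * x) = k%:R * x * x by ring.
  by rewrite !mulr_ge0.
by rewrite ler_wpM2l// subr_ge0.
Qed.

(** Upper counterpart of Bernoulli's inequality: the left-hand side decreases with [k]. *)
Lemma onem_exprn_le (x : R) (k : nat) : 0 <= x <= 1 ->
  (1 - x) ^+ k * (1 + k%:R * x) <= 1.
Proof.
move=> /andP[x0 x1]; elim: k => [|k IH]; first by rewrite expr0 mul1r mul0r addr0.
apply: le_trans IH; rewrite exprS mulrAC mulrC ler_wpM2l ?exprn_ge0 ?subr_ge0//.
rewrite -subr_ge0 -natr1.
have -> : 1 + k%:R * x - (1 - x) * (1 + (k%:R + 1) * x) = (k%:R + 1) * x * x by ring.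
by rewrite !mulr_ge0// addr_ge0.
Qed.

(** Powers of [z] decrease, so [n * z ^+ n] is at most the geometric sum. *)
Lemma natrM_exprn_le (z : R) (n : nat) : 0 <= z < 1 -> n%:R * z ^+ n <= (1 - z)^-1.
Proof.
move=> /andP[z0 z1]; have z1' : 0 < 1 - z by lra.
rewrite -[leRHS]mul1r ler_pdivlMr//.
have -> : n%:R * z ^+ n * (1 - z) = (1 - z) * (\sum_(i < n) z ^+ n).
  by rewrite sumr_const card_ord -[z ^+ n *+ n]mulr_natl mulrC.
apply: (@le_trans _ _ ((1 - z) * (\sum_(i < n) z ^+ i))).
  rewrite ler_wpM2l ?(ltW z1')//; apply: ler_sum => i _.
  exact: (ler_wiXn2l z0 (ltW z1) (ltnW (ltn_ord i))).
have -> : (1 - z) * (\sum_(i < n) z ^+ i) = 1 - z ^+ n.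
  by rewrite -[RHS]opprB subrX1 -mulNr opprB.
by rewrite lerBlDr lerDl exprn_ge0.
Qed.

(** With 2 y = z^2, Bernoulli's inequality bounds the defect by n 2^n y^n = (n z^n) z^n, where n z^n
    stays bounded. *)
Lemma cvg_threshold_lt y : 0 <= y < 1/2 -> threshold n y @[n --> \oo] --> (1 : R).
Proof.
move=> /andP[y0 y1]; have y2 : 0 <= 2 * y by lra.
pose z := Num.sqrt (2 * y).
have z1 : 0 <= z < 1.
  rewrite sqrtr_ge0/=; rewrite -(ltr_pXn2r (ltn0Sn 1)) ?nnegrE ?sqrtr_ge0//.
  by rewrite sqr_sqrtr// expr1n; lra.
have yz : y = z ^+ 2 / 2 by rewrite sqr_sqrtr//; field.
apply: (@squeeze_cvgr _ _ _ _ (fun n => 1 - (1 - z)^-1 * z ^+ n) (fun=> 1)).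
- apply: nearW => n; apply/andP; split; last first.
    have := @threshold_bound n y; rewrite y0 /= => /(_ _)/(le_trans (ler_norm _)).
    by apply; lra.
  apply: le_trans (bernoulli_ineq _ _); last first.
    by rewrite exprn_ge0// exprn_ile1//; lra.
  have -> : y ^+ n = z ^+ n * z ^+ n / 2 ^+ n.
    by rewrite yz exprMn exprVn exprAC expr2.
  rewrite lerD2l lerN2 natrM natrX.
  have -> : n%:R * 2 ^+ n * (z ^+ n * z ^+ n / 2 ^+ n) = n%:R * z ^+ n * z ^+ n :> R.
    by field; rewrite expf_neq0.
  by rewrite ler_wpM2r ?exprn_ge0//; [case/andP: z1|exact: natrM_exprn_le].
- rewrite -[X in _ --> X]subr0; apply: cvgB; first exact: cvg_cst.
  rewrite -[X in _ --> X](mulr0 (1 - z)^-1); apply: cvgM; first exact: cvg_cst.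
  by apply: cvg_expr; case/andP: z1 => z0 z1; rewrite ger0_norm.
- exact: cvg_cst.
Qed.

(** Here 2^n y^n >= 1, so [onem_exprn_le] with exponent n 2^n makes [threshold n y] at most 1 / (n +
    1). *)
Lemma cvg_threshold_ge y : 1/2 <= y <= 1 -> threshold n y @[n --> \oo] --> (0 : R).
Proof.
move=> /andP[y1 y2].
apply: (@squeeze_cvgr _ _ _ _ (fun=> 0) (fun n => n.+1%:R^-1)).
- apply: nearW => n.
  have yn : 0 <= y ^+ n <= 1 by rewrite exprn_ge0 ?exprn_ile1//; lra.
  have t0 : 0 <= threshold n y by rewrite exprn_ge0// subr_ge0; case/andP: yn.
  rewrite t0 /= -[leRHS]mul1r ler_pdivlMr ?ltr0Sn//.
  apply: le_trans (onem_exprn_le (n * 2 ^ n) yn); rewrite ler_wpM2l//.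
  rewrite -natr1 addrC lerD2l natrM -mulrA ler_peMr// natrX -exprMn exprn_ege1//.
  lra.
- exact: cvg_cst.
- exact: cvg_harmonic.
Qed.

End threshold.

Section char_unique.
Context {disp : measure_display} {T : measurableType disp} {R : realType}.
Variables (mu nu : probability T R) (V : set (T -> R)).
Hypothesis mV : forall v, V v -> measurable_fun setT v.
Hypothesis V0 : V (fun=> 0).
Hypothesis VD : forall v w, V v -> V w -> V (fun x => v x + w x).
Hypothesis VZ : forall a v, V v -> V (fun x => a * v x).
Hypothesis munu : forall v th, V v ->
  \int[mu]_x cos (v x + th) = \int[nu]_x cos (v x + th).

Let M (f : T -> R) : Prop := bounded_mfun f /\ forall v th, V v ->
  \int[mu]_x (f x * cos (v x + th)) = \int[nu]_x (f x * cos (v x + th)).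

(* The multipliers of [M] are closed under products and bounded limits and contain
   the functions [cos (v x + th)].  A polynomial in one of these approximates the
   indicator of a half-space, see [Nthreshold]. *)
Let N (g : T -> R) : Prop := bounded_mfun g /\
  forall f, M f -> M (fun x => f x * g x).

Let bcos v th : V v -> bounded_mfun (fun x => cos (v x + th)).
Proof.
move=> Vv; split; last by exists 1 => x; exact: normr_cos_le1.
apply: measurableT_comp; first exact: measurable_cos.
by apply: measurable_funD => //; exact: mV.
Qed.

Let bi (P : probability T R) f g : bounded_mfun f -> bounded_mfun g ->
  P.-integrable setT (EFin \o (fun x => f x * g x)).
Proof. by move=> bf bg; apply: bounded_mfun_integrable; exact: bounded_mfunM. Qed.

Let MD f g : M f -> M g -> M (fun x => f x + g x).
Proof.
move=> [bf Ef] [bg Eg]; split; first exact: bounded_mfunD.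
move=> v th Vv; have bc := bcos th Vv.
under eq_Rintegral do rewrite mulrDl.
under [RHS]eq_Rintegral do rewrite mulrDl.
by rewrite !RintegralD//; try exact: bi; rewrite Ef// Eg.
Qed.

Let MZ a f : M f -> M (fun x => a * f x).
Proof.
move=> [bf Ef]; split; first by apply: bounded_mfunM => //; exact: bounded_mfun_cst.
move=> v th Vv; have bc := bcos th Vv.
under eq_Rintegral do rewrite -mulrA.
under [RHS]eq_Rintegral do rewrite -mulrA.
by rewrite !RintegralZl//; try exact: bi; rewrite Ef.
Qed.

Let Mlim (f_ : nat -> T -> R) (f : T -> R) (C : R) : (forall n, M (f_ n)) ->
  (forall n x, `|f_ n x| <= C) -> (forall x, f_ n x @[n --> \oo] --> f x) ->
  M f.
Proof.
move=> Mf fC ff.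
have mf : measurable_fun setT f.
  apply: (measurable_fun_cvg (fun n => (Mf n).1.1)) => x _; exact: ff.
have fC' x : `|f x| <= C.
  have nf : `|f_ n x| @[n --> \oo] --> `|f x| by apply: cvg_norm; exact: ff.
  rewrite -(cvg_lim _ nf)//; apply: limr_le; first by apply/cvg_ex; exists `|f x|.
  by apply: nearW => n; exact: fC.
have bf : bounded_mfun f by split => //; exists C.
split => // v th Vv; have bc := bcos th Vv.
have c (P : probability T R) : \int[P]_x (f_ n x * cos (v x + th)) @[n --> \oo] -->
    \int[P]_x (f x * cos (v x + th)).
  apply: (@cvg_Rintegral_bounded _ _ _ P _ _ C).
  - by move=> n; exact: (bounded_mfunM (Mf n).1 bc).1.
  - exact: (bounded_mfunM bf bc).1.
  - move=> n x; rewrite normrM (le_trans _ (fC n x))// ler_piMr//.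
    exact: normr_cos_le1.
  - by apply: aeW => x; apply: cvgM; [exact: ff|exact: cvg_cst].
have c2 := c mu.
rewrite (_ : (fun n => \int[mu]_x (f_ n x * cos (v x + th))) =
    fun n => \int[nu]_x (f_ n x * cos (v x + th))) in c2.
  exact: cvg_unique c2 (c nu).
by apply/funext => n; exact: (Mf n).2.
Qed.

Let M_ext f g : f =1 g -> M f -> M g.
Proof. by move=> /funext ->. Qed.

Let N_ext f g : f =1 g -> N f -> N g.
Proof. by move=> /funext ->. Qed.

Let Ncst c : N (fun=> c).
Proof.
split; first exact: bounded_mfun_cst.
by move=> f /(MZ c); apply: M_ext => x; rewrite mulrC.
Qed.

Let ND g h : N g -> N h -> N (fun x => g x + h x).
Proof.
move=> [bg Ng] [bh Nh]; split; first exact: bounded_mfunD.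
move=> f Mf; have := MD (Ng _ Mf) (Nh _ Mf).
by apply: M_ext => x; rewrite mulrDr.
Qed.

Let NM g h : N g -> N h -> N (fun x => g x * h x).
Proof.
move=> [bg Ng] [bh Nh]; split; first exact: bounded_mfunM.
by move=> f Mf; have := Nh _ (Ng _ Mf); apply: M_ext => x; rewrite mulrA.
Qed.

Let NX g k : N g -> N (fun x => g x ^+ k).
Proof.
move=> Ng; elim: k => [|k IH]; first exact: (Ncst 1).
by apply: N_ext (NM Ng IH) => x; rewrite exprS.
Qed.

Let Nlim (g_ : nat -> T -> R) (g : T -> R) (C : R) : (forall n, N (g_ n)) ->
  (forall n x, `|g_ n x| <= C) -> (forall x, g_ n x @[n --> \oo] --> g x) ->
  N g.
Proof.
move=> Ng gC gg.
have mg : measurable_fun setT g.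
  apply: (measurable_fun_cvg (fun n => (Ng n).1.1)) => x _; exact: gg.
have bg : bounded_mfun g.
  split => //; exists C => x.
  have nf : `|g_ n x| @[n --> \oo] --> `|g x| by apply: cvg_norm; exact: gg.
  rewrite -(cvg_lim _ nf)//; apply: limr_le; first by apply/cvg_ex; exists `|g x|.
  by apply: nearW => n; exact: gC.
split => // f Mf; have [[mf [D fD]] _] := Mf.
apply: (@Mlim (fun n x => f x * g_ n x) _ (D * C)).
- by move=> n; exact: (Ng n).2.
- by move=> n x; rewrite normrM ler_pM.
- by move=> x; apply: cvgM; [exact: cvg_cst|exact: gg].
Qed.

(** A product of two cosines is half the sum of the cosines of the sum and the difference of their
    arguments; [VD] and [VZ] keep these arguments in [V]. *)
Let Ncos v th : V v -> N (fun x => cos (v x + th)).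
Proof.
move=> Vv; split; first exact: bcos.
move=> f [bf Ef]; split; first by apply: bounded_mfunM => //; exact: bcos.
move=> w th' Vw.
have VB : V (fun x => v x + -1 * w x) by apply: VD => //; exact: VZ.
have E (P : probability T R) :
    \int[P]_x (f x * cos (v x + th) * cos (w x + th')) =
    2^-1 * (\int[P]_x (f x * cos (v x + w x + (th + th')))
     + \int[P]_x (f x * cos (v x + -1 * w x + (th - th')))).
  have i1 := bi P bf (bcos (th + th') (VD Vv Vw)).
  have i2 := bi P bf (bcos (th - th') VB).
  rewrite -RintegralD// -RintegralZl//; last first.
    by have := integrableD measurableT i1 i2.
  apply: eq_Rintegral => x _.
  have -> : v x + w x + (th + th') = (v x + th) + (w x + th') by ring.
  have -> : v x + -1 * w x + (th - th') = (v x + th) - (w x + th') by ring.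
  by move: (v x + th) (w x + th') => a b; rewrite cosB cosD; field.
by rewrite !E Ef ?Ef//; exact: VD.
Qed.

(** [y] maps sin(v x) affinely into [0, 1], the value [a] going to the threshold 1/2. The divisor 4
    fits because sin(v x) - a lies in [-2, 2]. *)
Let Nthreshold v (a : R) : V v -> -1 <= a <= 1 ->
  N (\1_[set x | sin (v x) < a]).
Proof.
move=> Vv /andP[a1 a2].
pose y x := (cos (v x + - (pi / 2)) - a) / 4 + 1 / 2.
have Ny : N y.
  have := ND (NM (Ncst 4^-1) (Ncos (- (pi / 2)) Vv)) (Ncst (1 / 2 - a / 4)).
  by apply: N_ext => x; rewrite /y; field.
have yE x : y x = (sin (v x) - a) / 4 + 1 / 2.
  by rewrite /y cosB cos_pihalf sin_pihalf mulr0 add0r mulr1.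
have y01 x : 0 <= y x <= 1.
  by rewrite yE; have := sin_le1 (v x); have := sin_geN1 (v x); lra.
apply: (@Nlim (fun n x => threshold n (y x)) _ 1).
- move=> n; apply: NX; have := ND (Ncst 1) (NM (Ncst (-1)) (NX n Ny)).
  by apply: N_ext => x; rewrite mulN1r.
- by move=> n x; exact: threshold_bound.
- move=> x; rewrite indicE; have [h|h] := ltP (sin (v x)) a.
    rewrite mem_set//=; apply: cvg_threshold_lt.
    by rewrite (andP (y01 x)).1 /= yE; lra.
  rewrite memNset/=; last by apply/negP; rewrite -leNgt.
  by apply: cvg_threshold_ge; rewrite (andP (y01 x)).2 andbT yE; lra.
Qed.

(** The sine is increasing on [- pi/2, pi/2] only. Dividing [v x] and [r] by [n.+1] brings both into
    that interval from some rank on, for each [x]. *)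
Let Nindic v (r : R) : V v -> N (\1_[set x | v x < r]).
Proof.
move=> Vv.
apply: (@Nlim (fun n => \1_[set x | sin (n.+1%:R^-1 * v x) < sin (n.+1%:R^-1 * r)]) _ 1).
- move=> n; apply: (@Nthreshold (fun x => n.+1%:R^-1 * v x)); first exact: VZ.
  by rewrite sin_geN1 sin_le1.
- by move=> n x; rewrite indicE; case: (_ \in _); rewrite ?normr0 ?normr1.
- move=> x; apply: cvg_near_cst; exists (Num.bound (`|v x| + `|r|)) => // n /= bn.
  have n0 : 0 < n.+1%:R :> R by rewrite ltr0Sn.
  have H y : `|y| <= `|v x| + `|r| -> n.+1%:R^-1 * y \in `[(- (pi/2)), (pi/2)].
    move=> h; rewrite in_itv/= -ler_norml normrM gtr0_norm ?invr_gt0//.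
    rewrite mulrC ler_pdivrMr// (le_trans h)// (@le_trans _ _ n.+1%:R)//.
      rewrite (le_trans (ltW (archi_boundP _)))// ?addr_ge0//.
      by rewrite ler_nat leqW.
    by rewrite ler_peMl ?(ltW n0)//; have := @pi_ge2 R; lra.
  have Hv : n.+1%:R^-1 * v x \in `[(- (pi/2)), (pi/2)] by rewrite H// lerDl.
  have Hr : n.+1%:R^-1 * r \in `[(- (pi/2)), (pi/2)] by rewrite H// lerDr.
  rewrite !indicE; congr (_%:R); congr nat_of_bool.
  apply/idP/idP => /set_mem /= h; apply/mem_set => /=.
    by move: h; rewrite ltr_sin// ltr_pM2l// invr_gt0.
  by rewrite ltr_sin// ltr_pM2l// invr_gt0.
Qed.

(** [G] is a pi-system of finite intersections of half-spaces. Their indicators are products of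
    multipliers; such a multiplier applied to the constant 1 and tested against cos 0 = 1 gives
    equal measures. *)
Lemma char_unique (G := [set A | exists (n : nat) (v : nat -> T -> R) (r : nat -> R),
    (forall i, V (v i)) /\ A = [set x | forall i, (i < n)%N -> v i x < r i]]) :
  measurable `<=` <<s G >> -> forall A, measurable A -> mu A = nu A.
Proof.
move=> mG A /mG.
have NG (n : nat) (v : nat -> T -> R) (r : nat -> R) : (forall i, V (v i)) ->
    N (\1_[set x | forall i, (i < n)%N -> v i x < r i]).
  move=> Vv; elim: n => [|n IH].
    apply: N_ext (Ncst 1) => x; rewrite indicE mem_set//.
  apply: N_ext (NM IH (Nindic (r n) (Vv n))) => x; rewrite !indicE -natrM mulnb.
  congr (_%:R); congr nat_of_bool; apply/idP/idP.
    move=> /andP[/set_mem/= h1 /set_mem/= h2]; apply/mem_set => i /=.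
    by rewrite ltnS leq_eqVlt => /predU1P[->//|]; exact: h1.
  move=> /set_mem/= h; apply/andP; split; apply/mem_set => /=; last exact: h.
  by move=> i /ltnW; exact: h.
have M1 : M (fun=> 1).
  split; first exact: bounded_mfun_cst.
  move=> v th Vv; under eq_Rintegral do rewrite mul1r.
  by under [RHS]eq_Rintegral do rewrite mul1r; exact: munu.
have Gm : G `<=` measurable.
  move=> _ [n [v [r [Vv ->]]]].
  rewrite (_ : [set x | _] = \bigcap_(i in `I_n) [set x | v i x < r i])//.
  apply: fin_bigcap_measurable => // i _.
  rewrite (_ : [set x | _] = setT `&` v i @^-1` `]-oo, r i[%classic).
    exact: (mV (Vv i)).
  by apply/seteqP; split => x /=; rewrite in_itv//= => -[].
have GI : setI_closed G.
  move=> _ _ [n [v [r [Vv ->]]]] [n' [v' [r' [Vv' ->]]]].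
  exists (n + n')%N, (fun i => if (i < n)%N then v i else v' (i - n)%N),
     (fun i => if (i < n)%N then r i else r' (i - n)%N); split.
    by move=> i; case: ifP.
  apply/seteqP; split => x /=.
    move=> [h h'] i ii; case: ifPn => [|]; first exact: h.
    by rewrite -leqNgt => ni; apply: h'; rewrite ltn_subLR.
  move=> h; split => i ii.
    by have := h i (ltn_addr _ ii); rewrite ii.
  have := h (n + i)%N; rewrite ltn_add2l ii ltnNge leq_addr/= addKn.
  exact.
have GT : forall i : nat, G ((fun=> setT) i).
  by move=> _; exists 0%N, (fun _ _ => 0), (fun=> 0); split=> //; apply/seteqP; split.
have Gcov : \bigcup_(i : nat) (fun=> setT) i = [set: T].
  by apply/seteqP; split => // x _; exists 0%N.
have GE B : G B -> mu B = nu B.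
  move=> GB; have mB := Gm _ GB; move: GB => [n [v [r [Vv BE]]]].
  have := NG n v r Vv; rewrite -BE => -[_ /(_ _ M1)[_ /(_ _ 0 V0)]].
  have E (P : probability T R) :
      P B = (\int[P]_x (1 * \1_B x * cos ((fun=> 0) x + 0)))%:E.
    under eq_Rintegral do rewrite mul1r addr0 cos0 mulr1.
    by rewrite /Rintegral integral_indic// setIT fineK//; exact: fin_num_measure.
  by rewrite !E => ->.
apply: (@g_sigma_algebra_measure_unique _ _ _ G Gm (fun=> setT) GT Gcov mu nu GI GE).
by move=> _; apply: le_lt_trans (ltry 1); exact: probability_le1.
Qed.

End char_unique.

(** * Symmetric matrices *)

Section sym_norm_theory.
Context {R : realType} {d : nat}.
Implicit Types (S : symM R d) (U : 'M[R]_d).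

Lemma frobDr U (A B : 'M[R]_d) : frob U (A + B) = frob U A + frob U B.
Proof. by rewrite frobC frobDl !(frobC U). Qed.

Lemma frobZr (a : R) U (A : 'M[R]_d) : frob U (a *: A) = a * frob U A.
Proof. by rewrite frobC frobZl (frobC U). Qed.

Lemma frobBr U (A B : 'M[R]_d) : frob U (A - B) = frob U A - frob U B.
Proof. by rewrite frobDr -scaleN1r frobZr mulN1r. Qed.

Lemma symB_val (S S' : symM R d) : symval (S - S') = symval S - symval S'.
Proof. by []. Qed.

Lemma symD_val (S S' : symM R d) : symval (S + S') = symval S + symval S'.
Proof. by []. Qed.

Lemma symZ_val (a : R) (S : symM R d) : symval (a *: S) = a *: symval S.
Proof. by []. Qed.

Lemma sym_entry S i j : S i j = S j i.
Proof. by case: S => S /= /eqP ST; rewrite -[in LHS]ST mxE. Qed.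

Lemma normr_frob_le U S : `|frob U S| <= Num.sqrt (frob U U) * `|S|.
Proof.
rewrite symM_normE -sqrtrM ?frob_ge0// -sqrtr_sqr ler_wsqrtr//.
exact: frob_cauchy_schwarz.
Qed.

Lemma entry_frob (A : 'M[R]_d) i j : A i j = frob (delta_mx i j) A.
Proof.
rewrite frobE (bigD1 i)//= [X in _ + X]big1 ?addr0; last first.
  by move=> k ki; apply: big1 => l _; rewrite mxE (negbTE ki) mul0r.
rewrite (bigD1 j)//= big1 ?addr0; first by rewrite mxE !eqxx mul1r.
by move=> l lj; rewrite mxE (negbTE lj) andbF mul0r.
Qed.

Lemma normr_entry_le S i j : `|S i j| <= `|S|.
Proof.
rewrite entry_frob (le_trans (normr_frob_le _ _))//.
by rewrite -entry_frob mxE !eqxx sqrtr1 mul1r.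
Qed.

Lemma sym_norm_le_sum S : `|S| <= \sum_i \sum_j `|S i j|.
Proof.
have s0 : 0 <= \sum_i \sum_j `|S i j| by do 2!apply: sumr_ge0 => ? _.
rewrite -[leRHS]ger0_norm// -sqrtr_sqr symM_normE ler_wsqrtr// frobE expr2.
rewrite mulr_suml; apply: ler_sum => i _.
rewrite mulr_suml; apply: ler_sum => j _.
rewrite (le_trans (ler_norm _))// normrM ler_wpM2l//.
rewrite (bigD1 i)//= (bigD1 j)//= -addrA lerDl addr_ge0 ?sumr_ge0// => k _.
by rewrite sumr_ge0.
Qed.

Lemma lipschitz_continuous_sym (f : symM R d -> R) (K : R) :
  (forall S S', `|f S - f S'| <= K * `|S - S'|) -> continuous f.
Proof.
move=> fK S; apply: (proj2 (@cvgrPdist_lt _ _ _ (nbhs S) (nbhs_filter S) f (f S))) => e e0.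
have K0 : 0 < `|K| + 1 by rewrite ltr_wpDl.
near=> S'; rewrite (le_lt_trans (fK _ _))//.
apply: (@le_lt_trans _ _ ((`|K| + 1) * `|S - S'|)).
  by rewrite ler_wpM2r// (le_trans (ler_norm _))// lerDl.
rewrite -ltr_pdivlMl// mulrC; near: S'.
by apply: cvgr_dist_lt => //; rewrite divr_gt0.
Unshelve. all: end_near. Qed.

Lemma continuous_frob U : continuous (fun S : symM R d => frob U S).
Proof.
apply: (@lipschitz_continuous_sym _ (Num.sqrt (frob U U))) => S S'.
rewrite -frobBr; exact: (normr_frob_le U (S - S')).
Qed.

Lemma continuous_entry i j : continuous (fun S : symM R d => S i j).
Proof.
apply: (@lipschitz_continuous_sym _ 1) => S S'; rewrite mul1r.
by have := normr_entry_le (S - S') i j; rewrite symB_val !mxE.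
Qed.

Lemma continuous_measurable_sym (f : symM R d -> R) :
  continuous f -> measurable_fun setT f.
Proof.
move=> cf; apply: (measurability _ (RGenOpens.measurableE R)) => _ [_ [x [y ->]]] <-.
rewrite setTI; apply: sub_sigma_algebra.
by apply: open_comp; [by move=> ? _; exact: cf|exact: interval_open].
Qed.

Lemma measurable_dist (M : symM R d) :
  measurable_fun setT (fun S : symM R d => `|S - M|).
Proof.
apply: continuous_measurable_sym; apply: (@lipschitz_continuous_sym _ 1) => S S'.
by rewrite mul1r (le_trans (ler_dist_dist _ _))// opprB addrA subrK.
Qed.

Lemma measurable_frob U : measurable_fun setT (fun S : symM R d => frob U S).
Proof. by apply: continuous_measurable_sym; exact: continuous_frob. Qed.

End sym_norm_theory.

Section measurable_sym.
Context {R : realType} {d : nat}.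

(** A countable family, through which the Borel sets of [symM] are generated by the entries. The
    centre ranges over all rational matrices, so that entries can be approximated independently. *)
Definition rat_box (qk : 'M[rat]_d * nat) : set (symM R d) :=
  [set S : symM R d | forall i j, `|S i j - ratr (qk.1 i j)| < qk.2.+1%:R^-1].

Lemma open_rat_box (O : set (symM R d)) : open O ->
  O = \bigcup_(qk in [set qk | rat_box qk `<=` O]) rat_box qk.
Proof.
move=> oO; apply/seteqP; split => [S OS|S [qk] /= qkO]; last exact: qkO.
have /nbhs_ballP[e /= e0 eO] : nbhs S O by exact: open_nbhs_nbhs.
(* Two points of a box differ by less than 2 / (k + 1) in each of the d^2 entries, and the norm is
   at most the sum of their absolute values; [k] makes the total less than [e]. *)
pose k := Num.bound (d%:R * d%:R * 2 / e : R).
have k0 : 0 < k.+1%:R^-1 :> R by rewrite invr_gt0.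
have kE : d%:R * d%:R * (2 * k.+1%:R^-1) < e :> R.
  rewrite mulrA ltr_pdivrMr// -ltr_pdivrMl// mulrC.
  apply: (lt_le_trans (archi_boundP _)).
    by rewrite divr_ge0 ?(ltW e0)// !mulr_ge0.
  by rewrite ler_nat.
have /choice[q qE] : forall ij : 'I_d * 'I_d,
    exists q : rat, `|S ij.1 ij.2 - ratr q| < k.+1%:R^-1.
  move=> [i j] /=.
  have [|q] := @rat_in_itvoo R (S i j - k.+1%:R^-1) (S i j + k.+1%:R^-1).
    by rewrite ltrD2l (lt_trans _ k0)// oppr_lt0.
  rewrite in_itv/= => /andP[q1 q2]; exists q; rewrite distrC ltr_norml.
  by rewrite ltrBrDr ltrBlDr addrC q1 addrC q2.
pose Q : 'M[rat]_d := \matrix_(i, j) q (i, j).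
exists (Q, k) => /=; last by move=> i j /=; rewrite mxE; exact: (qE (i, j)).
move=> S' /= S'Q; apply: eO; rewrite -ball_normE /=.
apply: le_lt_trans (sym_norm_le_sum _) (le_lt_trans _ kE).
have le i j : `|(S - S' : symM R d) i j| <= 2 * k.+1%:R^-1.
  rewrite symB_val !mxE; have := S'Q i j; have := qE (i, j).
  rewrite /= mxE => h1 h2; rewrite (le_trans (ler_distD (ratr (q (i, j))) _ _))//.
  by rewrite mulr_natl mulr2n lerD// ltW// distrC.
apply: (@le_trans _ _ (\sum_(i < d) \sum_(j < d) 2 * k.+1%:R^-1)).
  by do 2!apply: ler_sum => ? _.
by rewrite !sumr_const !card_ord -mulrnA -[leLHS]mulr_natl natrM.
Qed.

(** Preimages of boxes are finite intersections over the entries, and an open set is a countable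
    union of boxes. *)
Lemma measurable_sym_coord {disp : measure_display} {T : measurableType disp}
    (g : T -> symM R d) :
  (forall i j, measurable_fun setT (fun x => g x i j)) -> measurable_fun setT g.
Proof.
move=> mg; apply: (@measurability _ _ _ _ _ _ (@open (symM R d))) => //.
move=> _ [A oA <-]; rewrite setTI (open_rat_box oA) preimage_bigcup.
rewrite bigcup_mkcond.
apply: countable_bigcupT_measurable => [|qk]; first exact: countableP.
case: ifP => // _.
rewrite (_ : _ @^-1` _ = \bigcap_(ij in [set: 'I_d * 'I_d])
    (fun x => g x ij.1 ij.2 - ratr (qk.1 ij.1 ij.2)) @^-1`
      `](- qk.2.+1%:R^-1), (qk.2.+1%:R^-1)[ ); last first.
  apply/seteqP; split => x /=.
    by move=> h [i j] _ /=; rewrite in_itv/= -ltr_norml; exact: h.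
  by move=> h i j; have := h (i, j) I; rewrite /= in_itv/= -ltr_norml.
apply: fin_bigcap_measurable => // -[i j] _ /=.
rewrite -[X in measurable X]setTI.
by apply: (measurable_funB (mg i j) (measurable_cst _)) => //; exact: measurable_itv.
Qed.

Lemma measurable_entry i j : measurable_fun setT (fun S : symM R d => S i j).
Proof.
have := @measurable_frob R d (delta_mx i j).
by apply: eq_measurable_fun => S _; rewrite entry_frob.
Qed.

(** Pairing with a symmetric matrix sees only this part. It makes the entry functional
    [frob (delta_mx i j)] one of those indexed by [symM]. *)
Definition sym_part (U : 'M[R]_d) : 'M[R]_d := 2^-1 *: (U + U^T).

Fact sym_part_sym (U : 'M[R]_d) : sym_part U \in symmx.
Proof. by rewrite /in_mem /= /symmx /sym_part linearZ /= linearD /= trmxK addrC. Qed.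

Lemma frob_trmx (A B : 'M[R]_d) : frob A^T B^T = frob A B.
Proof.
rewrite !frobE exchange_big; apply: eq_bigr => i _; apply: eq_bigr => j _.
by rewrite !mxE.
Qed.

Lemma frob_sym_part (U : 'M[R]_d) (S : symM R d) : frob (sym_part U) S = frob U S.
Proof.
rewrite /sym_part frobZl frobDl.
have -> : frob U^T S = frob U S.
  rewrite -[in RHS]frob_trmx; congr frob; apply/matrixP => i j.
  by rewrite [RHS]mxE sym_entry.
by field.
Qed.

(** The linear functionals form the space [V] of [char_unique]. Half-spaces generate the Borel sets
    because the entries are among these functionals. *)
Lemma sym_char_unique (mu nu : probability (symM R d) R) :
  (forall (U : symM R d) th, \int[mu]_S cos (frob U S + th) =
                             \int[nu]_S cos (frob U S + th)) ->
  forall A, measurable A -> mu A = nu A.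
Proof.
move=> munu; pose V : set (symM R d -> R) :=
  [set v | exists U : symM R d, v = fun S : symM R d => frob U S].
apply: (@char_unique _ _ _ mu nu V).
- by move=> _ [U ->]; exact: measurable_frob.
- exists 0; apply/funext => S; rewrite frobE big1// => i _; rewrite big1// => j _.
  by rewrite mxE mul0r.
- by move=> _ _ [U ->] [U' ->]; exists (U + U'); apply/funext => S; rewrite frobDl.
- by move=> a _ [U ->]; exists (a *: U); apply/funext => S; rewrite frobZl.
- by move=> _ th [U ->]; exact: munu.
set G := [set A | _].
have mV (U : symM R d) : measurable_fun setT
    ((fun S => frob U S) : g_sigma_algebraType G -> R).
  apply: (measurability _ (RGenOInfty.measurableE R)) => _ [_ [x ->]] <-.
  rewrite setTI; apply: sub_sigma_algebra.
  (* Only sets of the form v < r belong to [G], so a lower bound by [x] is expressed through [- U]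
     and [- x]. *)
  exists 1%N, (fun _ (S : symM R d) => frob (- U : symM R d) S), (fun=> - x); split.
    by move=> _; exists (- U : symM R d).
  have NE (S : symM R d) : frob (- U : symM R d) S = - frob U S by rewrite -scaleN1r frobZl mulN1r.
  apply/seteqP; split => S /=; rewrite in_itv/= andbT.
    by move=> xS _ _; rewrite NE ltrN2.
  by move=> /(_ 0%N isT); rewrite NE ltrN2.
have mid : measurable_fun setT (idfun : g_sigma_algebraType G -> symM R d).
  apply: measurable_sym_coord => i j.
  have := mV (SymM (sym_part_sym (delta_mx i j))).
  by apply: eq_measurable_fun => S _; rewrite /= frob_sym_part -entry_frob.
by move=> A mA; have := mid measurableT A mA; rewrite setTI.
Qed.

End measurable_sym.

Section vecs_theory.
Context {R : realType} {d : nat}.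
Variable (o : 'I_(qd d) -> 'I_d * 'I_d).
Hypothesis o_ord : vecs_ordering o.

Lemma vecsD (S S' : symM R d) : vecs o (S + S') = vecs o S + vecs o S'.
Proof. by apply/rowP => a; rewrite !mxE mulrDr. Qed.

Lemma vecsZ (c : R) (S : symM R d) : vecs o (c *: S) = c *: vecs o S.
Proof. by apply/rowP => a; rewrite !mxE mulrCA. Qed.

Lemma sym_expand (S : symM R d) : S = \sum_a vecs o S ord0 a *: basis o a.
Proof.
apply: (vecs_inj o_ord).
have vs (I : Type) (s : seq I) (F : I -> symM R d) :
    vecs o (\sum_(i <- s) F i) = \sum_(i <- s) vecs o (F i).
  elim: s => [|i s IH]; last by rewrite !big_cons vecsD IH.
  by rewrite !big_nil; have := vecsZ 0 0; rewrite !scale0r.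
rewrite vs; apply/rowP => a; rewrite summxE (bigD1 a)//= big1 => [|b ba].
  by rewrite addr0 vecsZ vecs_basis// !mxE !eqxx mulr1.
by rewrite vecsZ vecs_basis// !mxE eqxx /= eq_sym (negbTE ba) mulr0.
Qed.

Lemma sym_linear_expand (F : 'M[R]_d -> R) (S : symM R d) :
  (forall A B, F (A + B) = F A + F B) -> (forall c A, F (c *: A) = c * F A) ->
  F S = \sum_a vecs o S ord0 a * F (basis o a).
Proof.
move=> FD FZ; rewrite {1}(sym_expand S).
have -> (I : Type) (s : seq I) (G : I -> symM R d) :
    F (\sum_(i <- s) G i : symM R d) = \sum_(i <- s) F (G i).
  elim: s => [|i s IH]; last by rewrite !big_cons symD_val FD IH.
  by rewrite !big_nil; have := FZ 0 (0 : 'M[R]_d); rewrite scale0r mul0r.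
by apply: eq_bigr => a _; rewrite symZ_val FZ.
Qed.

(** An off-diagonal [basis o a] has two entries 1 / sqrt 2, which meet equal entries of [S]: 2 /
    sqrt 2 = sqrt 2 is the weight in [vecs]. *)
Lemma frob_basis (S : symM R d) a : frob S (basis o a) = vecs o S ord0 a.
Proof.
pose x := (o a).1; pose y := (o a).2.
have E i j : ((i, j) == o a) = (i == x) && (j == y).
  by rewrite (surjective_pairing (o a)).
have bE : basis_mx o a = (vecs_weight o a)^-1 *:
    (if x == y then delta_mx x y else delta_mx x y + delta_mx y x) :> 'M[R]_d.
  apply/matrixP => i j; rewrite !mxE !E mulrC; congr (_ * _).
  case: ifPn => [/eqP <-|xy]; first by rewrite !mxE andbC orbb.
  rewrite !mxE; have [/andP[/eqP -> _]|_] /= := boolP ((i == x) && (j == y)).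
    by rewrite (negbTE xy) /= addr0.
  by rewrite add0r andbC.
rewrite /= bE frobZr mxE /vecs_weight -/x -/y; case: ifP => xy.
  by rewrite frobC -entry_frob invr1 !mul1r.
rewrite frobDr !(frobC S) -!entry_frob (sym_entry S y x).
have s2 : Num.sqrt 2 * Num.sqrt 2 = 2 :> R by rewrite -expr2 sqr_sqrtr.
have s0 : Num.sqrt 2 != 0 :> R by rewrite gt_eqF// sqrtr_gt0.
apply: (mulfI s0); rewrite mulVKf// mulrA s2; ring.
Qed.

Lemma frob_vecs (S S' : symM R d) :
  frob S S' = (vecs o S *m (vecs o S')^T) ord0 ord0.
Proof.
rewrite (sym_linear_expand S' (frobDr S) (fun c => frobZr c S)) [RHS]mxE.
apply: eq_bigr => a _; rewrite frob_basis mulrC; congr (_ * _).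
by rewrite [RHS]mxE.
Qed.

(** Both arguments of the bilinear form are expanded in the basis; variances of the normal law are
    thereby read off without coordinates. *)
Lemma sn_covarianceE (Psi Sigma U : symM R d) :
  (vecs o U *m sn_covariance o Psi Sigma *m (vecs o U)^T) ord0 ord0 =
  frob (sn_operator Psi Sigma U) U.
Proof.
pose K := @sn_operator R d Psi Sigma.
have KD A B : K (A + B) = K A + K B.
  by rewrite /K /sn_operator !mulmxDr !mulmxDl -scalerDr addrACA.
have KZ c A : K (c *: A) = c *: K A.
  by rewrite /K /sn_operator -!scalemxAr -!scalemxAl -scalerDr !scalerA mulrC.
rewrite (sym_linear_expand U (frobDr _) (fun c => frobZr c _)) [LHS]mxE.
apply: eq_bigr => b _; rewrite mulrC; congr (_ * _); first by rewrite [LHS]mxE.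
have := @sym_linear_expand (fun A => frob (K A) (basis o b)) U.
rewrite /= => ->; last 2 first.
- by move=> A B; rewrite KD frobDl.
- by move=> c A; rewrite KZ frobZl.
by rewrite [LHS]mxE; apply: eq_bigr => a _; congr (_ * _); rewrite [LHS]mxE.
Qed.

End vecs_theory.

Section sn_operator_theory.
Context {R : realType} {d : nat}.

(** Cyclicity of the trace turns both halves of the symmetrized operator into the same trace. *)
Lemma frob_sn_operator (Psi Sigma Ph Sh U : symM R d) :
  Ph *m Ph = Psi :> 'M[R]_d -> Sh *m Sh = Sigma :> 'M[R]_d ->
  frob (sn_operator Psi Sigma U) U =
  frob (Ph *m U *m Sh) (Ph *m U *m Sh).
Proof.
move=> PhE ShE; have tr (S : symM R d) : (S : 'M[R]_d)^T = S by apply/eqP; case: S.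
rewrite /sn_operator frobZl frobDl /frob !trmx_mul !tr -PhE -ShE !mulmxA.
have -> : \tr (Sh *m Sh *m U *m Ph *m Ph *m U) =
          \tr (Sh *m U *m Ph *m Ph *m U *m Sh).
  by rewrite -!mulmxA mxtrace_mulC !mulmxA.
have -> : \tr (Ph *m Ph *m U *m Sh *m Sh *m U) =
          \tr (Sh *m U *m Ph *m Ph *m U *m Sh).
  by rewrite -[_ *m Sh *m U]mulmxA mxtrace_mulC !mulmxA.
by field.
Qed.

Lemma frob_mulmx3 (U A B C : 'M[R]_d) :
  frob U (A *m B *m C) = frob (A^T *m U *m C^T) B.
Proof.
by rewrite /frob !trmx_mul !trmxK !mulmxA mxtrace_mulC !mulmxA.
Qed.

End sn_operator_theory.

(** * The implicit Euler scheme *)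

Section euler.
Context {R : realType}.
Notation mu := (@lebesgue_measure R).

(** Compactness in its near-covering form: the parameter is the radius [del] tending to 0 from the
    right, and each point of [0, t] supplies radii valid in a neighbourhood. *)
Lemma heine_cantor (z : R -> R) (t e : R) : continuous z -> 0 < e ->
  exists2 del, 0 < del & forall x y, 0 <= x <= t -> 0 <= y <= t ->
    `|x - y| < del -> `|z x - z y| < e.
Proof.
move=> cz e0.
have := @segment_compact R 0 t; rewrite compact_near_coveringP.
move=> /(_ R (0^'+) (fun del x => forall y, `|x - y| < del -> `|z x - z y| < e)).
move=> /(_ _ _)[|del0 /= del00 H].
  move=> x _; have e2 : 0 < e / 2 by rewrite divr_gt0.
  have /cvgrPdist_lt/(_ _ e2)/nbhs_ballP[eta /= eta0 Heta] := cz x.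
  have eta2 : 0 < eta / 2 by rewrite divr_gt0.
  exists (ball x (eta / 2), [set u | u < eta / 2]).
    split; first exact: nbhsx_ballx.
    exact: nbhs_right_lt.
  move=> [x' del] /= [xx' dele] y x'y.
  have h1 : `|z x - z x'| < e / 2.
    by apply: Heta; apply: le_ball xx'; lra.
  have h2 : `|z x - z y| < e / 2.
    apply: Heta; rewrite /ball/= (splitr eta).
    rewrite (le_lt_trans (ler_distD x' _ _))// ltrD//.
    exact: lt_trans dele.
  rewrite (splitr e) (le_lt_trans (ler_distD (z x) _ _))// ltrD//.
  by rewrite distrC.
exists (del0 / 2); first by rewrite divr_gt0.
move=> x y x0t y0t xy; apply: (H (del0 / 2)) => //=.
- rewrite sub0r normrN gtr0_norm ?divr_gt0//.
  by lra.
- by rewrite divr_gt0.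
Qed.

(** Paths are continuous on [0, +oo[ only. Freezing them at their initial value for negative times
    gives functions continuous on the whole line. *)
Lemma within_continuous_max (z : R -> R) :
  {within `[0, +oo[, continuous z} -> continuous (fun s : R => z (Num.max s 0)).
Proof.
move=> /subspace_continuousP cz x.
have x0 : `[0, +oo[%classic (Num.max x 0) by rewrite /= in_itv/= le_max lexx orbT.
have := cz _ x0; apply: cvg_trans.
move=> P; rewrite /= => zP.
have cm : Num.max s 0 @[s --> x] --> Num.max x 0.
  by apply: (@continuous_max _ R^o); [exact: cvg_id|exact: cvg_cst].
have zP' : \forall y \near Num.max x 0, `[0, +oo[%classic y -> P (z y) by exact: zP.
have H : \forall s \near x,
    `[0, +oo[%classic (Num.max s 0) -> P (z (Num.max s 0)) by exact: (cm _ zP').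
change (\forall s \near x, P (z (Num.max s 0))).
apply: filterS H => s; apply.
by rewrite /= in_itv/= le_max lexx orbT.
Qed.

Lemma continuous_integrable_itv (z : R -> R) (a b : R) : continuous z ->
  mu.-integrable `[a, b] (EFin \o z).
Proof.
move=> cz; apply: continuous_compact_integrable; first exact: segment_compact.
exact: continuous_subspaceT.
Qed.

Section recurrence.
Variables (z b : R -> R) (z0 : R).
Hypothesis cz : continuous z.
Hypothesis b0 : b 0 = 0.
Hypothesis zE : forall s, 0 <= s ->
  z s = z0 - \int[mu]_(u in `[0, s]) z u + b s.

(** Subtracting the equations at [v] and at [u] leaves the integral over ]u, v] of z(v) - z(s), the
    error of the right-endpoint rule. *)
Lemma euler_step_error (u v e : R) : 0 <= u <= v ->
  (forall s, u < s <= v -> `|z v - z s| <= e) ->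
  `|(1 + (v - u)) * z v - (z u + (b v - b u))| <= (v - u) * e.
Proof.
move=> /andP[u0 uv] ze; have v0 : 0 <= v by exact: le_trans uv.
have iz (a c : R) : mu.-integrable `]a, c] (EFin \o z).
  apply: integrableS (continuous_integrable_itv a c cz) => //.
  exact: subset_itv_oc_cc.
have I1 : \int[mu]_(s in `[0, v]) z s - \int[mu]_(s in `[0, u]) z s =
    \int[mu]_(s in `]u, v]) z s.
  by rewrite Rintegral_itvB ?bnd_simp//; exact: continuous_integrable_itv.
have muI : mu `]u, v]%classic = (v - u)%:E.
  rewrite lebesgue_measure_itv/= lte_fin; case: ltP => // vu.
  by have -> : v = u; [apply/le_anti/andP|rewrite subrr].
have icst (c : R) : mu.-integrable `]u, v] (EFin \o cst c).
  apply: (@integrableS _ _ _ mu `[u, v]) => //; first exact: subset_itv_oc_cc.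
  by apply: continuous_integrable_itv => x; exact: cvg_cst.
have Ic : \int[mu]_(s in `]u, v]) z v = z v * (v - u).
  by rewrite Rintegral_cst// [X in fine X]muI.
have -> : (1 + (v - u)) * z v - (z u + (b v - b u)) =
    \int[mu]_(s in `]u, v]) (z v - z s).
  have := @RintegralB _ _ _ mu _ _ _ (measurable_itv _) (icst (z v)) (iz u v).
  rewrite /= Ic -I1 => ->.
  by rewrite mulrDl mul1r {1}(zE v0) {1}(zE u0); ring.
apply: (le_trans (le_normr_Rintegral _ _)) => //.
  by have := integrableB (mu := mu) (measurable_itv _) (icst (z v)) (iz u v).
have -> : (v - u) * e = \int[mu]_(s in `]u, v]) e.
  by rewrite Rintegral_cst// [X in fine X]muI/= mulrC.
apply: le_Rintegral => //.
- have := integrableB (mu := mu) (measurable_itv _) (icst (z v)) (iz u v).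
  by move/integrable_abse.
- exact: icst.
Qed.

Lemma implicit_euler_sum (y r f : nat -> R) (rho : R) (n : nat) :
  (forall k, (k < n)%N -> y k.+1 = rho * (y k + f k)) ->
  y n = rho ^+ n * y 0%N + \sum_(k < n) rho ^+ (n - k) * f k.
Proof.
elim: n => [|n IH] yE; first by rewrite expr0 mul1r big_ord0 addr0.
rewrite yE// IH => [|k kn]; last by rewrite yE// ltnW.
rewrite big_ord_recr/= subSnn expr1 mulrDr mulrDr mulrA -exprS -addrA; congr (_ + _).
congr (_ + _); rewrite mulr_sumr.
by apply: eq_bigr => k _; rewrite mulrA -exprS subSn// ltnW.
Qed.

(** The exact path satisfies the implicit recurrence up to the errors [er k]. Unrolling multiplies
    each of them by a power of [rho n], at most 1, so the errors merely add up. *)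
Lemma cvg_implicit_euler (t : R) : 0 <= t ->
  let rho n : R := (1 + t / n.+1%:R)^-1 in
  rho n ^+ n.+1 * z0 + \sum_(k < n.+1) rho n ^+ (n.+1 - k) *
    (b (t * k.+1%:R / n.+1%:R) - b (t * k%:R / n.+1%:R)) @[n --> \oo] --> z t.
Proof.
move=> t0 rho; apply/cvgrPdist_le => e e0.
(* Each of the n + 1 steps errs by at most e / (t + 1) times its length t / (n + 1), in total t e /
   (t + 1) <= e. The + 1 covers t = 0. *)
have [del del0 Hdel] := @heine_cantor z t (e / (t + 1)) cz (divr_gt0 e0 (ltr_wpDl t0 ltr01)).
near=> n.
have n0 : 0 < n.+1%:R :> R by rewrite ltr0Sn.
have dn : t / n.+1%:R < del.
  rewrite ltr_pdivrMr// mulrC -ltr_pdivrMr//; near: n.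
  exists (Num.bound (t / del)) => // n /= bn.
  rewrite (lt_le_trans (archi_boundP _)) ?divr_ge0// ?(ltW del0)//.
  by rewrite ler_nat leqW.
pose tt k : R := t * k%:R / n.+1%:R.
have ttS k : tt k.+1 - tt k = t / n.+1%:R.
  by rewrite /tt -natr1; field; rewrite gt_eqF.
have tt0 k : 0 <= tt k by rewrite divr_ge0 ?mulr_ge0// ltW.
have ttmono k : tt k <= tt k.+1 by rewrite -subr_ge0 ttS divr_ge0// ltW.
have ttn k : (k <= n.+1)%N -> tt k <= t.
  by move=> kn; rewrite ler_pdivrMr// ler_wpM2l// ler_nat.
have dt0 : 0 <= t / n.+1%:R by rewrite divr_ge0// ltW.
have rho_gt0 : 0 < 1 + t / n.+1%:R by rewrite ltr_wpDr.
pose er k := (1 + t / n.+1%:R) * z (tt k.+1) - (z (tt k) + (b (tt k.+1) - b (tt k))).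
have erle k : (k < n.+1)%N -> `|er k| <= t / n.+1%:R * (e / (t + 1)).
  move=> kn; rewrite /er -(ttS k); apply: euler_step_error; first by rewrite tt0 ttmono.
  move=> s /andP[ks sk]; apply/ltW/Hdel.
  - by rewrite tt0 ttn.
  - by rewrite (le_trans (tt0 k) (ltW ks)) (le_trans sk) ?ttn.
  - rewrite ger0_norm ?subr_ge0// (le_lt_trans _ dn)// -(ttS k) lerB// ltW//.
have := @implicit_euler_sum (fun k => z (tt k)) (fun=> 0)
  (fun k => (b (tt k.+1) - b (tt k)) + er k) (rho n) n.+1.
have -> : tt 0%N = 0 by rewrite /tt mulr0 mul0r.
have -> : tt n.+1 = t by rewrite /tt mulfK// gt_eqF.
have -> : z 0 = z0.
  by rewrite zE// b0 set_itv1 Rintegral_set1 subr0 addr0.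
move=> ->; last first.
  move=> k _; apply: (mulfI (lt0r_neq0 rho_gt0)); rewrite mulVKf ?gt_eqF//.
  by rewrite /er; ring.
under [X in _ + X - _]eq_bigr do rewrite mulrDr.
rewrite big_split/= [X in `|X|](_ : _ =
  \sum_(k < n.+1) rho n ^+ (n.+1 - k) * er k); last by rewrite /tt; ring.
apply: (le_trans (ler_norm_sum _ _ _)).
apply: (@le_trans _ _ (\sum_(k < n.+1) t / n.+1%:R * (e / (t + 1)))).
  apply: ler_sum => k _; rewrite normrM.
  apply: (@le_trans _ _ (1 * `|er k|)); last by rewrite mul1r erle.
  rewrite ler_wpM2r// normrX exprn_ile1// gtr0_norm ?invr_gt0//.
  by rewrite invf_le1// lerDl.
have t1 : 0 < t + 1 by rewrite ltr_wpDl.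
rewrite sumr_const card_ord -[leLHS]mulr_natl.
rewrite (_ : _ * _ = t / (t + 1) * e); last by field; rewrite !gt_eqF.
by rewrite ler_piMl ?(ltW e0)// ler_pdivrMr// mul1r lerDl.
Unshelve. all: end_near. Qed.

End recurrence.

(** With del = t / (n + 1), exp(- del) <= 1 / (1 + del) <= exp(- del + del^2), the latter because (1
    - del + del^2) (1 + del) = 1 + del^3 >= 1. *)
Lemma cvg_compound (t : R) : 0 <= t ->
  (1 + t / n.+1%:R)^-1 ^+ n.+1 @[n --> \oo] --> expR (- t).
Proof.
move=> t0.
have n0 n : 0 < n.+1%:R :> R by rewrite ltr0Sn.
have d0 n : 0 <= t / n.+1%:R by rewrite divr_ge0// ltW.
have dE n (c : R) : expR (c / n.+1%:R) ^+ n.+1 = expR c.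
  by rewrite -expRM_natl mulrC divfK// gt_eqF.
apply: (@squeeze_cvgr _ _ _ _ (fun=> expR (- t))
   (fun n => expR (- t + t * t * n.+1%:R^-1))).
- apply: nearW => n; set del := t / n.+1%:R.
  have del0 : 0 <= del by exact: d0.
  have p : 0 < 1 + del by rewrite ltr_wpDr.
  apply/andP; split.
    rewrite -(dE n) mulNr -/del lerXn2r ?nnegrE ?expR_ge0 ?invr_ge0 ?(ltW p)//.
    by rewrite expRN lef_pV2 ?posrE ?expR_gt0// expR_ge1Dx.
  rewrite -(dE n) lerXn2r ?nnegrE ?expR_ge0 ?invr_ge0 ?(ltW p)//.
  have -> : (- t + t * t * n.+1%:R^-1) / n.+1%:R = - (del - del ^+ 2).
    by rewrite /del; field; rewrite gt_eqF.
  have h : 1 - (del - del ^+ 2) <= expR (- (del - del ^+ 2)) by exact: expR_ge1Dx.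
  rewrite -[leLHS]mul1r ler_pdivrMr//.
  apply: (@le_trans _ _ ((1 - (del - del ^+ 2)) * (1 + del))); last first.
    by rewrite ler_wpM2r// ltW.
  rewrite -subr_ge0 (_ : _ - _ = del ^+ 3); last by ring.
  exact: exprn_ge0.
- exact: cvg_cst.
- apply: continuous_cvg; first exact: continuous_expR.
  rewrite -[X in _ --> X]addr0; apply: cvgD; first exact: cvg_cst.
  rewrite -[X in _ --> X](mulr0 (t * t)); apply: cvgM; first exact: cvg_cst.
  exact: cvg_harmonic.
Qed.

End euler.

(** * Characteristic function of the Ornstein-Uhlenbeck process *)

Section brownian_sums.
Context {disp : measure_display} {T : measurableType disp} {R : realType}.
Variable P : probability T R.

Lemma independent_rvs_comp (I : finType) (X : I -> T -> R) (f : I -> R -> R) :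
  (forall i, measurable_fun setT (f i)) ->
  independent_rvs P X -> independent_rvs P (fun i w => f i (X i w)).
Proof.
move=> mf iX J A AJ; apply: iX => i /AJ[B mB <-].
exists (f i @^-1` B); last by rewrite !setTI.
by rewrite -[X in measurable X]setTI; exact: mf.
Qed.

Lemma brownian_sum_cos (W : R -> T -> R) (n : nat) (c : 'I_n -> R) (t : nat -> R) (th : R) :
  brownian_motion P W -> 0 <= t 0%N -> (forall i, t i <= t i.+1) ->
  \int[P]_w cos (\sum_(k < n) c k * (W (t k.+1) w - W (t k) w) + th) =
  expR (- ((\sum_(k < n) c k ^+ 2 * (t k.+1 - t k)) / 2)) * cos th.
Proof.
move=> BW t0 tS.
have tk k : 0 <= t k by elim: k => // k IH; exact: le_trans (tS k).
have g k := bm_gaussian BW (tk k) (tS k).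
apply: (@expectation_cos_sum _ _ _ P _ (fun k w => c k * (W (t k.+1) w - W (t k) w))
   _ _ (fun k => c k ^+ 2 * (t k.+1 - t k))).
- by move=> k; apply: measurable_funM => //; exact: (g k).1.
- apply: (@independent_rvs_comp _ _ (fun k x => c k * x)).
    by move=> k; exact: measurable_funM.
  have H := @bm_independent _ _ _ _ _ BW n t t0 tS.
  exact: H.
- move=> k a; rewrite (gaussian_rv_cos (g k)) ?subr_ge0//.
  by rewrite mulr0 add0r.
Qed.

(** [brownian_matrix] makes the sigma-algebras generated by the entries independent; this places the
    sums over time steps in them. *)
Lemma process_sigma_sum (W : R -> T -> R) (n : nat) (c : 'I_n -> R) (t : nat -> R) :
  (forall i, 0 <= t i) ->
  preimage_set_system setT (fun w => \sum_(k < n) c k * (W (t k.+1) w - W (t k) w))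
    measurable `<=` process_sigma W.
Proof.
move=> t0; rewrite /process_sigma; set G := [set A | _].
have mW s : 0 <= s -> measurable_fun setT (W s : g_sigma_algebraType G -> R).
  by move=> s0 _ A mA; apply: sub_sigma_algebra; exists s => //; exists A.
have mS : measurable_fun setT ((fun w => \sum_(k < n) c k * (W (t k.+1) w - W (t k) w))
    : g_sigma_algebraType G -> R).
  apply: measurable_sum => k; apply: measurable_funM => //.
  by apply: measurable_funB; exact: mW.
by move=> _ [A mA <-]; exact: mS.
Qed.

End brownian_sums.

Section ou_law.
Context {disp : measure_display} {T : measurableType disp} {R : realType}.
Variables (P : probability T R) (d : nat) (B : R -> T -> 'M[R]_d).
Hypothesis BB : brownian_matrix P B.

(** The pairing is regrouped by entries: increments in time are independent within an entry, and the
    resulting sums are independent across entries. *)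
Lemma brownian_matrix_sum_cos (A : 'M[R]_d) (n : nat) (c : 'I_n -> R)
    (t : nat -> R) (th : R) :
  0 <= t 0%N -> (forall i, t i <= t i.+1) ->
  \int[P]_w cos (\sum_(k < n) c k * frob A (B (t k.+1) w - B (t k) w) + th) =
  expR (- ((frob A A * \sum_(k < n) c k ^+ 2 * (t k.+1 - t k)) / 2)) * cos th.
Proof.
move=> t0 tS; have tk k : 0 <= t k by elim: k => // k IH; exact: le_trans (tS k).
pose W (ij : 'I_d * 'I_d) := fun s w => B s w ij.1 ij.2.
pose S ij w := \sum_(k < n) (A ij.1 ij.2 * c k) * (W ij (t k.+1) w - W ij (t k) w).
have -> : (fun w => cos (\sum_(k < n) c k * frob A (B (t k.+1) w - B (t k) w) + th)) =
    fun w => cos (\sum_ij S ij w + th).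
  apply/funext => w; congr (cos (_ + th)); rewrite exchange_big/=.
  apply: eq_bigr => k _; rewrite frobE pair_big/= mulr_sumr.
  by apply: eq_bigr => -[i j] _ /=; rewrite !mxE /W/=; ring.
have gE ij k := bm_gaussian (BB.1 ij.1 ij.2) (tk k) (tS k).
rewrite (@expectation_cos_sum _ _ _ P _ S _ _
  (fun ij => \sum_(k < n) (A ij.1 ij.2 * c k) ^+ 2 * (t k.+1 - t k))).
- congr (expR (- (_ / 2)) * _).
  have -> : frob A A = \sum_ij A ij.1 ij.2 * A ij.1 ij.2 by rewrite frobE pair_bigA.
  rewrite mulr_suml; apply: eq_bigr => ij _.
  by rewrite mulr_sumr; apply: eq_bigr => k _; ring.
- move=> ij; apply: measurable_sum => k; apply: measurable_funM => //.
  exact: (gE ij k).1.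
- move=> J C CJ; apply: BB.2 => ij /CJ; exact: process_sigma_sum.
- by move=> ij a; apply: brownian_sum_cos => //; exact: BB.1.
Qed.

Variables (M Ph Sh : symM R d) (Y : symM R d) (X : R -> T -> symM R d).
Hypothesis XE : ou_solution P B M Ph Sh Y X.

Let rho (t : R) n : R := (1 + t / n.+1%:R)^-1.

Let geometric_sum_rev (q c : R) : q * (1 + c) = 1 -> forall n,
  c * (\sum_(k < n) q ^+ (n - k)) = 1 - q ^+ n.
Proof.
move=> qc; elim=> [|n IH]; first by rewrite big_ord0 mulr0 subrr.
rewrite big_ord_recr/= subSnn expr1.
have -> : \sum_(i < n) q ^+ (n.+1 - i) = q * \sum_(i < n) q ^+ (n - i).
  by rewrite mulr_sumr; apply: eq_bigr => k _; rewrite -exprS subSn// ltnW.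
by rewrite mulrDr mulrCA IH exprS -[X in _ = X - _]qc; ring.
Qed.

(** Each entry of X_s - M satisfies, path by path, the scalar equation of [cvg_implicit_euler]; the
    entries are then paired with [U]. *)
Lemma ou_euler (U : symM R d) (t : R) : 0 <= t ->
  {ae P, forall w,
    frob U M + rho t n ^+ n.+1 * frob U (Y - M) +
    \sum_(k < n.+1) rho t n ^+ (n.+1 - k) * (Num.sqrt 2 *
      frob (Ph *m U *m Sh) (B (t * k.+1%:R / n.+1%:R) w - B (t * k%:R / n.+1%:R) w))
    @[n --> \oo] --> frob U (X t w)}.
Proof.
move=> t0; have [mX aeX] := XE.
(* Starting at 0 is almost sure for each entry separately; the finitely many entries share a null
   set. *)
have B0 : {ae P, forall w, forall i j, B 0 w i j = 0}.
  have : {ae P, forall w, forall ij : 'I_d * 'I_d, B 0 w ij.1 ij.2 = 0}.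
    apply: filter_forall => ij; exact: bm_start (BB.1 ij.1 ij.2).
  by apply: filterS => w h i j; exact: (h (i, j)).
apply: filterS2 aeX B0 => w [cX XwE] Bw0.
pose b i j s := ((Num.sqrt 2)^-1 *: (Ph *m B s w *m Sh)
           + (Num.sqrt 2)^-1 *: (Sh *m (B s w)^T *m Ph)) i j.
pose tt n k : R := t * k%:R / n.+1%:R.
have H i j : M i j + (rho t n ^+ n.+1 * (Y i j - M i j) +
    \sum_(k < n.+1) rho t n ^+ (n.+1 - k) * (b i j (tt n k.+1) - b i j (tt n k)))
    @[n --> \oo] --> X t w i j.
  pose x s := X s w i j - M i j.
  pose z s := x (Num.max s 0).
  have max0 (s : R) : 0 <= s -> Num.max s 0 = s by move=> s0; rewrite max_l.
  have cx : {within `[0, +oo[, continuous x}.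
    apply/subspace_continuousP => s s0.
    apply: cvgB; last exact: cvg_cst.
    have /subspace_continuousP/(_ s s0) cXs := cX.
    exact: (@cvg_comp _ _ _ _ (fun S : symM R d => S i j) _ _ _ cXs
      (@continuous_entry R d i j (X s w))).
  have cz : continuous z := within_continuous_max cx.
  have b0 : b i j 0 = 0.
    rewrite /b (_ : B 0 w = 0); last by apply/matrixP => k l; rewrite Bw0 mxE.
    by rewrite mulmx0 mul0mx trmx0 mulmx0 mul0mx scaler0 addr0 mxE.
  have zE s : 0 <= s ->
      z s = (Y i j - M i j) - \int[lebesgue_measure]_(u in `[0, s]) z u + b i j s.
    move=> s0; rewrite /z /x max0// XwE// -/(b i j s).
    have -> : \int[lebesgue_measure]_(u in `[0, s]) (X (Num.max u 0) w i j - M i j) =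
        \int[lebesgue_measure]_(u in `[0, s]) (X u w i j - M i j); last by ring.
    by apply: eq_Rintegral => u; rewrite inE/= in_itv/= => /andP[u0 _]; rewrite max0.
  have := cvg_implicit_euler cz b0 zE t0.
  rewrite /z /x max0// => /(cvgD (cvg_cst (M i j))).
  by rewrite [X in _ --> X]addrC subrK.
pose G n := \sum_i \sum_j U i j * (M i j + (rho t n ^+ n.+1 * (Y i j - M i j) +
    \sum_(k < n.+1) rho t n ^+ (n.+1 - k) * (b i j (tt n k.+1) - b i j (tt n k)))).
have HG : G n @[n --> \oo] --> \sum_i \sum_j U i j * X t w i j.
  apply: cvg_big => [|i _]; first exact: add_continuous.
  apply: cvg_big => [|j _]; first exact: add_continuous.
  by apply: cvgM; [exact: cvg_cst|exact: H].
rewrite [X in _ --> X]frobE; rewrite (_ : (fun n => _) = G)//.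
apply/funext => n; rewrite /G; symmetry.
pose Bm s : 'M[R]_d := (Num.sqrt 2)^-1 *: (Ph *m B s w *m Sh)
           + (Num.sqrt 2)^-1 *: (Sh *m (B s w)^T *m Ph).
transitivity (frob U (symval M + (rho t n ^+ n.+1 *: (symval Y - symval M) +
   \sum_(k < n.+1) rho t n ^+ (n.+1 - k) *: (Bm (tt n k.+1) - Bm (tt n k))))).
  rewrite frobE; apply: eq_bigr => i _; apply: eq_bigr => j _.
  rewrite [in RHS]mxE; congr (_ * (_ + _)); rewrite [in RHS]mxE; congr (_ + _).
    by rewrite !mxE.
  by rewrite summxE; apply: eq_bigr => k _; rewrite [RHS]mxE; congr (_ * _);
    rewrite [RHS]mxE [X in _ = _ + X]mxE.
rewrite (frobDr U (symval M)) frobDr frobZr addrA; congr (_ + _).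
have -> (s : seq 'I_n.+1) (F : 'I_n.+1 -> 'M[R]_d) :
    frob U (\sum_(k <- s) F k) = \sum_(k <- s) frob U (F k).
  elim: s => [|k s IH]; last by rewrite !big_cons frobDr IH.
  by rewrite !big_nil; have := frobZr 0 U (0 : 'M[R]_d); rewrite scale0r mul0r.
apply: eq_bigr => k _; rewrite frobZr; congr (_ * _).
rewrite -/(tt n k) -/(tt n k.+1).
have tr (S : symM R d) : (S : 'M[R]_d)^T = S by apply/eqP; case: S.
(* Transposition and the symmetry of [U], [Ph], [Sh] make both noise terms pair to the same number;
   2 / sqrt 2 = sqrt 2. *)
have BmE s : frob U (Bm s) = Num.sqrt 2 * frob (Ph *m U *m Sh) (B s w).
  rewrite /Bm frobDr !frobZr !frob_mulmx3 !tr -(frob_trmx _ (B s w)^T) trmxK.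
  rewrite !trmx_mul !tr mulmxA -mulrDl.
  have s2 : Num.sqrt 2 * Num.sqrt 2 = 2 :> R by rewrite -expr2 sqr_sqrtr.
  have s0 : Num.sqrt 2 != 0 :> R by rewrite gt_eqF// sqrtr_gt0.
  congr (_ * _); apply: (mulfI s0); rewrite s2 mulrDr mulfV//.
by rewrite frobBr !BmE -mulrBr -frobBr.
Qed.

(** For each [n] the noise part of the scheme is a combination of independent Gaussian increments,
    whose variance [V n] is a geometric sum. Its closed form [VE] tends to (1 - exp(- 2 t)) v. *)
Lemma ou_cos (U : symM R d) (t th : R) : 0 <= t ->
  \int[P]_w cos (frob U (X t w) + th) =
  expR (- ((1 - expR (- (2 * t))) * frob (Ph *m U *m Sh) (Ph *m U *m Sh) / 2)) *
  cos (frob U M + expR (- t) * frob U (Y - M) + th).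
Proof.
move=> t0; pose A := Ph *m U *m Sh; pose v := frob A A.
pose tt n k : R := t * k%:R / n.+1%:R.
pose a n := frob U M + rho t n ^+ n.+1 * frob U (Y - M) + th.
pose Sn n w := \sum_(k < n.+1) rho t n ^+ (n.+1 - k) * (Num.sqrt 2 *
  frob A (B (tt n k.+1) w - B (tt n k) w)).
have n0 n : 0 < n.+1%:R :> R by rewrite ltr0Sn.
have tt0 n : 0 <= tt n 0%N by rewrite /tt mulr0 mul0r.
have ttS n k : tt n k <= tt n k.+1.
  by rewrite ler_pM2r ?invr_gt0// ler_wpM2l// ler_nat.
have ttd n k : tt n k.+1 - tt n k = t / n.+1%:R.
  by rewrite /tt -natr1; field; rewrite gt_eqF.
have c1 : \int[P]_w cos (Sn n w + a n) @[n --> \oo] -->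
          \int[P]_w cos (frob U (X t w) + th).
  apply: (@cvg_Rintegral_bounded _ _ _ P _ _ 1).
  - move=> n; apply: measurableT_comp; first exact: measurable_cos.
    apply: measurable_funD => //; apply: measurable_sum => k.
    do 2!apply: measurable_funM => //.
    have ttk j : 0 <= tt n j by rewrite divr_ge0// mulr_ge0.
    under [X in measurable_fun _ X]eq_fun do rewrite frobE.
    apply: measurable_sum => i; apply: measurable_sum => j.
    under [X in measurable_fun _ X]eq_fun do rewrite !mxE.
    apply: measurable_funM => //; apply: measurable_funB.
      exact: (bm_measurable (BB.1 i j)).
    exact: (bm_measurable (BB.1 i j)).
  - apply: measurableT_comp; first exact: measurable_cos.
    apply: measurable_funD => //.
    exact: measurableT_comp (measurable_frob _) (XE.1 t t0).
  - by move=> n w; exact: normr_cos_le1.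
  - have := ou_euler U t0; apply: filterS => w; move=> h.
    apply: continuous_cvg; first exact: continuous_cos.
    rewrite (_ : (fun n => _) = (fun n => (frob U M + rho t n ^+ n.+1 * frob U (Y - M) +
      Sn n w) + th)); last by apply/funext => n; rewrite /a; ring.
    by apply: cvgD; [exact: h|exact: cvg_cst].
pose V n := v * (2 * \sum_(k < n.+1) (rho t n ^+ (n.+1 - k)) ^+ 2 * (t / n.+1%:R)).
have E n : \int[P]_w cos (Sn n w + a n) = expR (- (V n / 2)) * cos (a n).
  have := @brownian_matrix_sum_cos A n.+1
    (fun k => rho t n ^+ (n.+1 - k) * Num.sqrt 2) (tt n) (a n) (tt0 n) (ttS n).
  under eq_Rintegral do under eq_bigr do rewrite -mulrA.
  move=> ->; congr (expR (- (_ / 2)) * _); rewrite /V -/v; congr (_ * _).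
  rewrite mulr_sumr; apply: eq_bigr => k _.
  by rewrite exprMn sqr_sqrtr// ttd; ring.
have crho : rho t n ^+ n.+1 @[n --> \oo] --> expR (- t) by exact: cvg_compound.
have VE n : V n = v * (2 * (1 - (rho t n ^+ n.+1) ^+ 2) / (2 + t / n.+1%:R)).
  have del0 : 0 <= t / n.+1%:R by rewrite divr_ge0// ltW.
  have p1 : 1 + t / n.+1%:R != 0 by rewrite gt_eqF// ltr_wpDr.
  have p2 : 2 + t / n.+1%:R != 0 by rewrite gt_eqF// ltr_wpDr.
  (* The ratio is rho^2, whose inverse is (1 + del)^2 = 1 + (2 + del) del with del = t / (n + 1). *)
  have := @geometric_sum_rev (rho t n ^+ 2) ((2 + t / n.+1%:R) * (t / n.+1%:R)).
  have -> : rho t n ^+ 2 * (1 + (2 + t / n.+1%:R) * (t / n.+1%:R)) = 1.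
    rewrite /rho; set del := t / n.+1%:R.
    have -> : 1 + (2 + del) * del = (1 + del) ^+ 2 by ring.
    by rewrite -exprMn mulVf// expr1n.
  move=> /(_ erefl n.+1); rewrite -exprM mulnC exprM => <-; rewrite /V.
  have -> : \sum_(k < n.+1) (rho t n ^+ (n.+1 - k)) ^+ 2 * (t / n.+1%:R) =
      (t / n.+1%:R) * \sum_(k < n.+1) (rho t n ^+ 2) ^+ (n.+1 - k).
    by rewrite mulr_sumr; apply: eq_bigr => k _; rewrite exprAC mulrC.
  set s := \sum_(k < n.+1) _; move: p2; set del := t / n.+1%:R => p2.
  by field.
have c2 : \int[P]_w cos (Sn n w + a n) @[n --> \oo] -->
    expR (- ((1 - expR (- (2 * t))) * v / 2)) *
    cos (frob U M + expR (- t) * frob U (Y - M) + th).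
  rewrite (_ : (fun n => _) = fun n => expR (- (V n / 2)) * cos (a n)); last exact/funext.
  apply: cvgM; last first.
    apply: continuous_cvg; first exact: continuous_cos.
    apply: cvgD; last exact: cvg_cst.
    apply: cvgD; first exact: cvg_cst.
    by apply: cvgM; [exact: crho|exact: cvg_cst].
  apply: continuous_cvg; first exact: continuous_expR.
  apply: cvgN; apply: cvgM; last exact: cvg_cst.
  rewrite (_ : V = fun n => v * (2 * (1 - (rho t n ^+ n.+1) ^+ 2) / (2 + t / n.+1%:R)));
    last exact/funext.
  have -> : (1 - expR (- (2 * t))) * v = v * (2 * (1 - (expR (- t)) ^+ 2) / (2 + t * 0)).
    by rewrite -expRM_natl mulrN; field.
  apply: cvgM; first exact: cvg_cst.
  apply: cvgM.
    apply: cvgM; first exact: cvg_cst.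
    apply: cvgB; first exact: cvg_cst.
    by rewrite !expr2; apply: cvgM.
  apply: cvgV; first by rewrite mulr0 addr0.
  apply: cvgD; first exact: cvg_cst.
  by apply: cvgM; [exact: cvg_cst|exact: cvg_harmonic].
exact: cvg_unique c1 c2.
Qed.

End ou_law.

(** * Growth of test functions *)

Section growth.
Context {R : realType} {d : nat}.
Implicit Types (S T : symM R d) (h : symM R d -> R).

Definition growth (b : R) (N : nat) (C : R) h : Prop :=
  forall S T, `|h S - h T| <= C * (1 + `|S| + `|T|) ^+ N * `|S - T| `^ b.

Lemma holder_seminorm_le (b : R) h (c : R) :
  (holder_seminorm b h <= c%:E)%E <->
  (forall S T, S != T -> `|h S - h T| <= c * `|S - T| `^ b).
Proof.
split=> [hc S T ST|hc].
  have ST0 : 0 < `|S - T| `^ b by rewrite powR_gt0// normr_gt0 subr_eq0.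
  rewrite -ler_pdivrMr// -lee_fin; apply: le_trans hc.
  by apply: ereal_sup_ubound; exists S, T.
apply: ub_ereal_sup => _ [S [T [ST ->]]]; rewrite lee_fin.
rewrite ler_pdivrMr; first exact: hc.
by rewrite powR_gt0// normr_gt0 subr_eq0.
Qed.

Lemma holder_bound (b : R) h : holder b h -> exists2 C : R, 0 <= C &
  (holder_seminorm b h <= C%:E)%E.
Proof.
rewrite /holder; case: (holder_seminorm b h) => [r _|//|_].
  by exists `|r| => //; rewrite lee_fin ler_norm.
by exists 0 => //; rewrite leNye.
Qed.

Lemma holder_growth (b : R) h : holder b h -> exists2 C : R, 0 <= C & growth b 0 C h.
Proof.
move=> /holder_bound[C C0 /holder_seminorm_le hC]; exists C => // S T.
rewrite expr0 mulr1; have [->|ST] := eqVneq S T; last exact: hC.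
by rewrite subrr normr0 mulr_ge0// powR_ge0.
Qed.

Variable (o : 'I_(qd d) -> 'I_d * 'I_d).
Hypothesis o_ord : vecs_ordering o.

Lemma norm_basis a : `|basis o a : symM R d| = 1.
Proof.
rewrite symM_normE (frob_vecs o_ord) vecs_basis// mxE (bigD1 a)//= big1 => [|b ba].
  by rewrite addr0 !mxE !eqxx mulr1 sqrtr1.
by rewrite !mxE eqxx /= (negbTE ba) mul0r.
Qed.

Lemma normr_vecs_le S a : `|vecs o S ord0 a| <= `|S|.
Proof.
rewrite -(frob_basis o) frobC (le_trans (normr_frob_le _ _))//.
by have := norm_basis a; rewrite symM_normE => ->; rewrite mul1r.
Qed.

(** Scalar mean value theorem: the difference quotients of [phi] are those of [h] along the basis
    direction at the moving point. *)
Lemma directional_mvt h S a (r C : R) : (forall S', derivable h S' (basis o a)) ->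
  (forall c, `|c| <= `|r| -> `|'D_(basis o a) h (S + c *: basis o a)| <= C) ->
  `|h (S + r *: basis o a) - h S| <= C * `|r|.
Proof.
move=> hd hC; set E := basis o a; pose phi (c : R) := h (S + c *: E).
have shiftE (c u : R) : S + (u + c) *: E = u *: E + (S + c *: E).
  by rewrite scalerDl addrCA.
have dphi (c : R) : is_derive c 1 phi ('D_E h (S + c *: E)).
  have EF : (fun u : R => u^-1 *: (phi (u *: (1 : R) + c) - phi c)) =
      (fun u => u^-1 *: (h (u *: E + (S + c *: E)) - h (S + c *: E))).
    apply/funext => u; rewrite /phi -shiftE.
    by rewrite (_ : u *: (1 : R) = u)//; exact: mulr1.
  apply: DeriveDef.
    by rewrite /derivable EF; exact: hd.
  by rewrite /derive EF.
have cphi (x y : R) : {within `[x, y], continuous phi}.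
  apply: continuous_subspaceT => c; apply/differentiable_continuous/derivable1_diffP.
  by have [] := dphi c.
have phi0 : phi 0 = h S by rewrite /phi scale0r addr0.
rewrite -/E -/(phi r) -phi0.
have [r0|r0|r0] := ltgtP 0 r.
- have [c] := @MVT R phi (fun c => 'D_E h (S + c *: E)) 0 r r0 (fun c _ => dphi c) (cphi _ _).
  rewrite in_itv/= => /andP[c0 cr] ->; rewrite subr0 normrM ler_wpM2r// hC//.
  by rewrite !gtr0_norm// ltW.
- have [c] := @MVT R phi (fun c => 'D_E h (S + c *: E)) r 0 r0 (fun c _ => dphi c) (cphi _ _).
  rewrite in_itv/= => /andP[c0 cr] e; rewrite distrC e sub0r normrM normrN ler_wpM2r// hC//.
  by rewrite !ltr0_norm// lerN2 ltW.
- by rewrite -r0 subrr normr0 mulr0.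
Qed.

(** Induction on [p]: the first derivatives satisfy the claim for [p], hence are bounded by a
    multiple of (1 + |S|)^(p+1); the mean value theorem along coordinate directions integrates this
    bound. *)
Lemma lip_sym_growth (p : nat) h : lip_sym o p h ->
  exists2 C : R, 0 <= C & growth 1 p C h.
Proof.
elim: p h => [|p IH] h [hder hhol].
  by apply: holder_growth; exact: (hhol [::] erefl).
(* [coord_derive] applies the last direction of its list first, so differentiating [h] beforehand
   appends [i] at the end. *)
have Lg i : lip_sym o p ('D_(basis o i) h).
  split=> a ap; have E (a' : seq 'I_(qd d)) :
      coord_derive o a' ('D_(basis o i) h) = coord_derive o (rcons a' i) h.
  - by elim: a' => //= b a' ->.
  - by move=> S j; rewrite E; apply: hder; rewrite size_rcons.
  - by elim: a' => //= b a' ->.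
  - by rewrite E; apply: hhol; rewrite size_rcons ap.
have {IH} /choice[K HK] : forall i, exists K : R, 0 <= K /\ growth 1 p K ('D_(basis o i) h).
  by move=> i; have [K K0 gK] := IH _ (Lg i); exists K.
pose G i := `|'D_(basis o i) h 0| + K i.
have G0 i : 0 <= G i by rewrite addr_ge0// (HK i).1.
have GP i S : `|'D_(basis o i) h S| <= G i * (1 + `|S|) ^+ p.+1.
  have h1 : 1 <= 1 + `|S| by rewrite lerDl.
  have h1p : 1 <= (1 + `|S|) ^+ p.+1 by exact: exprn_ege1.
  rewrite -[X in `|X|](subrK ('D_(basis o i) h 0)) (le_trans (ler_normD _ _))//.
  rewrite addrC /G mulrDl lerD//; first by rewrite ler_peMr.
  rewrite (le_trans ((HK i).2 S 0))// normr0 addr0 subr0 powRr1//.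
  rewrite -mulrA exprSr ler_wpM2l ?(HK i).1// ler_wpM2l ?exprn_ge0 ?addr_ge0//.
  by rewrite lerDr.
(* Every point V of the coordinate path satisfies 1 + |V| <= Q (1 + |S| + |T|), each of the at most
   [qd d] moves having length at most |T - S|. *)
pose Q : R := 1 + (qd d)%:R.
have Q1 : 1 <= Q by rewrite lerDl.
exists (\sum_i G i * Q ^+ p.+1).
  by rewrite sumr_ge0// => i _; rewrite mulr_ge0// exprn_ge0// (le_trans ler01).
move=> S T; rewrite distrC powRr1//.
(* Telescoping along the coordinates, from [S] to [T]. *)
pose v a := vecs o (T - S) ord0 a.
pose F (s : seq 'I_(qd d)) := S + \sum_(a <- s) v a *: basis o a.
have FT : F (enum 'I_(qd d)) = T.
  by rewrite /F big_enum/= -(sym_expand o_ord) addrC subrK.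
have norm_sum (s : seq 'I_(qd d)) : `|\sum_(a <- s) v a *: basis o a : symM R d| <=
   (size s)%:R * `|T - S|.
  elim: s => [|a s IH]; first by rewrite big_nil normr0 mul0r.
  rewrite big_cons (le_trans (ler_normD _ _))// -natr1 addrC mulrDl mul1r lerD//.
  by rewrite normrZ norm_basis mulr1 normr_vecs_le.
suff H (s : seq 'I_(qd d)) : (size s <= qd d)%N ->
  `|h (F s) - h S| <= \sum_(a <- s) G a * Q ^+ p.+1 * (1 + `|S| + `|T|) ^+ p.+1 * `|S - T|.
  have := H (enum 'I_(qd d)).
  rewrite FT size_enum_ord leqnn => /(_ isT)/le_trans; apply.
  by rewrite big_enum/= !mulr_suml.
elim: s => [_|a s IH]; first by rewrite /F !big_nil addr0 subrr normr0.
move=> /= ss; rewrite big_cons.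
have -> : F (a :: s) = F s + v a *: basis o a.
  by rewrite /F big_cons [v a *: _ + _]addrC addrA.
rewrite (le_trans (ler_distD (h (F s)) _ _))// lerD//; last exact: IH (ltnW ss).
apply: (@le_trans _ _ (G a * Q ^+ p.+1 * (1 + `|S| + `|T|) ^+ p.+1 * `|v a|)); last first.
  rewrite ler_wpM2l//; last by rewrite distrC normr_vecs_le.
  by rewrite !mulr_ge0// ?exprn_ge0 ?addr_ge0.
apply: directional_mvt.
  by move=> S'; exact: (hder [::]).
move=> c cv; rewrite (le_trans (GP _ _))// -mulrA -exprMn ler_wpM2l// lerXn2r//.
- by rewrite nnegrE addr_ge0.
- by rewrite nnegrE mulr_ge0 ?addr_ge0// (le_trans ler01).
have TS : `|T - S| <= `|S| + `|T| by rewrite [leRHS]addrC ler_normB.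
have : `|F s + c *: basis o a| <= `|S| + (qd d)%:R * (`|S| + `|T|).
  rewrite /F -addrA (le_trans (ler_normD _ _))// lerD2l.
  apply: (@le_trans _ _ ((size s).+1%:R * `|T - S|)).
    rewrite (le_trans (ler_normD _ _))// -natr1 mulrDl mul1r lerD//.
    by rewrite normrZ norm_basis mulr1 (le_trans cv)// normr_vecs_le.
  by rewrite ler_pM// ler_nat.
move=> /(lerD (lexx 1))/le_trans; apply.
rewrite /Q mulrDl mul1r addrA; rewrite -subr_ge0.
have -> : 1 + `|S| + `|T| + (qd d)%:R * (1 + `|S| + `|T|) -
  (1 + `|S| + (qd d)%:R * (`|S| + `|T|)) = `|T| + (qd d)%:R by ring.
by rewrite addr_ge0.
Qed.

End growth.

Section powR_theory.
Context {R : realType}.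
Implicit Types (x y b : R).

Lemma powR_le1D x b : 0 <= x -> 0 < b <= 1 -> x `^ b <= 1 + x.
Proof.
move=> x0 /andP[b0 b1]; have [x1|x1] := leP x 1.
  apply: (@le_trans _ _ 1); last by rewrite lerDl.
  have <- : 1 `^ b = 1 :> R by rewrite powR1.
  by apply: ge0_ler_powR => //; rewrite ?nnegrE// ltW.
by rewrite (le_trans (ler1_powR (ltW x1) b1))// lerDr.
Qed.

(** For 0 <= u <= s and s > 0, u / s <= (u / s)^b, hence (u / s) s^b <= u^b. Take u = x and u = y
    with s = x + y, and add. *)
Lemma powRD_le x y b : 0 <= x -> 0 <= y -> 0 < b <= 1 ->
  (x + y) `^ b <= x `^ b + y `^ b.
Proof.
move=> x0 y0 /andP[b0 b1].
have H (u s : R) : 0 <= u -> 0 < s -> u <= s -> u / s * s `^ b <= u `^ b.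
  move=> u0 s0 us; have [->|un0] := eqVneq u 0.
    by rewrite !mul0r powR_ge0.
  have up : 0 < u by rewrite lt_def un0.
  rewrite -[in leRHS](divfK (lt0r_neq0 s0) u) powRM ?divr_ge0 ?(ltW s0)//.
  rewrite ler_wpM2r ?powR_ge0// ger1_powR// divr_gt0//=.
  by rewrite ler_pdivrMr// mul1r.
have [s0|s0] := eqVneq (x + y) 0.
  by rewrite s0 powR0 ?gt_eqF// addr_ge0// powR_ge0.
have sp : 0 < x + y by rewrite lt_def s0 addr_ge0.
apply: le_trans (lerD (H x _ x0 sp _) (H y _ y0 sp _)); rewrite ?lerDl ?lerDr//.
by rewrite -mulrDl -mulrDl divff// mul1r.
Qed.

End powR_theory.

Section growth_theory.
Context {R : realType} {d : nat}.
Implicit Types (S T : symM R d) (h : symM R d -> R).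
Variables (b : R) (N : nat) (C : R) (h : symM R d -> R).
Hypothesis b01 : 0 < b <= 1.
Hypothesis C0 : 0 <= C.
Hypothesis gh : growth b N C h.

Lemma near_norm_lt (S : symM R d) (e : R) : 0 < e -> \forall T \near S, `|S - T| < e.
Proof.
move=> e0; have := nbhsx_ballx S e e0.
by apply: (@filterS _ (nbhs S) (nbhs_filter S)) => T; rewrite -ball_normE.
Qed.

Lemma growth_continuous : continuous h.
Proof.
move=> S; apply: (proj2 (@cvgrPdist_lt _ _ _ (nbhs S) (nbhs_filter S) h (h S))) => e e0.
have /andP[b0 b1] := b01.
(* [K] bounds the growth factor on the unit ball around [S], the final + 1 making it positive; [del]
   solves K del^b = e. *)
pose K := C * (1 + `|S| + (`|S| + 1)) ^+ N + 1.
have K0 : 0 < K.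
  by rewrite ltr_wpDl// mulr_ge0// exprn_ge0// !addr_ge0.
pose del := (e / K) `^ b^-1.
have del0 : 0 < del by rewrite powR_gt0// divr_gt0.
have n1 : \forall T \near S, `|S - T| < 1.
  exact: near_norm_lt.
have n2 : \forall T \near S, `|S - T| < del by exact: near_norm_lt.
apply: filterS2 n1 n2 => T T1 T2.
apply: le_lt_trans (gh S T) _.
apply: (@le_lt_trans _ _ (K * `|S - T| `^ b)).
  rewrite ler_wpM2r ?powR_ge0//.
  apply: (@le_trans _ _ (C * (1 + `|S| + (`|S| + 1)) ^+ N)); last by rewrite lerDl.
  rewrite ler_wpM2l// lerXn2r ?nnegrE ?addr_ge0// lerD2l.
  rewrite -[T](subKr S) (le_trans (ler_normB _ _))// lerD2l.
  by rewrite ltW// subKr.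
rewrite mulrC -ltr_pdivlMr// (_ : e / K = del `^ b); last first.
  by rewrite /del -powRrM mulVf ?gt_eqF// powRr1// divr_ge0 ?ltW.
by apply: gt0_ltr_powR => //; rewrite ?nnegrE// ltW.
Qed.

Lemma growth_measurable : measurable_fun setT h.
Proof. by apply: continuous_measurable_sym; exact: growth_continuous. Qed.

(** The exponent rises by one because |S|^b <= 1 + |S|. *)
Lemma growth_abs : exists2 K : R, 0 <= K & forall S, `|h S| <= K * (1 + `|S|) ^+ N.+1.
Proof.
exists (`|h 0| + C) => [|S]; first by rewrite addr_ge0.
have S1 : 1 <= 1 + `|S| by rewrite lerDl.
rewrite -[X in `|X|](subrK (h 0)) (le_trans (ler_normD _ _))// addrC mulrDl lerD//.
  by rewrite ler_peMr// exprn_ege1.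
rewrite (le_trans (gh S 0))// normr0 addr0 subr0 exprSr -mulrA ler_wpM2l//.
rewrite ler_wpM2l ?exprn_ge0 ?addr_ge0//; exact: powR_le1D.
Qed.

End growth_theory.

(** * Integrals of random matrices with equal characteristic functions *)

Lemma bounded_mfun_cos_frob {R : realType} {d : nat} (U : 'M[R]_d) (th : R) :
  bounded_mfun (fun S : symM R d => cos (frob U S + th)).
Proof.
split; last by exists 1 => S; exact: normr_cos_le1.
apply: measurableT_comp; first exact: measurable_cos.
by apply: measurable_funD => //; exact: measurable_frob.
Qed.

Section equal_law.
Context {R : realType} {d : nat}.
Context {disp1 : measure_display} {T1 : measurableType disp1}.
Context {disp2 : measure_display} {T2 : measurableType disp2}.
Variables (P1 : probability T1 R) (P2 : probability T2 R).
Variables (X1 : T1 -> symM R d) (X2 : T2 -> symM R d).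
Hypothesis mX1 : measurable_fun setT X1.
Hypothesis mX2 : measurable_fun setT X2.
Hypothesis char12 : forall (U : symM R d) th,
  \int[P1]_w cos (frob U (X1 w) + th) = \int[P2]_w cos (frob U (X2 w) + th).

Let M1 : {mfun T1 >-> symM R d} := mfun_Sub (mem_set mX1).
Let M2 : {mfun T2 >-> symM R d} := mfun_Sub (mem_set mX2).

Lemma ge0_integral_equal_law (f : symM R d -> \bar R) : measurable_fun setT f ->
  (forall S, 0 <= f S)%E -> (\int[P1]_w f (X1 w) = \int[P2]_w f (X2 w))%E.
Proof.
move=> mf f0.
have E1 := @ge0_integral_distribution _ _ _ _ _ P1 M1 f mf f0.
have E2 := @ge0_integral_distribution _ _ _ _ _ P2 M2 f mf f0.
rewrite -[LHS]E1 -[RHS]E2; apply: eq_measure_integral => A mA _.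
apply: (@sym_char_unique R d (distribution P1 M1) (distribution P2 M2)) => // U th.
have bc := @bounded_mfun_cos_frob R d U th.
have mc : measurable_fun setT (fun S : symM R d => (cos (frob U S + th))%:E).
  by apply/measurable_EFinP; exact: bc.1.
rewrite /Rintegral.
rewrite (@integral_distribution _ _ _ _ _ P1 M1 _ mc); last first.
  by apply: (bounded_mfun_integrable P1 (bounded_mfun_comp bc mX1)).
rewrite (@integral_distribution _ _ _ _ _ P2 M2 _ mc); last first.
  by apply: (bounded_mfun_integrable P2 (bounded_mfun_comp bc mX2)).
exact: char12.
Qed.

(** Positive and negative parts have equal integrals, possibly infinite, so the identity is
    available before integrability is known. *)
Lemma integral_equal_law (f : symM R d -> R) : measurable_fun setT f ->
  \int[P1]_w f (X1 w) = \int[P2]_w f (X2 w).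
Proof.
move=> mf; have mf' : measurable_fun setT (EFin \o f) by exact/measurable_EFinP.
rewrite /Rintegral integralE [in RHS]integralE.
have p1 := ge0_integral_equal_law (measurable_funepos mf') (fun S => funepos_ge0 _ S).
have p2 := ge0_integral_equal_law (measurable_funeneg mf') (fun S => funeneg_ge0 _ S).
have fp (T : Type) (X : T -> symM R d) :
    (fun x => (f (X x))%:E)^\+%E = (fun x => (EFin \o f)^\+%E (X x)).
  exact: (funepos_comp (EFin \o f) X).
have fn (T : Type) (X : T -> symM R d) :
    (fun x => (f (X x))%:E)^\-%E = (fun x => (EFin \o f)^\-%E (X x)).
  exact: (funeneg_comp (EFin \o f) X).
by rewrite !fp !fn p1 p2.
Qed.

Lemma integrable_equal_law (f : symM R d -> R) : measurable_fun setT f ->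
  P2.-integrable setT (fun w => (f (X2 w))%:E) ->
  P1.-integrable setT (fun w => (f (X1 w))%:E).
Proof.
move=> mf /integrableP[_ i2]; apply/integrableP; split.
  by apply/measurable_EFinP; exact: measurableT_comp mf mX1.
apply: le_lt_trans i2.
have := @ge0_integral_equal_law (fun S => `|(f S)%:E|%E).
rewrite /= => -> //.
by apply/measurable_EFinP; exact: measurableT_comp.
Qed.

End equal_law.

Section integrable_product.
Context {disp1 : measure_display} {T1 : measurableType disp1}.
Context {disp2 : measure_display} {T2 : measurableType disp2} {R : realType}.
Variables (m1 : {sigma_finite_measure set T1 -> \bar R})
          (m2 : {sigma_finite_measure set T2 -> \bar R}).

Lemma integrable_prodM (a : T1 -> R) (c : T2 -> R) :
  m1.-integrable setT (EFin \o a) -> m2.-integrable setT (EFin \o c) ->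
  (m1 \x m2)%E.-integrable setT (fun z => (a z.1 * c z.2)%:E).
Proof.
move=> ia ic.
have /measurable_EFinP ma := measurable_int _ ia.
have /measurable_EFinP mc := measurable_int _ ic.
apply/integrable12ltyP.
  apply/measurable_EFinP; apply: measurable_funM.
    exact: measurableT_comp ma measurable_fst.
  exact: measurableT_comp mc measurable_snd.
have E x : (\int[m2]_y `|(a x * c y)%:E| = `|a x|%:E * \int[m2]_y `|(c y)%:E|)%E.
  rewrite -ge0_integralZl//; last first.
    by apply/measurableT_comp => //; exact/measurable_EFinP.
  by apply: eq_integral => y _; rewrite /= normrM EFinM.
under eq_integral do rewrite /= E.
rewrite ge0_integralZr//.
- apply: lte_mul_pinfty => //.
  + exact: integral_ge0.
  + have /integrableP[_] := ia; rewrite ge0_fin_numE//; exact: integral_ge0.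
  + by have /integrableP[_] := ic.
- by apply/measurable_EFinP; exact: measurableT_comp.
- exact: integral_ge0.
Qed.

End integrable_product.

(** * Mehler's formula *)

Section ou_std.
Context {R : realType}.
Implicit Types t s : R.

(** The factor of the noise in Mehler's formula. For [t < 0] the radicand is negative and [Num.sqrt]
    returns 0, so that [ou_std_le1] holds for all [t]. *)
Definition ou_std t : R := Num.sqrt (1 - expR (- (2 * t))).

Lemma ou_std_ge0 t : 0 <= ou_std t. Proof. exact: sqrtr_ge0. Qed.

Lemma ou_std_sqr t : 0 <= t -> ou_std t ^+ 2 = 1 - expR (- (2 * t)).
Proof.
move=> t0; rewrite sqr_sqrtr// subr_ge0 -[leRHS]expR0 ler_expR oppr_le0.
by rewrite mulr_ge0.
Qed.

Lemma expRN2 t : expR (- (2 * t)) = expR (- t) ^+ 2.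
Proof. by rewrite -mulrN expRM_natl. Qed.

Lemma ou_std_le1 t : ou_std t <= 1.
Proof.
rewrite -[leRHS]sqrtr1 ler_wsqrtr// lerBlDr lerDl; exact: expR_ge0.
Qed.

(** With e = exp(- t), squaring reduces the claim to (1 - e)^2 <= 1 - e^2. Hence [mehler t S]
    approaches [Y] at rate exp(- t) for each outcome. *)
Lemma onem_ou_std_le t : 0 <= t -> 1 - ou_std t <= expR (- t).
Proof.
move=> t0; rewrite lerBlDr -lerBlDl.
have e0 : 0 <= expR (- t) by exact: expR_ge0.
have e1 : expR (- t) <= 1 by rewrite -[leRHS]expR0 ler_expR oppr_le0.
rewrite -(ler_pXn2r (ltn0Sn 1)) ?nnegrE ?subr_ge0 ?ou_std_ge0//.
rewrite ou_std_sqr// expRN2 -subr_ge0.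
have -> : 1 - expR (- t) ^+ 2 - (1 - expR (- t)) ^+ 2 =
  2 * expR (- t) * (1 - expR (- t)) by ring.
by rewrite !mulr_ge0// subr_ge0.
Qed.

(** Addition of variances when two time steps with independent noises are composed. *)
Lemma ou_stdD t s : 0 <= t -> 0 <= s ->
  expR (- t) ^+ 2 * ou_std s ^+ 2 + ou_std t ^+ 2 = ou_std (t + s) ^+ 2.
Proof.
move=> t0 s0; rewrite !ou_std_sqr ?addr_ge0// !expRN2 opprD expRD; ring.
Qed.

Lemma ou_std0 : ou_std 0 = 0.
Proof. by rewrite /ou_std mulr0 oppr0 expR0 subrr sqrtr0. Qed.

Lemma continuous_ou_std : continuous ou_std.
Proof.
move=> t; apply: (cvg_comp (fun t => 1 - expR (- (2 * t))) Num.sqrt).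
  apply: cvgB; first exact: cvg_cst.
  apply: continuous_cvg; first exact: continuous_expR.
  by apply: cvgN; apply: cvgM; [exact: cvg_cst|exact: cvg_id].
exact: sqrt_continuous.
Qed.

End ou_std.

Section mehler.
Context {R : realType} {d : nat}.
Context {disp : measure_display} {T : measurableType disp}.
Variables (P : probability T R) (Y : T -> symM R d) (M : symM R d).
Variable v : symM R d -> R.
Hypothesis mY : measurable_fun setT Y.
Hypothesis vZ : forall c U, v (c *: U) = c ^+ 2 * v U.
Hypothesis charY : forall (U : symM R d) th,
  \int[P]_w cos (frob U (Y w) + th) = expR (- (v U / 2)) * cos (frob U M + th).
Hypothesis momY : forall k : nat, P.-integrable setT (fun w => (`|Y w - M| ^+ k)%:E).

(** A coupling through the noise [Y w], common to all times and starts. It reproduces the law of the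
    process at each single time, not the joint law over times. *)
Definition mehler (t : R) (S : symM R d) (w : T) : symM R d :=
  M + expR (- t) *: (S - M) + ou_std t *: (Y w - M).

Lemma measurable_mehler {disp0 : measure_display} {T0 : measurableType disp0}
    (f : T0 -> R) (g : T0 -> symM R d) (k : T0 -> T) :
  measurable_fun setT f -> measurable_fun setT g -> measurable_fun setT k ->
  measurable_fun setT (fun x => mehler (f x) (g x) (k x)).
Proof.
move=> mf mg mk; apply: measurable_sym_coord => i j.
have -> : (fun x => mehler (f x) (g x) (k x) i j) =
    (fun x => M i j + expR (- f x) * (g x i j - M i j) +
      ou_std (f x) * (Y (k x) i j - M i j)).
  by apply/funext => x; rewrite /mehler !symD_val !symZ_val !symB_val !mxE.
have me := @measurable_entry R d i j.
apply: measurable_funD.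
  apply: measurable_funD => //; apply: measurable_funM.
    by apply: measurableT_comp; [exact: measurable_expR|exact: measurableT_comp].
  by apply: measurable_funB => //; exact: measurableT_comp me mg.
apply: measurable_funM.
  apply: measurableT_comp mf; apply: continuous_measurable_fun.
  exact: continuous_ou_std.
apply: measurable_funB => //; apply: measurableT_comp me _.
exact: measurableT_comp mY mk.
Qed.

Lemma measurable_mehler_w t S : measurable_fun setT (mehler t S).
Proof.
by apply: (@measurable_mehler _ _ (fun=> t) (fun=> S) id).
Qed.

Lemma frob_mehler (U : symM R d) t S w : frob U (mehler t S w) =
  frob (ou_std t *: U) (Y w) +
  (frob U M + expR (- t) * frob U (S - M) - ou_std t * frob U M).
Proof.
rewrite /mehler !symD_val [LHS]frobDr [in LHS]frobDr !symZ_val !frobZr frobZl.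
by rewrite -(symD_val S) (symB_val (Y w)) frobBr; ring.
Qed.

Lemma mehler_cos (U : symM R d) t S th : 0 <= t ->
  \int[P]_w cos (frob U (mehler t S w) + th) =
  expR (- (ou_std t ^+ 2 * v U / 2)) *
  cos (frob U M + expR (- t) * frob U (S - M) + th).
Proof.
move=> t0; under eq_Rintegral do rewrite frob_mehler -addrA.
rewrite charY vZ; congr (_ * cos _).
by rewrite symZ_val frobZl; ring.
Qed.

Lemma mehler0 S w : mehler 0 S w = S.
Proof. by rewrite /mehler ou_std0 scale0r addr0 oppr0 expR0 scale1r addrC subrK. Qed.

Lemma mehler_dist_mean t S w : 0 <= t ->
  `|mehler t S w - M| <= `|S - M| + `|Y w - M|.
Proof.
move=> t0.
have -> : mehler t S w - M = expR (- t) *: (S - M) + ou_std t *: (Y w - M).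
  apply/val_inj/matrixP => i j.
  rewrite /= /mehler !(symB_val, symD_val, symZ_val, mxE); ring.
rewrite (le_trans (ler_normD _ _))// lerD//.
  rewrite normrZ ger0_norm ?expR_ge0//.
  by rewrite ler_piMl// -[leRHS]expR0 ler_expR oppr_le0.
by rewrite normrZ ger0_norm ?ou_std_ge0// ler_piMl// ou_std_le1.
Qed.

Lemma norm_mehler_le t S w : 0 <= t ->
  `|mehler t S w| <= `|M| + `|S - M| + `|Y w - M|.
Proof.
move=> t0; rewrite -addrA -lerBlDl (le_trans (lerB_dist _ _))//.
exact: mehler_dist_mean.
Qed.

Lemma mehler_dist_start t S w : 0 <= t ->
  `|mehler t S w - S| <= (1 - expR (- t) + ou_std t) * (`|S - M| + `|Y w - M|).
Proof.
move=> t0.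
have -> : mehler t S w - S = ou_std t *: (Y w - M) - (1 - expR (- t)) *: (S - M).
  apply/val_inj/matrixP => i j.
  rewrite /= /mehler !(symB_val, symD_val, symZ_val, mxE); ring.
have e1 : 0 <= 1 - expR (- t) by rewrite subr_ge0 -[leRHS]expR0 ler_expR oppr_le0.
rewrite (le_trans (ler_normB _ _))// !normrZ (ger0_norm (ou_std_ge0 t)) (ger0_norm e1).
move: (1 - expR (- t)) (ou_std t) e1 (ou_std_ge0 t) => x y x0 y0.
have : 0 <= x * `|Y w - M| by rewrite mulr_ge0.
have : 0 <= y * `|S - M| by rewrite mulr_ge0.
move: `|Y w - M| `|S - M| => u s ys xu.
rewrite -subr_ge0 (_ : _ - _ = x * u + y * s); last by ring.
by rewrite addr_ge0.
Qed.

Lemma mehler_contraction t S S' w :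
  `|mehler t S w - mehler t S' w| = expR (- t) * `|S - S'|.
Proof.
rewrite /mehler opprD addrACA subrr addr0 opprD addrACA subrr add0r.
by rewrite -scalerBr opprB addrA subrK normrZ ger0_norm// expR_ge0.
Qed.

Lemma mehler_dist_stationary t S w : 0 <= t ->
  `|mehler t S w - Y w| <= expR (- t) * (`|S - M| + `|Y w - M|).
Proof.
move=> t0.
have -> : mehler t S w - Y w = expR (- t) *: (S - M) - (1 - ou_std t) *: (Y w - M).
  apply/val_inj/matrixP => i j.
  rewrite /= /mehler !(symB_val, symD_val, symZ_val, mxE); ring.
rewrite (le_trans (ler_normB _ _))// !normrZ mulrDr lerD//.
  by rewrite ger0_norm// expR_ge0.
rewrite ger0_norm ?subr_ge0 ?ou_std_le1//.
by rewrite ler_wpM2r// onem_ou_std_le.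
Qed.

(** Together with [noise_size], it separates start from noise: by [le_start_noise] their product
    dominates 1 plus the norms that occur, so bounds take the product form convenient for Fubini's
    theorem. *)
Definition start_size (S : symM R d) : R := 1 + 2 * `|M| + `|S - M|.
Definition noise_size (w : T) : R := 1 + 2 * `|Y w - M|.
Local Notation q := start_size.
Local Notation z := noise_size.

Lemma start_size_ge1 S : 1 <= q S.
Proof. by rewrite /q -addrA lerDl addr_ge0// mulr_ge0. Qed.

Lemma start_size_ge0 S : 0 <= q S.
Proof. exact: le_trans (start_size_ge1 S). Qed.

Lemma noise_size_ge1 w : 1 <= z w. Proof. by rewrite lerDl mulr_ge0. Qed.

Lemma noise_size_ge0 w : 0 <= z w.
Proof. exact: le_trans (noise_size_ge1 w). Qed.

Lemma measurable_noise_size : measurable_fun setT z.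
Proof.
apply: measurable_funD => //; apply: measurable_funM => //.
exact: measurableT_comp (measurable_dist M) mY.
Qed.

(** The factor [3 ^+ N] comes from 1 + 2 y <= 3 max(1, y). *)
Lemma integrable_noise_sizeX N : P.-integrable setT (fun w => (z w ^+ N)%:E).
Proof.
apply: (@le_integrable _ _ _ P setT _ _
  (fun w => (3 ^+ N)%:E + (3 ^+ N)%:E * (`|Y w - M| ^+ N)%:E)%E) => //.
- by apply/measurable_EFinP; apply: measurable_funX measurable_noise_size.
- move=> w _; rewrite /= lee_fin ger0_norm ?exprn_ge0 ?noise_size_ge0//.
  rewrite ger0_norm; last by rewrite addr_ge0 ?mulr_ge0 ?exprn_ge0.
  rewrite /z; have [h|h] := leP `|Y w - M| 1.
    rewrite (@le_trans _ _ (3 ^+ N))//; last by rewrite lerDl mulr_ge0// exprn_ge0.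
    by rewrite lerXn2r ?nnegrE ?(noise_size_ge0 w)//; lra.
  rewrite (@le_trans _ _ (3 ^+ N * `|Y w - M| ^+ N))//; last by rewrite lerDr exprn_ge0.
  by rewrite -exprMn lerXn2r ?nnegrE ?(noise_size_ge0 w)// ?mulr_ge0//; lra.
- apply: integrableD => //; first exact: finite_measure_integrable_cst.
  exact: integrableZl.
Qed.

Lemma le_start_noise S w (x : R) : x <= `|S - M| + 2 * `|M| + 2 * `|Y w - M| ->
  1 + x <= q S * z w.
Proof.
rewrite /start_size /noise_size.
have : 0 <= `|S - M| by []; have : 0 <= `|M| by []; have : 0 <= `|Y w - M| by [].
move: `|S - M| `|M| `|Y w - M| => s m y y0 m0 s0 xle; rewrite -subr_ge0.
have -> : (1 + 2 * m + s) * (1 + 2 * y) - (1 + x) =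
  (2 * m + s) * (2 * y) + (s + 2 * m + 2 * y - x) by ring.
by rewrite addr_ge0 ?subr_ge0// !mulr_ge0// addr_ge0// mulr_ge0.
Qed.

Section growth_function.
Variables (b : R) (N : nat) (C : R) (h : symM R d -> R).
Hypothesis b01 : 0 < b <= 1.
Hypothesis C0 : 0 <= C.
Hypothesis gh : growth b N C h.

Let mh : measurable_fun setT h. Proof. exact: growth_measurable gh. Qed.
Let b0 : 0 < b. Proof. by case/andP: b01. Qed.

(** Both arguments of [h] use the same [w] and lie within exp(- t) x of each other, where x = q(S)
    z(w) >= 1. The weight contributes x^N and the distance x^b <= x, whence the exponent N + 1. *)
Lemma mehler_decay t S w : 0 <= t ->
  `|h (mehler t S w) - h (Y w)| <=
  C * (q S ^+ N.+1 * z w ^+ N.+1) * expR (- b * t).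
Proof.
move=> t0; rewrite (le_trans (gh _ _))// -!mulrA ler_wpM2l//.
have nY : `|Y w| <= `|M| + `|Y w - M| by rewrite -lerBlDl lerB_dist.
have nm := norm_mehler_le S w t0.
have eb : expR (- b * t) = expR (- t) `^ b by rewrite -expRM mulrC mulNr mulrN.
set x := q S * z w.
have x1 : 1 <= x := mulr_ege1 (start_size_ge1 S) (noise_size_ge1 w).
have x0 : 0 <= x := le_trans ler01 x1.
have e0 : 0 <= expR (- t) by exact: expR_ge0.
have -> : q S ^+ N.+1 * (z w ^+ N.+1 * expR (- b * t)) =
    x ^+ N * (x * expR (- t) `^ b).
  by rewrite eb /x !exprMn !exprS; ring.
rewrite ler_pM ?exprn_ge0 ?powR_ge0 ?addr_ge0//.
  rewrite lerXn2r ?nnegrE ?addr_ge0// -addrA le_start_noise//.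
  rewrite (le_trans (lerD nm nY))// -subr_ge0.
  have -> : forall m s y : R, s + 2 * m + 2 * y - (m + s + y + (m + y)) = 0 by move=> *; ring.
  by [].
rewrite (@le_trans _ _ ((expR (- t) * x) `^ b))//.
  apply: ge0_ler_powR; [exact: ltW|exact: normr_ge0|exact: mulr_ge0|].
  rewrite (le_trans (mehler_dist_stationary _ _ t0))// ler_wpM2l//.
  rewrite (le_trans _ (le_start_noise (lexx _)))// -subr_ge0.
  have -> : forall m s y : R, 1 + (s + 2 * m + 2 * y) - (s + y) = 1 + 2 * m + y by move=> *; ring.
  by rewrite !addr_ge0// mulr_ge0.
rewrite powRM// mulrC ler_wpM2r ?powR_ge0//.
by rewrite -[leRHS]powRr1// ler_powR//; case/andP: b01.
Qed.

Lemma integrable_mehler t S : 0 <= t ->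
  P.-integrable setT (fun w => (h (mehler t S w))%:E).
Proof.
move=> t0; have [K K0 hK] := growth_abs b01 C0 gh.
apply: (@le_integrable _ _ _ P setT _ _
    (fun w => ((K * q S ^+ N.+1)%:E * (z w ^+ N.+1)%:E)%E)) => //.
- apply/measurable_EFinP; apply: measurableT_comp mh _.
  exact: measurable_mehler_w.
- move=> w _; rewrite /= lee_fin (le_trans (hK _))// [leRHS]ger0_norm; last first.
    by rewrite !mulr_ge0// exprn_ge0// ?start_size_ge0 ?noise_size_ge0.
  rewrite -mulrA ler_wpM2l// -exprMn lerXn2r ?nnegrE ?addr_ge0//.
    by rewrite mulr_ge0 ?start_size_ge0 ?noise_size_ge0.
  rewrite le_start_noise// (le_trans (norm_mehler_le _ _ t0))// -subr_ge0.
  have -> : forall m s y : R, s + 2 * m + 2 * y - (m + s + y) = m + y by move=> *; ring.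
  by rewrite addr_ge0.
- exact: (@integrableZl _ _ _ P setT measurableT _ _ (integrable_noise_sizeX N.+1)).
Qed.

Lemma integrable_stationary : P.-integrable setT (fun w => (h (Y w))%:E).
Proof.
have [K K0 hK] := growth_abs b01 C0 gh.
apply: (@le_integrable _ _ _ P setT _ _
    (fun w => ((K * q M ^+ N.+1)%:E * (z w ^+ N.+1)%:E)%E)) => //.
- by apply/measurable_EFinP; apply: measurableT_comp mh mY.
- move=> w _; rewrite /= lee_fin (le_trans (hK _))// [leRHS]ger0_norm; last first.
    by rewrite !mulr_ge0// exprn_ge0// ?start_size_ge0 ?noise_size_ge0.
  rewrite -mulrA ler_wpM2l// -exprMn lerXn2r ?nnegrE ?addr_ge0//.
    by rewrite mulr_ge0 ?start_size_ge0 ?noise_size_ge0.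
  have nY : `|Y w| <= `|M| + `|Y w - M| by rewrite -lerBlDl lerB_dist.
  rewrite le_start_noise// (le_trans nY)// subrr normr0 add0r.
  by rewrite lerD// ler_peMl// ler1n.
- exact: (@integrableZl _ _ _ P setT measurableT _ _ (integrable_noise_sizeX N.+1)).
Qed.

(** P_t h(S) - E h(Y_oo) as one expectation, so that bounds for each outcome apply to it. *)
Definition mehler_diff t S : R := \int[P]_w (h (mehler t S w) - h (Y w)).

Lemma mehler_diffE t S : 0 <= t ->
  mehler_diff t S = \int[P]_w h (mehler t S w) - \int[P]_w h (Y w).
Proof.
move=> t0; apply: RintegralB => //; first exact: integrable_mehler.
exact: integrable_stationary.
Qed.

End growth_function.
End mehler.

(** * Integrals over the half-line *)

Section Fubini.
Context {disp1 : measure_display} {T1 : measurableType disp1}.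
Context {disp2 : measure_display} {T2 : measurableType disp2} {R : realType}.
Variables (m1 : {sigma_finite_measure set T1 -> \bar R})
          (m2 : {sigma_finite_measure set T2 -> \bar R}) (f : T1 * T2 -> R).
Hypothesis i12 : (m1 \x m2)%E.-integrable setT (EFin \o f).
Hypothesis i2 : forall x, m2.-integrable setT (fun y => (f (x, y))%:E).

Lemma fubini_FE x : fubini_F m2 (EFin \o f) x = (\int[m2]_y f (x, y))%:E.
Proof. by rewrite /Rintegral fineK//; exact: integrable_fin_num. Qed.

Lemma integrable_Rintegral :
  m1.-integrable setT (fun x => (\int[m2]_y f (x, y))%:E).
Proof. by rewrite -(funext fubini_FE); exact: integrable_fubini_F. Qed.

Lemma Rintegral_prod :
  \int[m1]_x \int[m2]_y f (x, y) = \int[(m1 \x m2)%E]_z f z.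
Proof.
rewrite /Rintegral -integral12_prod_meas1//; congr fine.
by apply: eq_integral => x _; rewrite fubini_FE.
Qed.

Lemma Rintegral_Fubini :
  (forall y, m1.-integrable setT (fun x => (f (x, y))%:E)) ->
  \int[m1]_x \int[m2]_y f (x, y) = \int[m2]_y \int[m1]_x f (x, y).
Proof.
move=> i1; rewrite Rintegral_prod /Rintegral -integral21_prod_meas1//.
congr fine; apply: eq_integral => y _; rewrite fineK//.
exact: integrable_fin_num.
Qed.

End Fubini.

Section half_line.
Context {R : realType}.
Notation mu := (@lebesgue_measure R).
Implicit Types f : R -> R.

Lemma Rintegral_indic (D : set R) f :
  \int[mu]_(t in D) f t = \int[mu]_t (\1_D t * f t).
Proof.
rewrite Rintegral_mkcond; apply: eq_Rintegral => t _.
by rewrite patchE indicE; case: ifP => _; rewrite ?mul1r ?mul0r.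
Qed.

Lemma integrable_indic (D : set R) f : measurable D ->
  mu.-integrable D (EFin \o f) <->
  mu.-integrable setT (fun t => (\1_D t * f t)%:E).
Proof.
move=> mD; have <- : (EFin \o f) \_ D = fun t => (\1_D t * f t)%:E.
  by apply/funext => t; rewrite patchE indicE; case: ifP => _;
     rewrite /= ?mul1r ?mul0r.
exact: integrable_mkcond.
Qed.

Lemma integrable_expR_half_line (b : R) : 0 < b ->
  mu.-integrable `[0, +oo[ (fun t => (expR (- b * t))%:E).
Proof.
move=> b0; apply/(integrable_indic (fun t => expR (- b * t))) => //.
have := integrableZl measurableT b^-1 (integrable_exponential_pdf b0).
congr (_.-integrable _ _); apply/funext => t /=.
rewrite /exponential_pdf patchE indicE; case: ifP => _.
  by rewrite -EFinM mulKf ?gt_eqF// mul1r.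
by rewrite mule0 mul0r.
Qed.

Lemma Rintegral_expR_half_line (b : R) : 0 < b ->
  \int[mu]_(t in `[0, +oo[) expR (- b * t) = b^-1.
Proof.
move=> b0; have : \int[mu]_t exponential_pdf b t = 1.
  by rewrite /Rintegral integral_exponential_pdf.
rewrite /exponential_pdf -Rintegral_mkcond RintegralZl//; last first.
  exact: integrable_expR_half_line.
by move=> /(canRL (mulKf (lt0r_neq0 b0))) ->; rewrite mulr1.
Qed.

Let shift (s : R) (t : measurableTypeR R) : measurableTypeR R := t + s.

Let measurable_shift s : measurable_fun setT (shift s).
Proof. exact: measurable_funD. Qed.

(** The image measure agrees with [mu] on the intervals ]a, b], which determine it. *)
Lemma lebesgue_measureD (s : R) (A : set R) : measurable A ->
  pushforward mu (shift s) A = mu A.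
Proof.
move=> mA; pose mixin := isMeasurableFun.Build _ _ _ _ _ (measurable_shift s).
pose ms : {mfun _ >-> _} := HB.pack (shift s) mixin.
apply/esym/(@lebesgue_measure_unique _ (pushforward mu ms)) => //=.
move=> _ [[a b]] _ <-; rewrite /pushforward.
have -> : shift s @^-1` `]a, b] = `]a - s, b - s]%classic.
  by apply/seteqP; split=> t /=; rewrite !in_itv/= ltrBlDr lerBrDr.
rewrite !lebesgue_measure_itv/= !lte_fin ltrD2r -EFinB.
by case: ifP => // _; congr _%:E; ring.
Qed.

Lemma Rintegral_shift f (s : R) : 0 <= s ->
  mu.-integrable `[0, +oo[ (EFin \o f) ->
  mu.-integrable `[0, +oo[ (fun t => (f (t + s))%:E) ->
  \int[mu]_(t in `[0, +oo[) f (t + s) =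
  \int[mu]_(t in `[0, +oo[) f t - \int[mu]_(t in `[0, s[) f t.
Proof.
move=> s0 i0 ish.
have E : `[0, +oo[%classic = `[0, s[ `|` `[s, +oo[ :> set R.
  by rewrite -itv_bndbnd_setU// bnd_simp.
rewrite [in RHS]E Rintegral_setU//; last 2 first.
- by rewrite -E.
- apply/disj_setPS => t [] /=; rewrite !in_itv/= andbT => /andP[_ ts].
  by rewrite leNgt ts.
rewrite addrC addKr.
have pre : shift s @^-1` `[s, +oo[ = `[0, +oo[%classic.
  by apply/seteqP; split=> t /=; rewrite !in_itv/= !andbT lerDr.
(* [f] is measurable on [0, +oo[ only; cut off, it is measurable on the line, as the change of
   variables asks. *)
pose g (t : R) := \1_`[0, +oo[ t * f t.
have mg : measurable_fun setT (EFin \o g).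
  exact: (measurable_int mu ((integrable_indic f (measurable_itv _)).1 i0)).
have gE t : 0 <= t -> g t = f t.
  by move=> t0; rewrite /g indicE mem_set ?mul1r//= in_itv/= andbT.
transitivity (\int[mu]_(t in shift s @^-1` `[s, +oo[) g (t + s)).
  rewrite pre; apply: eq_Rintegral => t; rewrite inE/= in_itv/= andbT => t0.
  by rewrite gE// addr_ge0.
transitivity (\int[mu]_(t in `[s, +oo[) g t); last first.
  apply: eq_Rintegral => t; rewrite inE/= in_itv/= andbT => st.
  by rewrite gE// (le_trans s0).
rewrite /Rintegral; congr fine.
rewrite -(@integral_pushforward _ _ _ _ _ _ (measurable_shift s) mu _ (EFin \o g))//.
  by apply: eq_measure_integral => A mA _; exact: lebesgue_measureD.
rewrite pre; apply: eq_integrable ish => // t.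
by rewrite inE/= in_itv/= andbT => t0; rewrite gE// addr_ge0.
Qed.

Lemma cvg_average_at_right f : mu.-integrable `[0, +oo[ (EFin \o f) ->
  f t @[t --> 0^'+] --> f 0 ->
  (\int[mu]_(t in `[0, s[) f t) / s @[s --> 0^'+] --> f 0.
Proof.
move=> i0 f0; apply/cvgrPdist_le => e e0.
move/cvgrPdist_le : f0 => /(_ _ e0)[r /= r0 fr].
near=> s.
have s0 : 0 < s by near: s; exact: nbhs_right_gt.
have sr : s < r by near: s; exact: nbhs_right_lt.
have ls : mu `[0, s[ = s%:E by rewrite lebesgue_measure_itv/= lte_fin s0 oppr0 adde0.
have i1 : mu.-integrable `[0, s[ (EFin \o f).
  by apply: integrableS i0 => //; exact: subset_itvl.
have ic (c : R) : mu.-integrable `[0, s[ (EFin \o cst c).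
  apply/integrableP; split; first by apply/measurable_EFinP; exact: measurable_cst.
  have := @integral_cst _ _ _ mu `[0, s[ (measurable_itv _) `|c%:E|%E.
  by rewrite /= => ->; rewrite ls ltry.
have Ic (c : R) : \int[mu]_(t in `[0, s[) c = c * s.
  by rewrite Rintegral_cst//; congr (_ * _); exact: (congr1 fine ls).
set I := \int[mu]_(t in _) _.
have {}Is : `|f 0 * s - I| <= e * s.
  rewrite -(Ic (f 0)) -RintegralB//; last exact: ic.
  have iB : mu.-integrable `[0, s[ (EFin \o (fun t => f 0 - f t)).
    have := @integrableB _ _ _ mu `[0, s[ (measurable_itv _) _ _ (ic (f 0)) i1.
    by [].
  rewrite (le_trans (le_normr_Rintegral _ iB))//.
  rewrite -(Ic e); apply: le_Rintegral => //; [exact: (integrable_norm iB)|exact: ic|].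
  move=> t; rewrite /= in_itv/= => /andP[t0 ts].
  (* The limit from the right says nothing of [t = 0] itself, where the difference is 0. *)
  have [->|tn0] := eqVneq t 0; first by rewrite subrr normr0 ltW.
  apply: fr => /=; last by rewrite lt_def tn0.
  by rewrite sub0r normrN ger0_norm// (lt_trans ts).
suff -> : `|f 0 - I / s| = `|f 0 * s - I| / s by rewrite ler_pdivrMr.
rewrite (_ : f 0 - I / s = (f 0 * s - I) / s); last by rewrite mulrBl mulfK ?gt_eqF.
by rewrite normrM normfV (gtr0_norm s0).
Unshelve. all: by end_near. Qed.

End half_line.

(** * The Stein equation for Mehler's semigroup *)

Section product_sigma_finite.
Context {disp1 : measure_display} {T1 : measurableType disp1}.
Context {disp2 : measure_display} {T2 : measurableType disp2} {R : realType}.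
Variables (P1 : probability T1 R) (m2 : {sigma_finite_measure set T2 -> \bar R}).

(** The product has to be sigma-finite itself to be a factor of the threefold product of start, time
    and noise. *)
Fact product_sigma_finite : sigma_finite setT (P1 \x m2)%E.
Proof.
have [F FT mF] := sigma_finiteT m2.
exists (fun k => [set: T1] `*` F k).
  by rewrite -setX_bigcupr -FT setXTT.
move=> k; have [mFk Fk] := mF k; split; first exact: measurableX.
rewrite product_measure1E//; rewrite [X in (X * _)%E]probability_setT mul1e.
exact: Fk.
Qed.

Definition sigma_finite_product : {sigma_finite_measure set (T1 * T2)%type -> \bar R} :=
  HB.pack (P1 \x m2)%E (Measure_isSigmaFinite.Build _ _ _ (P1 \x m2)%E product_sigma_finite).

End product_sigma_finite.

Section dirac.
Context {disp : measure_display} {T : measurableType disp} {R : realType}.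

Lemma integrable_dirac (a : T) (f : T -> R) : measurable_fun setT f ->
  (\d_a : {measure set T -> \bar R}).-integrable setT (EFin \o f).
Proof.
move=> mf; have mf' : measurable_fun setT (EFin \o f) by exact/measurable_EFinP.
apply/integrableP; split => //.
rewrite integral_dirac//; last exact: measurableT_comp.
by rewrite diracT mul1e ltry.
Qed.

Lemma Rintegral_dirac (a : T) (f : T -> R) : measurable_fun setT f ->
  \int[(\d_a : {measure set T -> \bar R})]_x f x = f a.
Proof.
move=> mf; rewrite /Rintegral integral_dirac//; last exact/measurable_EFinP.
by rewrite diracT mul1e.
Qed.

End dirac.

Section mehler_stein.
Context {R : realType} {d : nat}.
Context {disp : measure_display} {T : measurableType disp}.
Variables (P : probability T R) (Y : T -> symM R d) (M : symM R d).
Variable v : symM R d -> R.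
Hypothesis mY : measurable_fun setT Y.
Hypothesis vZ : forall c U, v (c *: U) = c ^+ 2 * v U.
Hypothesis charY : forall (U : symM R d) th,
  \int[P]_w cos (frob U (Y w) + th) = expR (- (v U / 2)) * cos (frob U M + th).
Hypothesis momY : forall k : nat, P.-integrable setT (fun w => (`|Y w - M| ^+ k)%:E).

Local Notation mu := (@lebesgue_measure R).
Local Notation q := (start_size M).
Local Notation z := (noise_size Y M).
Local Notation mehler := (mehler Y M).

Section composition.
Context {disp0 : measure_display} {T0 : measurableType disp0}.
Context {disp2 : measure_display} {T2 : measurableType disp2}.
Variables (P0 : probability T0 R) (S0 : T0 -> symM R d).
Variables (P2 : probability T2 R) (X2 : T2 -> symM R d).
Hypothesis mS0 : measurable_fun setT S0.
Hypothesis mX2 : measurable_fun setT X2.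
Variable t : R.
Hypothesis t0 : 0 <= t.
Hypothesis char02 : forall (U : symM R d) th,
  expR (- (ou_std t ^+ 2 * v U / 2)) * \int[P0]_x
    cos (frob (expR (- t) *: U) (S0 x) + (frob U M - expR (- t) * frob U M + th)) =
  \int[P2]_w cos (frob U (X2 w) + th).

Let mX1 : measurable_fun setT (fun x : T0 * T => mehler t (S0 x.1) x.2).
Proof.
by apply: measurable_mehler => //; exact: measurableT_comp mS0 measurable_fst.
Qed.

Let char12 (U : symM R d) th :
  \int[(P0 \x P)%E]_x cos (frob U (mehler t (S0 x.1) x.2) + th) =
  \int[P2]_w cos (frob U (X2 w) + th).
Proof.
have bc : bounded_mfun (fun x : T0 * T => cos (frob U (mehler t (S0 x.1) x.2) + th)).
  exact: bounded_mfun_comp (bounded_mfun_cos_frob U th) mX1.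
rewrite -(@Rintegral_prod _ _ _ _ _ P0 P
  (fun x => cos (frob U (mehler t (S0 x.1) x.2) + th))) /=; last 2 first.
- exact: bounded_mfun_integrable.
- move=> x; apply: bounded_mfun_integrable.
  exact: (bounded_mfun_comp bc (pair1_measurable x)).
under eq_Rintegral do rewrite (mehler_cos vZ charY)//.
rewrite -char02 -RintegralZl//.
  apply: eq_Rintegral => x _; congr (_ * cos _).
  by rewrite symZ_val frobZl symB_val frobBr; ring.
apply: bounded_mfun_integrable.
exact: bounded_mfun_comp (bounded_mfun_cos_frob _ _) mS0.
Qed.

(** Under the product measure the noise is independent of the start [S0], and [char02] says that the
    composed variable has the characteristic function of [X2]. It is used with a Mehler variable and
    with the stationary variable as [X2]. *)
Lemma mehler_compose (b : R) (N : nat) (C : R) (f : symM R d -> R) :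
  0 < b <= 1 -> 0 <= C -> growth b N C f ->
  P2.-integrable setT (fun w => (f (X2 w))%:E) ->
  \int[P0]_x \int[P]_w f (mehler t (S0 x) w) = \int[P2]_w f (X2 w).
Proof.
move=> b01 C0 gf if2; have mf := growth_measurable b01 C0 gf.
pose F (x : T0 * T) := f (mehler t (S0 x.1) x.2).
have iF : (P0 \x P)%E.-integrable setT (EFin \o F).
  exact: (integrable_equal_law mX1 mX2 char12 mf if2).
transitivity (\int[(P0 \x P)%E]_x F x); last first.
  exact: (integral_equal_law mX1 mX2 char12 mf).
apply: (@Rintegral_prod _ _ _ _ _ P0 P F iF) => x.
exact: (integrable_mehler mY momY b01 C0 gf (S0 x) t0).
Qed.

End composition.

Section growth_function.
Variables (b : R) (N : nat) (C : R) (h : symM R d -> R).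
Hypothesis b01 : 0 < b <= 1.
Hypothesis C0 : 0 <= C.
Hypothesis gh : growth b N C h.

Local Notation mehler_diff := (mehler_diff P Y M h).

Let mh : measurable_fun setT h. Proof. exact: growth_measurable gh. Qed.
Let b0 : 0 < b. Proof. by case/andP: b01. Qed.

(** Fresh noise is added to a start distributed as [mehler s S]: the contraction factors multiply
    and the variances add by [ou_stdD]. *)
Lemma mehler_semigroup t s S : 0 <= t -> 0 <= s ->
  \int[P]_x \int[P]_w h (mehler t (mehler s S x) w) =
  \int[P]_w h (mehler (t + s) S w).
Proof.
move=> t0 s0; have ts0 : 0 <= t + s by exact: addr_ge0.
apply: (@mehler_compose _ _ _ _ P (mehler s S) P (mehler (t + s) S) _ _ t t0 _ b N C h) => //.
- exact: measurable_mehler_w.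
- exact: measurable_mehler_w.
- move=> U th; rewrite (mehler_cos vZ charY U S th ts0).
  have E := mehler_cos vZ charY (expR (- t) *: U) S
    (frob U M - expR (- t) * frob U M + th) s0.
  rewrite [X in _ * X]E mulrA -expRD (vZ _ U) -(ou_stdD t0 s0).
  congr (expR _ * cos _); first by ring.
  by rewrite symZ_val !frobZl opprD expRD; ring.
- exact: (integrable_mehler mY momY b01 C0 gh S ts0).
Qed.

(** Here the variances add up to exp(- 2 t) + (1 - exp(- 2 t)) = 1 times that of [Y]. *)
Lemma mehler_invariant t : 0 <= t ->
  \int[P]_x \int[P]_w h (mehler t (Y x) w) = \int[P]_w h (Y w).
Proof.
move=> t0; apply: (@mehler_compose _ _ _ _ P Y P Y _ _ t t0 _ b N C h) => //.
- move=> U th; rewrite (charY U th).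
  have E := charY (expR (- t) *: U) (frob U M - expR (- t) * frob U M + th).
  rewrite [X in _ * X]E mulrA -expRD (vZ _ U) ou_std_sqr// expRN2.
  congr (expR _ * cos _); first by field.
  by rewrite symZ_val frobZl; ring.
- exact: (integrable_stationary mY momY b01 C0 gh).
Qed.

Let Ez := \int[P]_w (z w ^+ N.+1).

Lemma mehler_diff_bound t S : 0 <= t ->
  `|mehler_diff t S| <= C * Ez * q S ^+ N.+1 * expR (- b * t).
Proof.
move=> t0; pose f w := h (mehler t S w) - h (Y w).
have iF : P.-integrable setT (EFin \o f).
  have := @integrableB _ _ _ P _ measurableT _ _
    (integrable_mehler mY momY b01 C0 gh S t0)
    (integrable_stationary mY momY b01 C0 gh).
  by [].
have iz := integrable_noise_sizeX mY momY N.+1.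
rewrite (le_trans (le_normr_Rintegral measurableT iF))//.
rewrite (_ : _ * expR _ = (C * q S ^+ N.+1 * expR (- b * t)) * Ez); last by ring.
rewrite -RintegralZl//; apply: le_Rintegral => //.
- exact: (integrable_norm iF).
- exact: (@integrableZl _ _ _ P _ measurableT _ _ iz).
- move=> w _; rewrite (le_trans (mehler_decay _ _ b01 C0 gh _ _ t0))//.
  by rewrite le_eqVlt; apply/orP; left; apply/eqP; ring.
Qed.

Local Notation half_line := (\1_`[0, +oo[ : R -> R).

Let half_line_ge0 (t : R) : 0 <= t -> half_line t = 1.
Proof. by move=> t0; rewrite indicE mem_set//= in_itv/= andbT. Qed.

Let half_line_lt0 (t : R) : t < 0 -> half_line t = 0.
Proof.
by move=> t0; rewrite indicE memNset//= in_itv/= andbT leNgt t0.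
Qed.

Section random_start.
Context {disp0 : measure_display} {T0 : measurableType disp0}.
Variables (P0 : probability T0 R) (S0 : T0 -> symM R d).
Hypothesis mS0 : measurable_fun setT S0.
Hypothesis iS0 : P0.-integrable setT (fun x => (q (S0 x) ^+ N.+1)%:E).

Let m0 := sigma_finite_product P0 mu.

(** The half-line is encoded by an indicator, so that Fubini's theorem is applied on full product
    spaces. [G] dominates [F] and is a product of functions of start, time and noise. *)
Let F (x : (T0 * R) * T) : R := half_line x.1.2 *
  (h (mehler x.1.2 (S0 x.1.1) x.2) - h (Y x.2)).

Let G (x : (T0 * R) * T) : R :=
  (C * (q (S0 x.1.1) ^+ N.+1 * (half_line x.1.2 * expR (- b * x.1.2)))) *
  z x.2 ^+ N.+1.

Let mF : measurable_fun setT F.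
Proof.
have m11 : measurable_fun setT (fun x : (T0 * R) * T => x.1.1).
  exact: measurableT_comp measurable_fst measurable_fst.
have m12 : measurable_fun setT (fun x : (T0 * R) * T => x.1.2).
  exact: measurableT_comp measurable_snd measurable_fst.
have m2 : measurable_fun setT (fun x : (T0 * R) * T => x.2).
  exact: measurable_snd.
apply: measurable_funM.
  have mi : measurable_fun setT half_line by exact: measurable_indic.
  exact: measurableT_comp mi m12.
apply: measurable_funB.
  apply: measurableT_comp mh _.
  exact: (measurable_mehler M mY m12 (measurableT_comp mS0 m11) m2).
exact: measurableT_comp mh (measurableT_comp mY m2).
Qed.

Let iG : (m0 \x P)%E.-integrable setT (EFin \o G).
Proof.
have i01 : m0.-integrable setT
    (fun x => (q (S0 x.1) ^+ N.+1 * (half_line x.2 * expR (- b * x.2)))%:E).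
  apply: (@integrable_prodM _ _ _ _ _ P0 mu (fun x => q (S0 x) ^+ N.+1)
    (fun t => half_line t * expR (- b * t)) iS0).
  apply/(integrable_indic (fun t => expR (- b * t))) => //.
  exact: integrable_expR_half_line.
have i02 := @integrableZl _ _ _ m0 _ measurableT C _ i01.
exact: (@integrable_prodM _ _ _ _ _ m0 P
  (fun x => C * (q (S0 x.1) ^+ N.+1 * (half_line x.2 * expR (- b * x.2))))
  _ i02 (integrable_noise_sizeX mY momY N.+1)).
Qed.

Let FG x : `|F x| <= G x.
Proof.
rewrite /F /G; have [t0|t0] := leP 0 x.1.2.
  rewrite half_line_ge0// !mul1r (le_trans (mehler_decay Y M b01 C0 gh _ _ t0))//.
  by rewrite le_eqVlt; apply/orP; left; apply/eqP; ring.
by rewrite half_line_lt0// !mul0r mulr0 mulr0 mul0r normr0.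
Qed.

Let iF : (m0 \x P)%E.-integrable setT (EFin \o F).
Proof.
apply: (@le_integrable _ _ _ (m0 \x P)%E setT _ _ (EFin \o G)) => //.
  exact/measurable_EFinP.
by move=> x _; rewrite /= lee_fin (le_trans (FG x))// ler_norm.
Qed.

Let iF2 x : P.-integrable setT (fun w => (F (x, w))%:E).
Proof.
have [t0|t0] := leP 0 x.2; last first.
  rewrite (_ : (fun w => _) = cst 0%E) ?integrable0//.
  by apply/funext => w; rewrite /F /= half_line_lt0// mul0r.
have := @integrableB _ _ _ P _ measurableT _ _
  (integrable_mehler mY momY b01 C0 gh (S0 x.1) t0)
  (integrable_stationary mY momY b01 C0 gh).
by congr (_.-integrable _ _); apply/funext => w; rewrite /F /= half_line_ge0// mul1r.
Qed.

(** The start is random for two uses: under a Dirac mass this gives joint measurability, and under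
    the law of [mehler s S] it justifies the exchange of integrals in [expectation_stein_mehler]. *)
Lemma integrable_prod_mehler_diff : (P0 \x mu)%E.-integrable setT
  (fun x => (half_line x.2 * mehler_diff x.2 (S0 x.1))%:E).
Proof.
have := @integrable_Rintegral _ _ _ _ _ m0 P F iF iF2.
congr (_.-integrable _ _); apply/funext => x; congr EFin.
rewrite /F /=; have [t0|t0] := leP 0 x.2; last first.
  rewrite half_line_lt0// mul0r.
  by under eq_Rintegral do rewrite mul0r; rewrite Rintegral_prob_cst.
by rewrite half_line_ge0// mul1r; under eq_Rintegral do rewrite mul1r.
Qed.

End random_start.

(** Measurability is extracted from integrability: the start is the identity of [symM] under the
    Dirac mass at [M], for which every measurable function is integrable. *)
Lemma measurable_mehler_diff : measurable_fun setT
  (fun x : symM R d * R => half_line x.2 * mehler_diff x.2 x.1).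
Proof.
have mq : measurable_fun setT (fun S => q S ^+ N.+1).
  apply: measurable_funX; apply: measurable_funD => //.
  exact: measurable_dist.
apply/measurable_EFinP.
have := @integrable_prod_mehler_diff _ _ (\d_M : probability _ R)
  id (@measurable_id _ _ setT) (integrable_dirac M mq).
exact: measurable_int.
Qed.

Lemma integrable_mehler_diff S :
  mu.-integrable `[0, +oo[ (fun t => (mehler_diff t S)%:E).
Proof.
apply/(integrable_indic (mehler_diff ^~ S)) => //.
have ie : mu.-integrable setT (fun t : R => (half_line t * expR (- b * t))%:E).
  apply/(integrable_indic (fun t => expR (- b * t))) => //.
  exact: integrable_expR_half_line.
have iK := @integrableZl _ _ _ mu _ measurableT (C * Ez * q S ^+ N.+1) _ ie.
apply: (le_integrable measurableT _ _ iK).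
  apply/measurable_EFinP.
  exact: (measurableT_comp measurable_mehler_diff (pair1_measurable S)).
move=> t _; rewrite /= lee_fin; have [t0|t0] := leP 0 t; last first.
  by rewrite half_line_lt0// !mul0r mulr0 normr0.
rewrite half_line_ge0// !mul1r (le_trans (mehler_diff_bound S t0))//.
exact: ler_norm.
Qed.

Definition stein_mehler S : R := - \int[mu]_(t in `[0, +oo[) mehler_diff t S.

Lemma integrable_start_size_mehler s S k : 0 <= s ->
  P.-integrable setT (fun w => (q (mehler s S w) ^+ k)%:E).
Proof.
move=> s0; have iz := integrable_noise_sizeX mY momY k.
have iK := @integrableZl _ _ _ P _ measurableT (q S ^+ k) _ iz.
apply: (le_integrable measurableT _ _ iK).
  apply/measurable_EFinP; apply: measurable_funX.
  apply: measurable_funD => //.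
  exact: measurableT_comp (measurable_dist M) (measurable_mehler_w M mY s S).
move=> w _; rewrite /= lee_fin.
have q0 : 0 <= q (mehler s S w) by exact: start_size_ge0.
have z0 : 0 <= z w by exact: noise_size_ge0.
rewrite !ger0_norm ?mulr_ge0 ?exprn_ge0 ?start_size_ge0//.
rewrite -exprMn lerXn2r ?nnegrE ?mulr_ge0 ?start_size_ge0//.
rewrite {1}/start_size -addrA le_start_noise//.
have := mehler_dist_mean Y M S w s0.
move: `|mehler s S w - M| `|S - M| `|Y w - M| `|M| (normr_ge0 (Y w - M)) => x y u m u0 xle.
rewrite -subr_ge0 (_ : _ - _ = (y + u - x) + u); last by ring.
by rewrite addr_ge0// subr_ge0.
Qed.

Lemma measurable_mehler_diff_start t : 0 <= t -> measurable_fun setT (mehler_diff t).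
Proof.
move=> t0; have := measurableT_comp measurable_mehler_diff (pair2_measurable t).
by congr measurable_fun; apply/funext => S; rewrite /= half_line_ge0// mul1r.
Qed.

Lemma integrable_mehler_diff_mehler t s S : 0 <= t -> 0 <= s ->
  P.-integrable setT (fun w => (mehler_diff t (mehler s S w))%:E).
Proof.
move=> t0 s0.
have iK := @integrableZl _ _ _ P _ measurableT (C * Ez * expR (- b * t)) _
  (integrable_start_size_mehler S N.+1 s0).
apply: (le_integrable measurableT _ _ iK).
  apply/measurable_EFinP.
  exact: measurableT_comp (measurable_mehler_diff_start t0) (measurable_mehler_w M mY s S).
move=> w _; rewrite /= lee_fin (le_trans (mehler_diff_bound _ t0))//.
by rewrite mulrAC ler_norm.
Qed.

Lemma expectation_mehler_diff t s S : 0 <= t -> 0 <= s ->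
  \int[P]_w mehler_diff t (mehler s S w) = mehler_diff (t + s) S.
Proof.
move=> t0 s0; pose Eh := \int[P]_x h (Y x).
rewrite (mehler_diffE mY momY b01 C0 gh S (addr_ge0 t0 s0)).
rewrite -(mehler_semigroup S t0 s0); apply/eqP; rewrite -subr_eq opprK.
rewrite -{1}(Rintegral_prob_cst P (\int[P]_x h (Y x))).
have iE : P.-integrable setT (EFin \o cst Eh) by exact: finite_measure_integrable_cst.
rewrite -(RintegralD measurableT (integrable_mehler_diff_mehler S t0 s0) iE).
apply/eqP/eq_Rintegral => w _ /=.
by rewrite (mehler_diffE mY momY b01 C0 gh _ t0) subrK.
Qed.

Lemma integrable_mehler_diff_shift s S : 0 <= s ->
  mu.-integrable `[0, +oo[ (fun t => (mehler_diff (t + s) S)%:E).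
Proof.
move=> s0; apply/(integrable_indic (fun t => mehler_diff (t + s) S)) => //.
have ie : mu.-integrable setT (fun t : R => (half_line t * expR (- b * t))%:E).
  apply/(integrable_indic (fun t => expR (- b * t))) => //.
  exact: integrable_expR_half_line.
have iK := @integrableZl _ _ _ mu _ measurableT (C * Ez * q S ^+ N.+1) _ ie.
have Ez0 : 0 <= Ez.
  by apply: Rintegral_ge0 => w _; rewrite exprn_ge0 ?noise_size_ge0.
apply: (le_integrable measurableT _ _ iK).
  apply/measurable_EFinP.
  (* Joint measurability is known only with the cutoff in time, so a second cutoff at [t + s], equal
     to 1 wherever the first is nonzero, is inserted. *)
  have -> : (fun t => half_line t * mehler_diff (t + s) S) = (fun t =>
      half_line t * (half_line (t + s) * mehler_diff (t + s) S)).
    apply/funext => t; have [t0|t0] := leP 0 t; last by rewrite half_line_lt0// !mul0r.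
    by rewrite (half_line_ge0 (addr_ge0 t0 s0)) mul1r.
  apply: measurable_funM; first exact: measurable_indic.
  apply: (@measurableT_comp _ _ _ _ _ _
    (fun x : symM R d * R => half_line x.2 * mehler_diff x.2 x.1) _
    (fun t : R => (S, t + s))).
    exact: measurable_mehler_diff.
  by apply: measurable_fun_pair => //; exact: measurable_funD.
move=> t _; rewrite /= lee_fin; have [t0|t0] := leP 0 t; last first.
  by rewrite half_line_lt0// !mul0r mulr0 normr0.
rewrite half_line_ge0// !mul1r.
rewrite (le_trans (mehler_diff_bound S (addr_ge0 t0 s0)))//.
rewrite (le_trans _ (ler_norm _))// ler_wpM2l//.
  by rewrite !mulr_ge0// exprn_ge0// start_size_ge0.
by rewrite ler_expR !mulNr lerN2 ler_wpM2l ?(ltW b0)// lerDl.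
Qed.

(** Taking the expectation under the time integral advances time by [s]; the shifted half-line
    integral misses exactly [0, s[. *)
Lemma expectation_stein_mehler s S : 0 <= s ->
  \int[P]_w stein_mehler (mehler s S w) =
  stein_mehler S + \int[mu]_(t in `[0, s[) mehler_diff t S.
Proof.
move=> s0; pose F (x : T * R) := half_line x.2 * mehler_diff x.2 (mehler s S x.1).
have iF : (P \x mu)%E.-integrable setT (EFin \o F).
  apply: (@integrable_prod_mehler_diff _ _ P (mehler s S)).
    exact: measurable_mehler_w.
  exact: integrable_start_size_mehler.
have iF2 w : mu.-integrable setT (fun t => (F (w, t))%:E).
  exact/(integrable_indic (mehler_diff ^~ (mehler s S w)) (measurable_itv _)).1/integrable_mehler_diff.
have iF1 t : P.-integrable setT (fun w => (F (w, t))%:E).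
  have [t0|t0] := leP 0 t; last first.
    rewrite (_ : (fun w => _) = cst 0%E) ?integrable0//.
    by apply/funext => w; rewrite /F /= half_line_lt0// mul0r.
  have := integrable_mehler_diff_mehler S t0 s0.
  by congr (_.-integrable _ _); apply/funext => w; rewrite /F /= half_line_ge0// mul1r.
have iN := @integrable_Rintegral _ _ _ _ _ P mu F iF iF2.
have E w : stein_mehler (mehler s S w) = (-1) * \int[mu]_t F (w, t).
  by rewrite /stein_mehler Rintegral_indic mulN1r.
under eq_Rintegral do rewrite E.
rewrite (@RintegralZl _ _ _ P _ (fun w => \int[mu]_t F (w, t)) (-1) measurableT iN).
rewrite (@Rintegral_Fubini _ _ _ _ _ P mu F iF iF2 iF1) mulN1r.
have E2 t : \int[P]_w F (w, t) = half_line t * mehler_diff (t + s) S.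
  have [t0|t0] := leP 0 t; last first.
    rewrite half_line_lt0// mul0r -[RHS](Rintegral_prob_cst P).
    by apply: eq_Rintegral => w _; rewrite /F /= half_line_lt0// mul0r.
  rewrite half_line_ge0// mul1r -(expectation_mehler_diff S t0 s0).
  by apply: eq_Rintegral => w _; rewrite /F /= half_line_ge0// mul1r.
under eq_Rintegral do rewrite E2.
rewrite -(Rintegral_indic `[0, +oo[ (fun t => mehler_diff (t + s) S)).
rewrite (@Rintegral_shift _ (mehler_diff ^~ S) s s0 (integrable_mehler_diff S)
  (integrable_mehler_diff_shift S s0)).
by rewrite opprB addrC.
Qed.

Let Ez' := \int[P]_w (z w ^+ N).

(** With common noise the two Mehler variables are exactly exp(- t) |S - S'| apart. The exponent
    stays [N], and for [N = 0] the constant is [C] itself, so Hoelder seminorms contract by exp(- b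
    t) without loss. *)
Lemma growth_mehler_diff t S S' : 0 <= t ->
  `|mehler_diff t S - mehler_diff t S'| <=
  C * (1 + 4 * `|M|) ^+ N * Ez' * (1 + `|S| + `|S'|) ^+ N * `|S - S'| `^ b *
  expR (- b * t).
Proof.
move=> t0; rewrite !(mehler_diffE mY momY b01 C0 gh _ t0).
rewrite opprB addrA subrK.
have i1 := integrable_mehler mY momY b01 C0 gh S t0.
have i2 := integrable_mehler mY momY b01 C0 gh S' t0.
rewrite -(RintegralB measurableT i1 i2).
have i12 : P.-integrable setT
    (EFin \o (fun w => h (mehler t S w) - h (mehler t S' w))).
  exact: (@integrableB _ _ _ P _ measurableT _ _ i1 i2).
have iz := integrable_noise_sizeX mY momY N.
rewrite (le_trans (le_normr_Rintegral measurableT i12))//.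
rewrite [leRHS](_ : _ = (C * (1 + 4 * `|M|) ^+ N * (1 + `|S| + `|S'|) ^+ N *
  `|S - S'| `^ b * expR (- b * t)) * Ez'); last by ring.
rewrite -RintegralZl//; apply: le_Rintegral => //.
- exact: (integrable_norm i12).
- exact: (@integrableZl _ _ _ P _ measurableT _ _ iz).
move=> w _; rewrite (le_trans (gh _ _))// mehler_contraction.
have -> : expR (- b * t) = expR (- t) `^ b by rewrite -expRM mulrC mulNr mulrN.
rewrite powRM ?expR_ge0//.
rewrite [leRHS](_ : _ = C * ((1 + 4 * `|M|) * (1 + `|S| + `|S'|) * z w) ^+ N *
   (expR (- t) `^ b * `|S - S'| `^ b)); last by rewrite !exprMn; ring.
rewrite ler_wpM2r ?mulr_ge0 ?powR_ge0// ler_wpM2l//.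
have z0 : 0 <= z w by exact: noise_size_ge0.
have s0 : 0 <= (1 + 4 * `|M|) * (1 + `|S| + `|S'|) * z w.
  by rewrite !mulr_ge0// ?addr_ge0// mulr_ge0.
rewrite lerXn2r ?nnegrE ?addr_ge0//.
have n1 := norm_mehler_le Y M S w t0.
have n2 := norm_mehler_le Y M S' w t0.
have d1 : `|S - M| <= `|S| + `|M| := ler_normB _ _.
have d2 : `|S' - M| <= `|S'| + `|M| := ler_normB _ _.
rewrite /noise_size.
move: (normr_ge0 S) (normr_ge0 S') (normr_ge0 M) (normr_ge0 (Y w - M)) n1 n2 d1 d2.
move: `|mehler t S w| `|mehler t S' w| `|S| `|S'| `|S - M| `|S' - M| `|M| `|Y w - M|.
move=> m1 m2 x1 x2 y1 y2 m u x10 x20 m0 u0 n1 n2 d1 d2.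
have a0 : 0 <= m * (x1 + x2) by rewrite mulr_ge0 ?addr_ge0.
have c0 : 0 <= (4 * m + x1 + x2 + 4 * (m * (x1 + x2))) * u.
  by rewrite mulr_ge0// !addr_ge0// mulr_ge0.
(* Each Mehler variable has norm at most 2 |M| + |start| + |Y - M|, which explains the 4 and the 2;
   the cross terms in [a0] and [c0] are nonnegative and only help. *)
rewrite (_ : (1 + 4 * m) * (1 + x1 + x2) * (1 + 2 * u) =
  1 + 4 * m + x1 + x2 + 4 * (m * (x1 + x2)) + 2 * u +
  2 * ((4 * m + x1 + x2 + 4 * (m * (x1 + x2))) * u)); last by ring.
by lra.
Qed.

(** Integrating the contraction in time keeps [b] and [N], so the results proved for [h] apply to
    the Stein solution too. *)
Lemma growth_stein_mehler :
  growth b N (C * (1 + 4 * `|M|) ^+ N * Ez' / b) stein_mehler.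
Proof.
move=> S S'; rewrite /stein_mehler opprK addrC.
have i1 := integrable_mehler_diff S'; have i2 := integrable_mehler_diff S.
rewrite -(@RintegralB _ _ _ mu _ _ _ (measurable_itv _) i1 i2).
have i12 : mu.-integrable `[0, +oo[
    (EFin \o (fun t => mehler_diff t S' - mehler_diff t S)).
  exact: (@integrableB _ _ _ mu _ (measurable_itv _) _ _ i1 i2).
rewrite (le_trans (@le_normr_Rintegral _ _ _ mu _ _ (measurable_itv _) i12))//.
set K := C * (1 + 4 * `|M|) ^+ N * Ez'.
rewrite [leRHS](_ : _ = K * (1 + `|S| + `|S'|) ^+ N * `|S - S'| `^ b * b^-1); last by ring.
rewrite -(Rintegral_expR_half_line b0) -RintegralZl//; last first.
  exact: integrable_expR_half_line.
apply: le_Rintegral => //.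
- exact: (integrable_norm i12).
- apply: (@integrableZl _ _ _ mu _ (measurable_itv _) _ _ (integrable_expR_half_line b0)).
- move=> t; rewrite /= in_itv/= andbT => t0.
  by rewrite distrC growth_mehler_diff.
Qed.

(** The factor [2 ^+ N] appears because |S - M| enters both the bound for [mehler t S w] and the one
    for [S], but only once in [q S]. *)
Lemma mehler_diff_start t S : 0 <= t ->
  `|mehler_diff 0 S - mehler_diff t S| <=
  C * 2 ^+ N * q S ^+ N.+1 * Ez * (1 - expR (- t) + ou_std t) `^ b.
Proof.
move=> t0; rewrite (mehler_diffE mY momY b01 C0 gh _ (lexx 0)).
rewrite (mehler_diffE mY momY b01 C0 gh _ t0) opprB addrA subrK.
have i1 := integrable_mehler mY momY b01 C0 gh S (lexx 0).
have i2 := integrable_mehler mY momY b01 C0 gh S t0.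
rewrite -(RintegralB measurableT i1 i2).
have i12 : P.-integrable setT
    (EFin \o (fun w => h (mehler 0 S w) - h (mehler t S w))).
  exact: (@integrableB _ _ _ P _ measurableT _ _ i1 i2).
have iz := integrable_noise_sizeX mY momY N.+1.
rewrite (le_trans (le_normr_Rintegral measurableT i12))//.
set D := 1 - expR (- t) + ou_std t.
have D0 : 0 <= D.
  by rewrite addr_ge0 ?ou_std_ge0// subr_ge0 -[leRHS]expR0 ler_expR oppr_le0.
rewrite [leRHS](_ : _ = (C * 2 ^+ N * q S ^+ N.+1 * D `^ b) * Ez); last by ring.
rewrite -RintegralZl//; apply: le_Rintegral => //.
- exact: (integrable_norm i12).
- exact: (@integrableZl _ _ _ P _ measurableT _ _ iz).
move=> w _; rewrite mehler0 distrC (le_trans (gh _ _))//.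
set x := q S * z w.
have x1 : 1 <= x := mulr_ege1 (start_size_ge1 M S) (noise_size_ge1 Y M w).
have x0 : 0 <= x := le_trans ler01 x1.
have x20 : 0 <= 2 * x by rewrite mulr_ge0.
rewrite [leRHS](_ : _ = C * ((2 * x) ^+ N * (D `^ b * x))); last first.
  by rewrite /x !exprMn !exprS; ring.
rewrite -mulrA ler_wpM2l// ler_pM ?exprn_ge0 ?addr_ge0 ?powR_ge0//.
  rewrite lerXn2r ?nnegrE ?addr_ge0//.
  have n1 := norm_mehler_le Y M S w t0.
  have d1 : `|S| <= `|M| + `|S - M| by rewrite -lerBlDl lerB_dist.
  have := @le_start_noise _ _ _ _ Y M S w _ (lexx _); rewrite -/x.
  move: (normr_ge0 M) (normr_ge0 (Y w - M)) n1 d1.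
  move: `|mehler t S w| `|S| `|S - M| `|M| `|Y w - M| => m1 y1 s m u m0 u0 n1 d1 xle.
  by lra.
rewrite (@le_trans _ _ ((D * x) `^ b))//.
  apply: ge0_ler_powR; [exact: ltW|exact: normr_ge0|exact: mulr_ge0|].
  rewrite (le_trans (mehler_dist_start _ _ _ _ t0))// ler_wpM2l//.
  rewrite (le_trans _ (le_start_noise (lexx _)))//.
  move: `|S - M| `|M| `|Y w - M| (normr_ge0 M) (normr_ge0 (Y w - M)) => s m u m0 u0.
  rewrite -subr_ge0 (_ : _ - _ = 1 + m + m + u); last by ring.
  by rewrite !addr_ge0.
rewrite powRM// ler_wpM2l ?powR_ge0//.
by rewrite -[leRHS]powRr1// ler_powR//; case/andP: b01.
Qed.

Lemma cvg_mehler_diff_start S : mehler_diff t S @[t --> 0^'+] --> mehler_diff 0 S.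
Proof.
apply/cvgrPdist_le => e e0.
set K := C * 2 ^+ N * q S ^+ N.+1 * Ez.
have Ez0 : 0 <= Ez.
  by apply: Rintegral_ge0 => w _; rewrite exprn_ge0 ?noise_size_ge0.
have K0 : 0 <= K by rewrite !mulr_ge0 ?exprn_ge0 ?start_size_ge0.
have K1 : 0 < K + 1 by rewrite ltr_wpDl.
(* [r] solves (K + 1) r^b = e, and the displacement factor [D t] falls below it near 0. *)
pose r := (e / (K + 1)) `^ b^-1.
have r0 : 0 < r by rewrite powR_gt0 ?divr_gt0.
pose D (t : R) : R := 1 - expR (- t) + ou_std t.
have D0 : D t @[t --> 0^'+] --> (0 : R).
  suff : D t @[t --> 0^'+] --> D 0.
    by rewrite {2}/D oppr0 expR0 subrr ou_std0 addr0.
  apply: cvg_at_right_filter; apply: cvgD; last exact: continuous_ou_std.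
  apply: cvgB; first exact: cvg_cst.
  by apply: (continuous_comp (@oppr_continuous _ R^o 0)); exact: continuous_expR.
near=> t.
have t0 : 0 <= t by near: t; exact: nbhs_right_ge.
have Dr : D t <= r.
  have : `|0 - D t| <= r by near: t; move/cvgrPdist_le : D0; exact.
  by rewrite sub0r normrN; apply: le_trans; exact: ler_norm.
have D0' : 0 <= D t.
  by rewrite addr_ge0 ?ou_std_ge0// subr_ge0 -[leRHS]expR0 ler_expR oppr_le0.
rewrite (le_trans (mehler_diff_start _ t0))// -/K.
rewrite (@le_trans _ _ (K * (e / (K + 1))))//.
  have -> : e / (K + 1) = r `^ b.
    by rewrite -powRrM mulVf ?gt_eqF// powRr1// divr_ge0// ltW.
  by rewrite ler_wpM2l// ge0_ler_powR ?nnegrE ?(ltW b0) ?(ltW r0).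
by rewrite mulrCA ler_piMr ?(ltW e0)// ler_pdivrMr// mul1r lerDl.
Unshelve. all: by end_near. Qed.

Lemma stein_mehler_equation S :
  (\int[P]_w stein_mehler (mehler s S w) - stein_mehler S) / s @[s --> 0^'+] -->
  h S - \int[P]_w h (Y w).
Proof.
have <- : mehler_diff 0 S = h S - \int[P]_w h (Y w).
  rewrite (mehler_diffE mY momY b01 C0 gh _ (lexx 0)); congr (_ - _).
  by under eq_Rintegral do rewrite mehler0; rewrite Rintegral_prob_cst.
have := cvg_average_at_right (integrable_mehler_diff S) (@cvg_mehler_diff_start S).
apply: cvg_trans; apply: near_eq_cvg; near=> s.
by rewrite expectation_stein_mehler// addrC addKr.
Unshelve. all: by end_near. Qed.

End growth_function.
End mehler_stein.

(** * Laws of the process and of its stationary limit *)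

Section moments_of_sums.
Context {disp : measure_display} {T : measurableType disp} {R : realType}.
Variable P : probability T R.

Lemma exprD_le (x y : R) k : 0 <= x -> 0 <= y ->
  (x + y) ^+ k <= 2 ^+ k * x ^+ k + 2 ^+ k * y ^+ k.
Proof.
move=> x0 y0; rewrite -!exprMn; have [xy|yx] := leP x y.
  rewrite (@le_trans _ _ ((2 * y) ^+ k))//; last by rewrite lerDr exprn_ge0 ?mulr_ge0.
  by rewrite lerXn2r ?nnegrE ?addr_ge0 ?mulr_ge0// mulr2n mulrDl !mul1r lerD2r.
rewrite (@le_trans _ _ ((2 * x) ^+ k))//; last by rewrite lerDl exprn_ge0 ?mulr_ge0.
by rewrite lerXn2r ?nnegrE ?addr_ge0 ?mulr_ge0// mulr2n mulrDl !mul1r lerD2l ltW.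
Qed.

(** All powers are treated at once so that the induction on [s] closes. *)
Lemma integrable_sumX (I : Type) (s : seq I) (x : I -> T -> R) :
  (forall i w, 0 <= x i w) ->
  (forall i k, P.-integrable setT (fun w => (x i w ^+ k)%:E)) ->
  forall k, P.-integrable setT (fun w => ((\sum_(i <- s) x i w) ^+ k)%:E).
Proof.
move=> x0 ix; elim: s => [|i s IH] k.
  rewrite (_ : (fun w => _) = cst ((0 : R) ^+ k)%:E).
    exact: finite_measure_integrable_cst.
  by apply/funext => w; rewrite big_nil.
have mx (f : T -> R) : P.-integrable setT (fun w => (f w ^+ 1)%:E) ->
    measurable_fun setT f.
  by move=> /(measurable_int P) /measurable_EFinP; under eq_fun do rewrite expr1.
have s0 w : 0 <= \sum_(i <- s) x i w by exact: sumr_ge0.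
have i1 := @integrableZl _ _ _ P _ measurableT (2 ^+ k) _ (ix i k).
have i2 := @integrableZl _ _ _ P _ measurableT (2 ^+ k) _ (IH k).
apply: (le_integrable measurableT _ _ (integrableD measurableT i1 i2)).
  apply/measurable_EFinP; under eq_fun do rewrite big_cons.
  by apply: measurable_funX; apply: measurable_funD; apply: mx.
move=> w _; rewrite /= lee_fin big_cons ger0_norm ?exprn_ge0 ?addr_ge0//.
by rewrite (le_trans (exprD_le _ _ _))// ler_norm.
Qed.

End moments_of_sums.

Section symmetric_normal.
Context {R : realType} {d : nat} (o : 'I_(qd d) -> 'I_d * 'I_d).
Hypothesis o_ord : vecs_ordering o.
Context {disp : measure_display} {T : measurableType disp}.
Variables (P : probability T R) (Z : T -> symM R d) (M Psi Sigma Ph Sh : symM R d).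
Hypothesis mZ : measurable_fun setT Z.
Hypothesis Z_law : symmetric_normal P o Z M Psi Sigma.
Hypothesis PhE : Ph *m Ph = Psi :> 'M[R]_d.
Hypothesis ShE : Sh *m Sh = Sigma :> 'M[R]_d.

Definition sn_variance (U : symM R d) : R := frob (Ph *m U *m Sh) (Ph *m U *m Sh).

Lemma sn_varianceZ c U : sn_variance (c *: U) = c ^+ 2 * sn_variance U.
Proof.
by rewrite /sn_variance symZ_val -scalemxAr -scalemxAl frobZl frobZr mulrA.
Qed.

(** Pairing with [vecs o U] is [frob U], and its variance becomes the squared norm of Ph U Sh, the
    quantity that occurs in [ou_cos]. *)
Let Z_gaussian (U : symM R d) : gaussian_rv P (fun w => frob U (Z w)) (frob U M) (sn_variance U).
Proof.
have := Z_law (vecs o U).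
rewrite (sn_covarianceE o_ord) (frob_sn_operator U PhE ShE) -(frob_vecs o_ord).
by congr (gaussian_rv _ _ _ _); apply/funext => w; rewrite -(frob_vecs o_ord).
Qed.

Lemma symmetric_normal_cos (U : symM R d) th :
  \int[P]_w cos (frob U (Z w) + th) =
  expR (- (sn_variance U / 2)) * cos (frob U M + th).
Proof.
have := gaussian_rv_cos (Z_gaussian U) (frob_ge0 _) 1 th.
by rewrite expr1n !mul1r => <-; apply: eq_Rintegral => w _; rewrite mul1r.
Qed.

(** The norm is at most the sum of the absolute coordinates in [basis], each a one-dimensional
    Gaussian with all moments. *)
Lemma symmetric_normal_moment k :
  P.-integrable setT (fun w => (`|Z w - M| ^+ k)%:E).
Proof.
pose x a w : R := `|frob (basis o a : symM R d) (Z w) - frob (basis o a : symM R d) M|.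
have ix a j : P.-integrable setT (fun w => (x a w ^+ j)%:E).
  exact: gaussian_rv_integrable (Z_gaussian (basis o a)) (frob_ge0 _) j.
have x0 a w : 0 <= x a w by exact: normr_ge0.
apply: (le_integrable measurableT _ _ (integrable_sumX (index_enum _) x0 ix k)).
  apply/measurable_EFinP; apply: measurable_funX.
  exact: measurableT_comp (measurable_dist M) mZ.
move=> w _; rewrite /= lee_fin !ger0_norm ?exprn_ge0 ?sumr_ge0//.
rewrite lerXn2r ?nnegrE ?sumr_ge0//.
rewrite {1}[Z w - M](sym_expand o_ord) (le_trans (ler_norm_sum _ _ _))//.
apply: ler_sum => a _; rewrite normrZ norm_basis// mulr1.
by rewrite /x -frobBr -symB_val frobC (frob_basis o).
Qed.

End symmetric_normal.

Section ornstein_uhlenbeck.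
Context {R : realType} {d : nat}.
Context {disp : measure_display} {T : measurableType disp}.
Context {disp' : measure_display} {T' : measurableType disp'}.
Variables (P : probability T R) (B : R -> T -> 'M[R]_d) (M Ph Sh : symM R d).
Variable X : symM R d -> R -> T -> symM R d.
Variables (P' : probability T' R) (Z : T' -> symM R d).
Hypothesis BB : brownian_matrix P B.
Hypothesis XE : forall S, ou_solution P B M Ph Sh S (X S).
Hypothesis mZ : measurable_fun setT Z.
Hypothesis charZ : forall (U : symM R d) th, \int[P']_w cos (frob U (Z w) + th) =
  expR (- (sn_variance Ph Sh U / 2)) * cos (frob U M + th).

Let X_mehler S t (U : symM R d) th : 0 <= t ->
  \int[P]_w cos (frob U (X S t w) + th) =
  \int[P']_w cos (frob U (mehler Z M t S w) + th).
Proof.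
move=> t0; rewrite (ou_cos BB (XE S) U th t0).
by rewrite (mehler_cos (sn_varianceZ Ph Sh) charZ U S th t0) ou_std_sqr.
Qed.

(** The solution of the equation enters only through its law at time [t]; the semigroup becomes an
    expectation over the space of the stationary variable. *)
Lemma semigroup_mehler f S t : measurable_fun setT f -> 0 <= t ->
  semigroup P X t f S = \int[P']_w f (mehler Z M t S w).
Proof.
move=> mf t0; have mX := (XE S).1 t t0.
exact: (integral_equal_law mX (measurable_mehler_w M mZ t S)
  (fun U th => X_mehler S U th t0) mf).
Qed.

Lemma semigroup_defined_mehler f S t : measurable_fun setT f -> 0 <= t ->
  P'.-integrable setT (fun w => (f (mehler Z M t S w))%:E) ->
  semigroup_defined P X t f S.
Proof.
move=> mf t0 ifm; split => //; have mX := (XE S).1 t t0.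
exact: (integrable_equal_law mX (measurable_mehler_w M mZ t S)
  (fun U th => X_mehler S U th t0) mf ifm).
Qed.

End ornstein_uhlenbeck.

(** * The Kantorovich bound *)

Section holder_kantorovich.
Context {R : realType} {d : nat}.
Hypothesis d_gt0 : (0 < d)%N.
Variable b : R.
Hypothesis b01 : 0 < b <= 1.
Implicit Types h : symM R d -> R.

Let b0 : 0 < b. Proof. by case/andP: b01. Qed.

Lemma growth_powR_dist (M : symM R d) : growth b 0 1 (fun S => `|S - M| `^ b).
Proof.
have le (S S' : symM R d) : `|S - M| `^ b <= `|S' - M| `^ b + `|S - S'| `^ b.
  rewrite (le_trans _ (powRD_le _ _ _))//.
  rewrite ge0_ler_powR ?nnegrE ?(ltW b0) ?addr_ge0//.
  by rewrite -[S - M](subrKA S') addrC ler_normD.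
move=> S S'; rewrite expr0 !mul1r ler_distlC; apply/andP; split.
  by rewrite lerBlDr le.
by rewrite (distrC S S') le.
Qed.

(** For [d > 0] the identity matrix differs from 0, so the supremum is over a nonempty set and is
    nonnegative; over the empty set it would be - oo. *)
Lemma holder_seminorm_fin h : holder b h ->
  exists2 L : R, 0 <= L & holder_seminorm b h = L%:E.
Proof.
move=> hh; pose I : symM R d := SymM (introT eqP (trmx1 R d)).
have I0 : I != 0.
  apply/eqP => /(congr1 (fun S : symM R d => S (Ordinal d_gt0) (Ordinal d_gt0))).
  by rewrite !mxE eqxx => /eqP; rewrite oner_eq0.
have s0 : (0 <= holder_seminorm b h)%E.
  apply: (@le_trans _ _ (`|h I - h 0| / `|I - 0| `^ b)%:E).
    by rewrite lee_fin divr_ge0// powR_ge0.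
  by apply: ereal_sup_ubound; exists I, 0.
exists (fine (holder_seminorm b h)); first exact: fine_ge0.
by rewrite fineK// ge0_fin_numE.
Qed.

Lemma holder_seminorm_growth h (L : R) : 0 <= L ->
  holder_seminorm b h = L%:E -> growth b 0 L h.
Proof.
move=> L0 hL S S'; rewrite expr0 mulr1.
have [->|SS'] := eqVneq S S'.
  by rewrite subrr normr0 mulr_ge0// powR_ge0.
have /holder_seminorm_le hc : (holder_seminorm b h <= L%:E)%E by rewrite hL.
exact: hc.
Qed.

Context {disp : measure_display} {T : measurableType disp}.
Variables (P : probability T R) (Z : {RV P >-> symM R d}) (M : symM R d).
Variable v : symM R d -> R.
Hypothesis vZ : forall c U, v (c *: U) = c ^+ 2 * v U.
Hypothesis charZ : forall (U : symM R d) th,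
  \int[P]_w cos (frob U (Z w) + th) = expR (- (v U / 2)) * cos (frob U M + th).
Hypothesis momZ : forall k : nat, P.-integrable setT (fun w => (`|Z w - M| ^+ k)%:E).

Let mZ : measurable_fun setT Z. Proof. exact: measurable_funPT. Qed.
Let gamma := distribution P Z.

Let integrable_growth h (C : R) : 0 <= C -> growth b 0 C h ->
  P.-integrable setT (fun w => (h (Z w))%:E).
Proof. by move=> C0 gh; exact: (integrable_stationary mZ momZ b01 C0 gh). Qed.

Lemma finite_moment_gamma : finite_moment b gamma.
Proof.
have g := growth_powR_dist 0.
have mf := growth_measurable b01 ler01 g.
have mf' : measurable_fun setT (EFin \o (fun S : symM R d => `|S - 0| `^ b)).
  exact/measurable_EFinP.
have i0 := integrable_growth ler01 g.
have := integrable_pushforward mZ mf' i0 measurableT.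
by rewrite /finite_moment; under eq_fun do rewrite subr0.
Qed.

Lemma finite_moment_dirac (S : symM R d) : finite_moment b \d_S.
Proof.
apply: (@integrable_dirac _ _ _ S (fun S' : symM R d => `|S'| `^ b)).
have := growth_measurable b01 ler01 (growth_powR_dist 0).
by under eq_fun do rewrite subr0.
Qed.

Lemma Rintegral_gamma h (C : R) : 0 <= C -> growth b 0 C h ->
  \int[gamma]_S h S = \int[P]_w h (Z w).
Proof.
move=> C0 gh; have mh := growth_measurable b01 C0 gh.
rewrite /Rintegral integral_distribution//.
  exact/measurable_EFinP.
exact: integrable_growth C0 gh.
Qed.

(** Above, |h(S) - h(Z)| <= |S - M|^b + |Z - M|^b by subadditivity of the power; below, the zero
    test function. *)
Lemma dHK_fin (S : symM R d) : exists2 D : R, 0 <= D &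
  dHK b \d_S gamma = D%:E /\
  D <= \int[P]_w (`|Z w - M| `^ b) + `|S - M| `^ b.
Proof.
set E := _ + _.
have iZ := integrable_growth ler01 (growth_powR_dist M).
have dE : (dHK b \d_S gamma <= E%:E)%E.
  apply: ge_ereal_sup => _ [h [hh h1 ->]]; rewrite lee_fin.
  have hS S1 S2 : `|h S1 - h S2| <= `|S1 - S2| `^ b.
    have [->|SS'] := eqVneq S1 S2; first by rewrite subrr normr0 powR_ge0.
    by move/holder_seminorm_le : h1 => /(_ _ _ SS'); rewrite mul1r.
  have gh : growth b 0 1 h by move=> S1 S2; rewrite expr0 !mul1r.
  have mh := growth_measurable b01 ler01 gh.
  rewrite (Rintegral_gamma ler01 gh) (Rintegral_dirac S mh).
  have ih := integrable_growth ler01 gh.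
  have ic (c : R) : P.-integrable setT (EFin \o cst c) by exact: finite_measure_integrable_cst.
  rewrite -(Rintegral_prob_cst P (h S)) -(RintegralB measurableT (ic (h S)) ih).
  have i1 := @integrableB _ _ _ P _ measurableT _ _ (ic (h S)) ih.
  rewrite (le_trans (le_normr_Rintegral measurableT i1))//.
  rewrite /E -[X in _ + X](Rintegral_prob_cst P) -(RintegralD measurableT iZ (ic _)).
  apply: le_Rintegral => //.
  - exact: (integrable_norm i1).
  - exact: (@integrableD _ _ _ P _ measurableT _ _ iZ (ic _)).
  move=> w _; rewrite (le_trans (hS _ _))//.
  rewrite (le_trans _ (powRD_le _ _ _))//.
  rewrite ge0_ler_powR ?nnegrE ?(ltW b0) ?addr_ge0//.
  by rewrite (distrC (Z w) M) [leRHS]addrC -[S - Z w](subrKA M) ler_normD.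
have d0 : (0 <= dHK b \d_S gamma)%E.
  apply: ereal_sup_ubound; exists (fun=> 0); split.
  - have : (holder_seminorm b (fun _ : symM R d => 0%R) <= 0%:E)%E.
      by apply/holder_seminorm_le => S1 S2 _; rewrite subrr normr0 mul0r.
    by move=> /le_lt_trans; apply; rewrite ltry.
  - by apply/holder_seminorm_le => S1 S2 _; rewrite subrr normr0 mul1r powR_ge0.
  - by rewrite !Rintegral_cst// !mul0r subrr normr0.
have dfin : dHK b \d_S gamma \is a fin_num.
  by rewrite ge0_fin_numE// (le_lt_trans dE)// ltry.
exists (fine (dHK b \d_S gamma)); first exact: fine_ge0.
by rewrite fineK//; split => //; rewrite -lee_fin fineK.
Qed.

Variables (h : symM R d -> R) (L : R).
Hypothesis L0 : 0 <= L.
Hypothesis hL : holder_seminorm b h = L%:E.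

Let gh : growth b 0 L h. Proof. exact: holder_seminorm_growth. Qed.

Let mehler_diff := mehler_diff P Z M h.

Let growth_diff t : 0 <= t -> growth b 0 (L * expR (- b * t)) (mehler_diff t).
Proof.
move=> t0 S S'; have := growth_mehler_diff mZ momZ b01 L0 gh S S' t0.
rewrite !expr0 mulr1; under eq_Rintegral do rewrite expr0.
by rewrite Rintegral_prob_cst !mulr1 mulrAC.
Qed.

Lemma mehler_diff_dHK t (S : symM R d) (D : R) : 0 <= t ->
  dHK b \d_S gamma = D%:E -> `|mehler_diff t S| <= L * D * expR (- b * t).
Proof.
(* For [L = 0] the normalization by [k] is impossible, but the difference then vanishes. *)
move=> t0 DE; have [L00|Ln0] := eqVneq L 0.
  have gh0 : growth b 0 0 h by rewrite -L00.
  have := mehler_diff_bound mZ momZ b01 (lexx 0) gh0 S t0.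
  by rewrite L00 !mul0r.
have Lgt0 : 0 < L by rewrite lt_def Ln0.
pose k := L * expR (- b * t).
have k0 : 0 < k by rewrite mulr_gt0// expR_gt0.
pose g (S' : symM R d) := k^-1 * mehler_diff t S'.
have gg : growth b 0 1 g.
  move=> S1 S2; rewrite /g -mulrBr normrM gtr0_norm ?invr_gt0// mul1r.
  rewrite ler_pdivrMl// (le_trans (growth_diff t0 _ _))//.
  by rewrite -mulrA.
have g1 : (holder_seminorm b g <= 1%:E)%E.
  by apply/holder_seminorm_le => S1 S2 _; have := gg S1 S2; rewrite expr0 mulr1.
have id := integrable_growth (ltW k0) (growth_diff t0).
have mean0 : \int[P]_w mehler_diff t (Z w) = 0.
  have iZ := integrable_growth L0 gh.
  have ic : P.-integrable setT (EFin \o cst (\int[P]_w h (Z w))).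
    exact: finite_measure_integrable_cst.
  apply: (@addIr _ (\int[P]_w h (Z w))); rewrite add0r.
  rewrite -[X in _ + X](Rintegral_prob_cst P) -(RintegralD measurableT id ic).
  rewrite -[RHS](mehler_invariant mZ vZ charZ momZ b01 L0 gh t0).
  apply: eq_Rintegral => w _.
  by rewrite /mehler_diff (mehler_diffE mZ momZ b01 L0 gh _ t0) subrK.
have mg := growth_measurable b01 ler01 gg.
have : (`|g S|%:E <= D%:E)%E.
  rewrite -DE; apply: ereal_sup_ubound; exists g; split => //.
    by rewrite /holder (le_lt_trans g1)// ltry.
  rewrite (Rintegral_gamma ler01 gg) (Rintegral_dirac S mg).
  by rewrite (RintegralZl k^-1 measurableT id) mean0 mulr0 subr0.
rewrite lee_fin /g normrM gtr0_norm ?invr_gt0// ler_pdivrMl//.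
by rewrite /k mulrAC.
Qed.

Lemma stein_mehler_dHK (S : symM R d) (D : R) : dHK b \d_S gamma = D%:E ->
  `|stein_mehler P Z M h S| <= b^-1 * L * D.
Proof.
move=> DE; rewrite /stein_mehler normrN.
have i1 := integrable_mehler_diff mZ momZ b01 L0 gh S.
rewrite (le_trans (@le_normr_Rintegral _ _ _ (@lebesgue_measure R) _ _
  (measurable_itv _) i1))//.
rewrite (_ : b^-1 * L * D = L * D * b^-1); last by ring.
have ie := integrable_expR_half_line b0.
rewrite -(Rintegral_expR_half_line b0) -RintegralZl//.
apply: le_Rintegral => //.
- exact: (integrable_norm i1).
- exact: (@integrableZl _ _ _ (@lebesgue_measure R) _ (measurable_itv _) _ _ ie).
- by move=> t; rewrite /= in_itv/= andbT => t0; exact: mehler_diff_dHK.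
Qed.

End holder_kantorovich.
Theorem theorem3p4 (R : realType) (d : nat) (d_gt0 : (0 < d)%N)
    (o : 'I_(qd d) -> 'I_d * 'I_d) (o_ordering : vecs_ordering o)
    (M Psi Sigma : symM R d) (Psi_pos : posdef Psi) (Sigma_pos : posdef Sigma)
    (comm_Psi_Sigma : Psi *m Sigma = Sigma *m Psi :> 'M[R]_d)
    (Ph Sh : symM R d)
    (Ph_sqrt : Ph *m Ph = Psi :> 'M[R]_d)
    (Sh_sqrt : Sh *m Sh = Sigma :> 'M[R]_d)
    (disp : measure_display) (T : measurableType disp) (P : probability T R)
    (B : R -> T -> 'M[R]_d) (B_brownian : brownian_matrix P B)
    (X : symM R d -> R -> T -> symM R d)
    (X_solution : forall Y : symM R d, ou_solution P B M Ph Sh Y (X Y))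
    (disp' : measure_display) (T' : measurableType disp')
    (P' : probability T' R) (Yinf : {RV P' >-> symM R d})
    (Yinf_law : symmetric_normal P' o Yinf M Psi Sigma) :
  (forall h : symM R d -> R,
    (exists2 b : R, 0 < b <= 1 & holder b h) \/
    (exists p : nat, lip_sym o p h) ->
    let Eh := \int[P']_w h (Yinf w) in
    let fh := stein_solution P X h Eh in
    [/\ forall (t : R) (Y : symM R d), 0 <= t -> semigroup_defined P X t h Y,
        P'.-integrable setT (fun w => (h (Yinf w))%:E),
        forall Y : symM R d, (@lebesgue_measure R).-integrable `[0, +oo[
          (fun t => (semigroup P X t h Y - Eh)%:E),
        forall (s : R) (Y : symM R d), 0 <= s -> semigroup_defined P X s fh Y &
        forall Y : symM R d,
          (semigroup P X s fh Y - fh Y) / s @[s --> 0^'+] --> h Y - Eh]) /\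
  (forall (h : symM R d -> R) (b : R), 0 < b <= 1 -> holder b h ->
    let gamma := distribution P' Yinf in
    let fh := stein_solution P X h (\int[P']_w h (Yinf w)) in
    forall Y : symM R d,
    [/\ finite_moment b (\d_Y),
        finite_moment b gamma,
        (`|fh Y|%:E <=
          (b^-1)%:E * holder_seminorm b h * dHK b (\d_Y) gamma)%E &
        ((b^-1)%:E * holder_seminorm b h * dHK b (\d_Y) gamma <=
          (b^-1)%:E * holder_seminorm b h *
          ('E_P'[fun w => (`|Yinf w - M| `^ b)%R] + (`|Y - M| `^ b)%:E))%E]).
Proof.
have mZ : measurable_fun setT Yinf by exact: measurable_funPT.
have vZ := sn_varianceZ Ph Sh.
have charZ := symmetric_normal_cos o_ordering Yinf_law Ph_sqrt Sh_sqrt.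
have momZ := symmetric_normal_moment o_ordering mZ Yinf_law Ph_sqrt Sh_sqrt.
(* The integrands over [0, +oo[ agree at every [t >= 0]; the growth of [h] supplies the
   measurability and integrability behind this. *)
have steinE b N C h : 0 < b <= 1 -> 0 <= C -> growth b N C h ->
    stein_solution P X h (\int[P']_w h (Yinf w)) = stein_mehler P' Yinf M h.
  move=> b01 C0 gh; have mh := growth_measurable b01 C0 gh.
  apply/funext => Y; congr (- _); apply: eq_Rintegral => t.
  rewrite inE/= in_itv/= andbT => t0.
  rewrite (semigroup_mehler B_brownian X_solution mZ charZ Y mh t0).
  by rewrite (mehler_diffE mZ momZ b01 C0 gh Y t0).
split=> [h hh /=|h b b01 hb gamma /= Y].
  have [b [N [C [b01 C0 gh]]]] : exists b N C, [/\ 0 < b <= 1, 0 <= C & growth b N C h].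
    case: hh => [[b b01 /holder_growth[C C0 gh]]|[p /(lip_sym_growth o_ordering)[C C0 gh]]].
      by exists b, 0%N, C.
    by exists 1, p, C; split => //; rewrite ltr01 lexx.
  have mh := growth_measurable b01 C0 gh.
  (* The Stein solution now takes the place of [h] in the results on laws and integrability; these
     ask for a nonnegative constant, hence [Cf0]. *)
  have gf := growth_stein_mehler mZ momZ b01 C0 gh.
  rewrite (steinE b N C h b01 C0 gh).
  have Cf0 : 0 <= C * (1 + 4 * `|M|) ^+ N *
      (\int[P']_w (noise_size Yinf M w ^+ N)) / b.
    have b0 : 0 <= b by apply: ltW; case/andP: b01.
    have z0 : 0 <= \int[P']_w (noise_size Yinf M w ^+ N).
      by apply: Rintegral_ge0 => w _; rewrite exprn_ge0 ?noise_size_ge0.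
    by rewrite !mulr_ge0 ?invr_ge0// exprn_ge0// addr_ge0// mulr_ge0.
  have mf := growth_measurable b01 Cf0 gf.
  split.
  - move=> t Y t0.
    apply: (semigroup_defined_mehler B_brownian X_solution mZ charZ mh t0).
    exact: (integrable_mehler mZ momZ b01 C0 gh Y t0).
  - exact: (integrable_stationary mZ momZ b01 C0 gh).
  - move=> Y; apply: eq_integrable (integrable_mehler_diff mZ momZ b01 C0 gh Y) => // t.
    rewrite inE/= in_itv/= andbT => t0.
    rewrite (semigroup_mehler B_brownian X_solution mZ charZ Y mh t0).
    by rewrite (mehler_diffE mZ momZ b01 C0 gh Y t0).
  - move=> s Y s0.
    apply: (semigroup_defined_mehler B_brownian X_solution mZ charZ mf s0).
    exact: (integrable_mehler mZ momZ b01 Cf0 gf Y s0).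
  - move=> Y; have := stein_mehler_equation mZ vZ charZ momZ b01 C0 gh (S:=Y).
    apply: cvg_trans; apply: near_eq_cvg; near=> s.
    have s0 : 0 <= s by near: s; exact: nbhs_right_ge.
    by rewrite (semigroup_mehler B_brownian X_solution mZ charZ Y mf s0).
(* [L] is the seminorm itself and [D] the distance itself, not upper bounds, since both occur in the
   inequalities to prove. *)
have [L L0 hL] := holder_seminorm_fin d_gt0 hb.
have gh := holder_seminorm_growth L0 hL.
have [D D0 [DE Dle]] := dHK_fin b01 momZ Y.
rewrite (steinE b 0%N L h b01 L0 gh) hL DE; split.
- exact: finite_moment_dirac.
- exact: (finite_moment_gamma b01 momZ).
- rewrite -!EFinM lee_fin.
  exact: (stein_mehler_dHK b01 vZ charZ momZ L0 hL DE).
- have iZ := integrable_stationary mZ momZ b01 ler01 (growth_powR_dist b01 M).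
  have -> : ('E_P'[fun w => (`|Yinf w - M| `^ b)%R] =
      (\int[P']_w (`|Yinf w - M| `^ b))%:E)%E.
    by rewrite unlock /Rintegral fineK//; exact: integrable_fin_num.
  rewrite -EFinD -!EFinM lee_fin ler_wpM2l// mulr_ge0// invr_ge0 ltW//.
  by case/andP: b01.
Unshelve. all: by end_near. Qed.
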